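(* Let $0<r<1$ and $\lambda>0$. The density function of (the absolutely continuous part of) $\mu_{C_\lambda^{QW}}$ is given by $$p_{C_\lambda^{QW}}(x)=\frac{\widetilde\omega_1\,P(x-\widetilde\alpha_2)}{\left[x-\widetilde\alpha_1-\widetilde\omega_1R(x-\widetilde\alpha_2)\right]^2+\left[\pi\widetilde\omega_1P(x-\widetilde\alpha_2)\right]^2}$$ for $x\in[S_-,S_+]:=[\widetilde\alpha-2\sqrt{\widetilde\omega},\widetilde\alpha+2\sqrt{\widetilde\omega}]$. Moreover: (1) If $0<\lambda\le\Lambda_-(r)$, let $x_0$ be the unique zero of $f$ in $(0,S_-]$ and $x_1$ the unique zero of $g$ in $(\widetilde\alpha_1,(\sqrt{\omega_1}+\sqrt\lambda)^2)$. Then $x_0\in\sigma(C_\lambda^{QW})\cap(0,S_-]$, $x_1\in\sigma(C_\lambda^{QW})\cap(\widetilde\alpha_1,(\sqrt{\omega_1}+\sqrt\lambda)^2)$ and $$\mu_{C_\lambda^{QW}}(dx)=\mu_{C_\lambda^{QW}}(\{x_0\})\delta_{x_0}(dx)+\mu_{C_\lambda^{QW}}(\{x_1\})\delta_{x_1}(dx)+p_{C_\lambda^{QW}}(x)\,dx.$$ (2) If $\Lambda_-(r)<\lambda<\Lambda_+(r)$, let $x_1$ be the unique zero of $g$ in $(\widetilde\alpha_1,(\sqrt{\omega_1}+\sqrt\lambda)^2)$. Then $x_1\in\sigma(C_\lambda^{QW})\cap(\widetilde\alpha_1,(\sqrt{\omega_1}+\sqrt\lambda)^2)$ and $$\mu_{C_\lambda^{QW}}(dx)=\mu_{C_\lambda^{QW}}(\{x_1\})\delta_{x_1}(dx)+p_{C_\lambda^{QW}}(x)\,dx.$$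 (3) If $\lambda\ge\Lambda_+(r)$, let $x_2$ be the unique zero of $g$ in $[S_+,(\sqrt{\omega_1}+\sqrt\lambda)^2)$. Then $x_2\in\sigma(C_\lambda^{QW})\cap[S_+,(\sqrt{\omega_1}+\sqrt\lambda)^2)$ and $$\mu_{C_\lambda^{QW}}(dx)=\mu_{C_\lambda^{QW}}(\{x_2\})\delta_{x_2}(dx)+p_{C_\lambda^{QW}}(x)\,dx.$$
   Context: Fix $r\in(0,1)$ and let $\omega_1=1-\sqrt{1-r^2}$, $\omega_2=\frac{\sqrt{1-r^2}}{2}\omega_1$, $\omega=\frac{r^2}{4}$, and $\omega_n=\omega$ for $n\ge3$. Let $\mathcal H$ be a complex Hilbert space with complete orthonormal system $\{\Phi_n\}_{n\ge0}$, and let $B_+^{QW},B_-^{QW}$ be the bounded operators with $B_+^{QW}\Phi_n=\sqrt{\omega_{n+1}}\,\Phi_{n+1}$ ($n\ge0$), $B_-^{QW}\Phi_n=\sqrt{\omega_n}\,\Phi_{n-1}$ ($n\ge1$), $B_-^{QW}\Phi_0=0$; they are mutually adjoint. For $\lambda>0$ put $C_\lambda^{QW}=(B_-^{QW}+\sqrt\lambda I)(B_+^{QW}+\sqrt\lambda I)$, with spectrum $\sigma(C_\lambda^{QW})$ and spectral distribution $\mu_{C_\lambda^{QW}}(B)=\langle\Phi_0,E(B)\Phi_0\rangle$, $E$ being its spectral measure. Notation: $\widetilde\alpha_1=\lambda+\omega_1$, $\widetilde\alpha_2=\lambda+\omega_2$, $\widetilde\alpha=\lambda+\omega$, $\widetilde\omega_1=\lambda\omega_1$,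 $\widetilde\omega_2=\lambda\omega_2$, $\widetilde\omega=\lambda\omega$. With $t=\sqrt{1-r^2}$, $\Lambda_-(r)=\left(\frac{r(1-t)(3-t)}{4(t^2-t+2)}\right)^2$ and $\Lambda_+(r)=\left(\frac{(1-t)(3-t)}{4r}\right)^2$. Put $s=\widetilde\omega_2$, $a=\widetilde\alpha-\widetilde\alpha_2$, $b=\widetilde\omega-\widetilde\omega_2$. For $y\in[a-2\sqrt{s+b},a+2\sqrt{s+b}]$, $$R(y)=\frac{(s+2b)y+sa}{2(by^2+say+s^2)},\qquad P(y)=\frac{s\sqrt{4(s+b)-(y-a)^2}}{2\pi(by^2+say+s^2)},$$ and $P(y)=0$ for other $y$ (these are the real part, and $-1/\pi$ times the imaginary part, of the boundary value of the Cauchy transform of the free Meixner distribution with parameters $s,a,b$). Densities are understood up to Lebesgue-null sets, and $p_{C_\lambda^{QW}}$ is $0$ outside $[S_-,S_+]$. The functions $f$ and $g$ are $$f(x)=\frac1{x-\widetilde\alpha_1}-\frac1{\widetilde\omega_1}\left(x-\widetilde\alpha_2-\widetilde\omega_2\frac{x-\widetilde\alpha+\sqrt{(x-\widetilde\alpha)^2-4\widetilde\omega}}{2\widetilde\omega}\right),\quad x<\widetilde\alpha-2\sqrt{\widetilde\omega},$$ $$g(x)=\frac1{x-\widetilde\alpha_1}-\frac1{\widetilde\omega_1}\left(x-\widetilde\alpha_2-\widetilde\omega_2\frac{x-\widetilde\alpha-\sqrt{(x-\widetilde\alpha)^2-4\widetilde\omega}}{2\widetilde\omega}\right),\quad x>\widetilde\alpha+2\sqrt{\widetilde\omega},\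 x\ne\widetilde\alpha_1,$$ with values at the endpoints $S_-$ (for $f$) and $S_+$ (for $g$) given by the limits. The zeros $x_0,x_1,x_2$ named in the claim exist and are unique in the stated ranges of $\lambda$. *)

(* Defs.v *)
From HB Require Import structures.
From mathcomp Require Import all_boot all_order all_algebra.
From mathcomp Require Import all_classical all_reals all_analysis.
From mathcomp Require Import complex.

Set Implicit Arguments.
Unset Strict Implicit.
Unset Printing Implicit Defensive.

Import Order.TTheory GRing.Theory Num.Theory.
Import numFieldNormedType.Exports.

Local Open Scope classical_set_scope.
Local Open Scope ring_scope.
Local Open Scope complex_scope.

(* A complex Hilbert space is a complete normed module [H] over [R[i]] together
   with a positive definite hermitian form [dot] (linear in its first argument)
   that induces the norm; see [norm_of_dot]. *)
Section hilbert.
Context {R : realType} {H : completeNormedModType R[i]}.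
Variable dot : {dot H for Num.conj}.

Definition norm_of_dot := forall v : H, `|v| ^+ 2 = dot v v.

Definition complete_orthonormal (Phi : nat -> H) :=
  (forall m n, dot (Phi m) (Phi n) = (m == n)%:R) /\
  (forall v, (forall n, dot v (Phi n) = 0) -> v = 0).

Definition bounded_op (T : H -> H) :=
  exists M : R[i], forall v, `|T v| <= M * `|v|.

Definition spectrum (T : H -> H) : set R[i] :=
  [set z | ~ exists S : {linear H -> H},
     [/\ bounded_op S, forall v, S (T v - z *: v) = v
       & forall v, T (S v) - z *: S v = v]].

Definition orthogonal_projection (T : H -> H) :=
  (forall v, T (T v) = T v) /\ (forall u v, dot (T u) v = dot u (T v)).

(* The values of [E] on non-measurable sets are irrelevant. *)
Definition projection_valued_measure (E : set R -> {linear H -> H}) :=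
  [/\ forall B, measurable B -> orthogonal_projection (E B),
      (forall v, E set0 v = 0) /\ (forall v, E setT v = v),
      forall A B, measurable A -> measurable B ->
        forall v, E (A `&` B) v = E A (E B v)
    & forall F : (set R)^nat, (forall n, measurable (F n)) ->
        trivIset setT F ->
        forall v, series (fun n => E (F n) v) @ \oo --> E (\bigcup_n F n) v].

(* B |-> <v, E(B) v>; the number [dot (E B v) v] is real for measurable [B]. *)
Definition spectral_distribution (E : set R -> {linear H -> H}) (v : H) :
    set R -> \bar R :=
  fun B => (complex.Re (dot (E B v) v))%:E.

(* [E] is the spectral measure of the bounded self-adjoint operator [T]:
   a compactly supported projection-valued measure with T = \int x E(dx), the
   latter in the weak sense (by polarization the quadratic form suffices). *)
Definition is_spectral_measure (E : set R -> {linear H -> H}) (T : H -> H) :=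
  [/\ projection_valued_measure E,
      exists M : R, forall v, E [set` `[- M, M]] v = v
    & forall v, dot (T v) v =
        (fine (\int[spectral_distribution E v]_x x%:E))%:C].

End hilbert.

Section lebesgue_decomposition.
Context {R : realType}.
Local Open Scope ereal_scope.

Definition mutually_singular (m1 m2 : set R -> \bar R) :=
  exists N, [/\ measurable N, m1 N = 0 & m2 (~` N) = 0].

(* [p] is the density of the absolutely continuous part, with respect to the
   Lebesgue measure, of the measure [mu] *)
Definition is_ac_density (mu : set R -> \bar R) (p : R -> R) :=
  exists mac msg : {measure set R -> \bar R},
    [/\ mac `<< @lebesgue_measure R,
        mutually_singular msg (@lebesgue_measure R),
        forall B, measurable B -> mu B = mac B + msg B,
        measurable_fun setT p /\ (forall x, (0 <= p x)%R)
      & forall B, measurable B ->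
          mac B = \int[@lebesgue_measure R]_(x in B) (p x)%:E].

End lebesgue_decomposition.

Section zeros.
Context {R : realType}.

Definition is_unique_zero_in (h : R -> \bar R) (I : interval R) (x : R) :=
  unique (fun y => y \in I /\ h y = 0%E) x.

End zeros.

Section free_meixner.
Context {R : realType}.
Variables s a b : R.

Definition meixner_den (y : R) := b * y ^+ 2 + s * a * y + s ^+ 2.

Definition meixnerR (y : R) :=
  ((s + 2 * b) * y + s * a) / (2 * meixner_den y).

Definition meixnerP (y : R) :=
  if y \in `[a - 2 * Num.sqrt (s + b), a + 2 * Num.sqrt (s + b)] then
    s * Num.sqrt (4 * (s + b) - (y - a) ^+ 2) / (2 * pi * meixner_den y)
  else 0.

End free_meixner.

Section quantum_walk.
Context {R : realType}.
Variable r : R.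

Let t := Num.sqrt (1 - r ^+ 2).

(* the value at index 0 is never used *)
Definition om (n : nat) : R :=
  match n with
  | 1 => 1 - t
  | 2 => t / 2 * (1 - t)
  | _ => r ^+ 2 / 4
  end.

Definition LambdaM := (r * (1 - t) * (3 - t) / (4 * (t ^+ 2 - t + 2))) ^+ 2.
Definition LambdaP := ((1 - t) * (3 - t) / (4 * r)) ^+ 2.

Variable lam : R.

Definition alt1 := lam + om 1.
Definition alt2 := lam + om 2.
Definition alt := lam + om 3.
Definition omt1 := lam * om 1.
Definition omt2 := lam * om 2.
Definition omt := lam * om 3.

Definition Sminus := alt - 2 * Num.sqrt omt.
Definition Splus := alt + 2 * Num.sqrt omt.

Definition qwR : R -> R := meixnerR omt2 (alt - alt2) (omt - omt2).
Definition qwP : R -> R := meixnerP omt2 (alt - alt2) (omt - omt2).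

Definition qw_density (x : R) :=
  if x \in `[Sminus, Splus] then
    omt1 * qwP (x - alt2) /
    ((x - alt1 - omt1 * qwR (x - alt2)) ^+ 2
      + (pi * omt1 * qwP (x - alt2)) ^+ 2)
  else 0.

Definition f_formula (x : R) :=
  (x - alt1)^-1 - omt1^-1 *
    (x - alt2 - omt2 * ((x - alt + Num.sqrt ((x - alt) ^+ 2 - 4 * omt))
                        / (2 * omt))).

Definition g_formula (x : R) :=
  (x - alt1)^-1 - omt1^-1 *
    (x - alt2 - omt2 * ((x - alt - Num.sqrt ((x - alt) ^+ 2 - 4 * omt))
                        / (2 * omt))).

(* Endpoint values are limits taken in the extended reals: when
   [lam = LambdaP] one has [Splus = alt1] and [g] tends to +oo at [Splus],
   whereas [g_formula Splus] is a finite junk value. *)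
Definition qw_f (x : R) : \bar R :=
  if x == Sminus then lim ((f_formula y)%:E @[y --> Sminus^'-])
  else (f_formula x)%:E.

Definition qw_g (x : R) : \bar R :=
  if x == Splus then lim ((g_formula y)%:E @[y --> Splus^'+])
  else (g_formula x)%:E.

End quantum_walk.

(* (Bm + sqrt lam) (Bp + sqrt lam) *)
Definition qwC {R : realType} {H : completeNormedModType R[i]}
    (Bm Bp : H -> H) (lam : R) (v : H) : H :=
  let u := Bp v + (Num.sqrt lam)%:C *: v in
  Bm u + (Num.sqrt lam)%:C *: u.

(* Main.v *)
Require Import Defs.
From HB Require Import structures.
From mathcomp Require Import all_boot all_order all_algebra.
From mathcomp Require Import all_classical all_reals all_analysis.
From mathcomp Require Import measurable_realfun complex ring lra.

Import Order.TTheory GRing.Theory Num.Theory.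
Import numFieldNormedType.Exports.

Set Implicit Arguments.
Unset Strict Implicit.
Unset Printing Implicit Defensive.

Local Open Scope classical_set_scope.
Local Open Scope ring_scope.
Local Open Scope complex_scope.

(** Write T for the operator C. On the basis Phi it is a Jacobi operator whose
    coefficients are constant from index 2 on. Hence T - z is inverted on Phi 0
    by an explicit vector: if ze is the root, in the unit disc, of
    ze (z - al) = be (ze^2 + 1), then geometric coordinates in ze solve the
    recurrence far out, and matching the first two coordinates gives
    <(T - z)^-1 Phi 0, Phi 0> = - N / D with N and D polynomial in z and ze
    ([jacobi_resolvent], [green_num], [green_den]).

    The spectral measure is given only by <T v, v> = int x d<E v, v>. By
    polarization T is symmetric and commutes with every projection E B
    ([T_comm]), and on the range of E J it differs from c by at most d when J
    lies within d of c ([localization]). Cutting the line into short cells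
    then shows that (T - z) u = v implies
    |u|^2 = int |y - z|^-2 d<E v, v>(y) ([resolvent_integral]). For v = Phi 0
    and z = x + i e this identifies the Poisson integral of mu with the
    imaginary part of - N / D ([green_identity]).

    It remains to let e tend to 0. Integrated over an interval ]c, d[ whose
    endpoints are not atoms, the Poisson integral tends to pi times mu ]c, d[
    ([poisson_density]). The imaginary part of - N / D tends to pi times the
    density p, uniformly on intervals that avoid the two band edges and the
    real zeros of D outside the band ([green_uniform_limit],
    [qw_density_bd]). So mu and p dx agree off a finite set
    ([measure_off_points]), and since e Im (- N / D) tends to 0 wherever the
    boundary value of D is nonzero, even at an edge, atoms sit only at the
    zeros of D ([qw_mu_atom0], [qw_mu_formula]).

    Outside the band D is - (x - alt1) omt1 times f on the left and times g on
    the right ([qw_fg_den]). Both functions decrease strictly on each interval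
    that avoids alt1 ([qw_fg_decr]), so the zeros are counted by the signs of
    D at 0, at the band edges, at alt1 and at the upper bound U. The sign at
    the left edge changes at LambdaM ([qw_den_Sminus_le0]), and alt1 enters
    the band at LambdaP ([Splus_alt1]). At a zero x of D the truncations of
    the explicit vector are approximate eigenvectors, even when the vector
    itself leaves the space because |ze| = 1; so x is in the spectrum
    ([jacobi_spectrum]). *)

(** * Hilbert space preliminaries *)

Section complex_modulus.
Context {R : realType}.
Implicit Types (x e : R) (a b : R[i]).
Local Notation normc := Normc.normc.

Lemma normc_ge0 (a : R[i]) : 0 <= normc a.
Proof. by case: a => x y; exact: sqrtr_ge0. Qed.

Lemma normcX (a : R[i]) n : normc (a ^+ n) = normc a ^+ n.
Proof.
elim: n => [|n IH]; first by rewrite !expr0 Normc.normc1.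
by rewrite !exprS Normc.normcM IH.
Qed.

Lemma normc_le (a : R[i]) : normc a <= `|complex.Re a| + `|complex.Im a|.
Proof.
case: a => x y /=; have h : 0 <= `|x| + `|y| by rewrite addr_ge0.
rewrite -(ger0_norm h) -sqrtr_sqr ler_wsqrtr// sqrrD !real_normK ?num_real//.
by rewrite lerD2r lerDl mulrn_wge0// mulr_ge0.
Qed.

Lemma normc_sq (a : R[i]) : normc a ^+ 2 = complex.Re a ^+ 2 + complex.Im a ^+ 2.
Proof. by case: a => x y /=; rewrite sqr_sqrtr// addr_ge0 ?sqr_ge0. Qed.

Lemma normc_real x : normc x%:C = `|x|.
Proof. by rewrite /= expr0n addr0 sqrtr_sqr. Qed.

Lemma normc_imag x e : normc ((x +i* e) - x%:C) = `|e|.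
Proof. by rewrite /= subrr expr0n add0r subr0 sqrtr_sqr. Qed.

Lemma normcB (a b : R[i]) : normc (a - b) = normc (b - a).
Proof. by rewrite -normcN opprB. Qed.

Lemma ler_normc_Im (a : R[i]) : `|complex.Im a| <= normc a.
Proof. by case: a => u v /=; rewrite -sqrtr_sqr ler_wsqrtr// lerDr sqr_ge0. Qed.

End complex_modulus.

Section hilbert_real.
Context {R : realType} {H : completeNormedModType R[i]}.
Variable dot : {dot H for Num.conj}.
Hypothesis hd : norm_of_dot dot.
Implicit Types u v w : H.

(** The norm of [H] takes its values in [R[i]]; estimates are made with its
    real part, and with the real scalar product [rdot]. *)
Definition hnorm v : R := complex.Re `|v|.
Definition rdot u v : R := complex.Re (dot u v).

Lemma hnormE v : `|v| = (hnorm v)%:C.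
Proof. by rewrite /hnorm RRe_real// normr_real. Qed.

Lemma hnorm_ge0 v : 0 <= hnorm v.
Proof. by rewrite -ler0c -hnormE. Qed.

Lemma hnormD u v : hnorm (u + v) <= hnorm u + hnorm v.
Proof. by rewrite -lecR rmorphD/= -!hnormE ler_normD. Qed.

Lemma hnormN v : hnorm (- v) = hnorm v.
Proof. by rewrite /hnorm normrN. Qed.

Lemma normc_complex (a : R[i]) : `|a| = (Normc.normc a)%:C.
Proof. by []. Qed.

Lemma hnormZ (a : R[i]) v : hnorm (a *: v) = Normc.normc a * hnorm v.
Proof.
by apply: complexI; rewrite rmorphM/= -!hnormE -normc_complex normrZ.
Qed.

Lemma hnorm_eq0 v : hnorm v = 0 -> v = 0.
Proof. by move=> h; apply/normr0_eq0; rewrite hnormE h. Qed.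

Lemma rdotDl u v w : rdot (u + v) w = rdot u w + rdot v w.
Proof. by rewrite /rdot linearDl raddfD. Qed.

Lemma rdotDr u v w : rdot w (u + v) = rdot w u + rdot w v.
Proof. by rewrite /rdot linearDr raddfD. Qed.

Lemma dotDl u v w : dot (u + v) w = dot u w + dot v w.
Proof. exact: linearDl. Qed.

Lemma dotNl u w : dot (- u) w = - dot u w.
Proof. exact: linearNl. Qed.

Lemma dotZl (a : R[i]) u v : dot (a *: u) v = a * dot u v.
Proof. exact: linearZl_LR. Qed.

Lemma dotZr (a : R[i]) u v : dot u (a *: v) = a^* * dot u v.
Proof. exact: linearZr_LR. Qed.

Lemma dotC u v : dot u v = (dot v u)^*.
Proof. by have := @hermitian_subproof _ _ _ _ dot u v; rewrite mul1r. Qed.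

Lemma rdotC u v : rdot u v = rdot v u.
Proof. by rewrite /rdot dotC; case: (dot v u). Qed.

Lemma rdotZl (a : R) u v : rdot (a%:C *: u) v = a * rdot u v.
Proof. by rewrite /rdot dotZl; case: (dot u v) => x y /=; ring. Qed.

Lemma rdotZr (a : R) u v : rdot u (a%:C *: v) = a * rdot u v.
Proof. by rewrite rdotC rdotZl rdotC. Qed.

Lemma rdotNl u v : rdot (- u) v = - rdot u v.
Proof. by rewrite /rdot linearNl raddfN. Qed.

Lemma rdotNr u v : rdot u (- v) = - rdot u v.
Proof. by rewrite /rdot linearNr raddfN. Qed.

Lemma rdotBl u v w : rdot (u - v) w = rdot u w - rdot v w.
Proof. by rewrite rdotDl rdotNl. Qed.

Lemma rdotBr u v w : rdot w (u - v) = rdot w u - rdot w v.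
Proof. by rewrite rdotDr rdotNr. Qed.

Lemma dotvv v : dot v v = (hnorm v ^+ 2)%:C.
Proof. by rewrite -hd hnormE rmorphXn. Qed.

Lemma rdotvv v : rdot v v = hnorm v ^+ 2.
Proof. by rewrite /rdot dotvv. Qed.

(** Imaginary parts are real scalar products too, so that everything below can
    be said with [rdot] alone. *)
Lemma Im_dot u v : complex.Im (dot u v) = rdot u ('i *: v).
Proof. by rewrite /rdot dotZr; case: (dot u v) => x y /=; ring. Qed.

Lemma rdotii u v : rdot ('i *: u) ('i *: v) = rdot u v.
Proof. by rewrite /rdot dotZr dotZl; case: (dot u v) => x y /=; ring. Qed.

Lemma rdot_eq0 u : (forall v, rdot u v = 0) -> u = 0.
Proof.
by move=> /(_ u); rewrite rdotvv => /eqP; rewrite sqrf_eq0 => /eqP/hnorm_eq0.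
Qed.

Lemma hnormD2 u v : hnorm (u + v) ^+ 2 = hnorm u ^+ 2 + hnorm v ^+ 2 + 2 * rdot u v.
Proof.
rewrite -!rdotvv rdotDl !rdotDr (rdotC v u); ring.
Qed.

Lemma cauchy_schwarz u v : `|rdot u v| <= hnorm u * hnorm v.
Proof.
have h (a b : H) : rdot a b <= hnorm a * hnorm b.
  have := hnormD a b; rewrite -(ler_pXn2r (n := 2))// ?nnegrE ?addr_ge0 ?hnorm_ge0//.
  rewrite hnormD2; lra.
by rewrite ler_norml h andbT lerNl -rdotNl (le_trans (h _ _))// hnormN.
Qed.

End hilbert_real.

(** * Projection-valued measures and their operators *)

Section spectral_measure.
Context {R : realType} {H : completeNormedModType R[i]}.
Variable dot : {dot H for Num.conj}.
Hypothesis hd : norm_of_dot dot.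
Variable E : set R -> {linear H -> H}.
Hypothesis hE : projection_valued_measure dot E.
Implicit Types (u v w : H) (A B : set R).
Local Notation rdot := (rdot dot).

Lemma E_idem B v : measurable B -> E B (E B v) = E B v.
Proof. by case: hE => h _ _ _ mB; case: (h B mB) => + _; exact. Qed.

Lemma E_sym B u v : measurable B -> dot (E B u) v = dot u (E B v).
Proof. by case: hE => h _ _ _ mB; case: (h B mB) => _; exact. Qed.

Lemma E_rsym B u v : measurable B -> rdot (E B u) v = rdot u (E B v).
Proof. by move=> mB; rewrite /rdot E_sym. Qed.

Lemma E_setI A B v : measurable A -> measurable B -> E (A `&` B) v = E A (E B v).
Proof. by case: hE => _ _ h _ mA mB; exact: h. Qed.

Lemma E_set0 v : E set0 v = 0. Proof. by case: hE => _ [h _] _ _. Qed.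
Lemma E_setT v : E setT v = v. Proof. by case: hE => _ [_ h] _ _. Qed.

(** As a square the quantity <v, E B v> is visibly nonnegative and finite on
    every set, measurable or not, as a measure has to be. *)
Definition smeas v B : \bar R := (hnorm (E B v) ^+ 2)%:E.

Lemma smeas_rdot v B : measurable B -> smeas v B = (rdot (E B v) v)%:E.
Proof. by move=> mB; rewrite /smeas -(rdotvv hd) E_rsym// E_idem// rdotC. Qed.

Lemma spectral_distributionE v B : measurable B ->
  spectral_distribution dot E v B = smeas v B.
Proof. by move=> mB; rewrite smeas_rdot. Qed.

Let smeas0 v : smeas v set0 = 0%E.
Proof. by rewrite /smeas E_set0 /hnorm normr0 expr0n. Qed.

Let smeas_ge0 v B : (0 <= smeas v B)%E.
Proof. by rewrite lee_fin sqr_ge0. Qed.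

Lemma cvg_rdot (u_ : nat -> H) u v : u_ n @[n --> \oo] --> u ->
  rdot (u_ n) v @[n --> \oo] --> rdot u v.
Proof.
move=> cu; apply/cvgrPdist_lt => e e0.
have e'0 : 0 < e / (hnorm v + 1) by rewrite divr_gt0// ltr_wpDl ?hnorm_ge0.
have : (0 : R[i]) < (e / (hnorm v + 1))%:C by rewrite ltcR.
move/cvgrPdist_lt : cu => /[apply]; apply: filterS => n.
rewrite hnormE ltcR ltr_pdivlMr ?ltr_wpDl ?hnorm_ge0// => h.
rewrite -rdotBl; apply: le_lt_trans h.
apply: (le_trans (cauchy_schwarz hd _ _)).
by rewrite ler_wpM2l ?hnorm_ge0// lerDl.
Qed.

Let smeas_sigma v : semi_sigma_additive (smeas v).
Proof.
move=> F mF tF mUF; case: hE => _ _ _ /(_ F mF tF v)/(@cvg_rdot _ _ v) h.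
rewrite smeas_rdot//.
have -> : (fun n => (\sum_(0 <= i < n) smeas v (F i))%E) =
  EFin \o (fun n => rdot (series (fun n => E (F n) v) n) v).
  apply/funext => n /=; rewrite /series/= big_mkord.
  elim: n => [|n IH].
    by rewrite !big_ord0 big_nil /rdot linear0l.
  by rewrite big_ord_recr/= IH big_nat_recr//= rdotDl EFinD -smeas_rdot.
by apply: cvg_EFin => //; exact: nearW.
Qed.

HB.instance Definition _ v := isMeasure.Build _ _ _ (smeas v)
  (smeas0 v) (smeas_ge0 v) (@smeas_sigma v).

Let smeas_fin v : fin_num_fun (smeas v).
Proof. by []. Qed.

HB.instance Definition _ v := Measure_isFinite.Build _ _ _ (smeas v) (smeas_fin v).

Definition spmeas v : {finite_measure set R -> \bar R} := smeas v.

Lemma smeas_setT v : smeas v setT = (hnorm v ^+ 2)%:E.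
Proof. by rewrite /smeas E_setT. Qed.

Lemma smeas_E v A B : measurable A -> measurable B ->
  smeas (E B v) A = smeas v (A `&` B).
Proof. by move=> mA mB; rewrite /smeas E_setI. Qed.

End spectral_measure.

Section eq_measure_integral.
Local Open Scope ereal_scope.
Context d (T : measurableType d) (R : realType).
Import HBNNSimple.

(** The integral against a bare set function only looks at its values on
    measurable sets. This passes from the spectral distribution, which is
    arbitrary on nonmeasurable sets, to the measure [smeas]. *)
Lemma eq_setfun_integral (m1 m2 : set T -> \bar R) (f : T -> \bar R) :
  (forall A, measurable A -> m1 A = m2 A) ->
  \int[m1]_x f x = \int[m2]_x f x.
Proof.
move=> m12.
have h (h : {nnsfun T >-> R}) : sintegral m1 h = sintegral m2 h.
  by apply: eq_fsbigr => r _; rewrite m12.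
rewrite /integral; congr (ereal_sup _ - ereal_sup _);
  by apply/seteqP; split => x [g gf <-]; exists g => //; rewrite h.
Qed.

End eq_measure_integral.

Section spectral_operator.
Context {R : realType} {H : completeNormedModType R[i]}.
Variable dot : {dot H for Num.conj}.
Hypothesis hd : norm_of_dot dot.
Variable T : {linear H -> H}.
Variable E : set R -> {linear H -> H}.
Hypothesis hET : is_spectral_measure dot E T.
Implicit Types (u v w : H) (A B J : set R).
Local Notation rdot := (rdot dot).
Local Notation smeas := (smeas E).

Let hE : projection_valued_measure dot E. Proof. by case: hET. Qed.

Local Notation spmeas := (spmeas hd hE).

Lemma spmeas_ran_supp J w : measurable J -> E J w = w -> spmeas w (~` J) = 0%E.
Proof.
move=> mJ Jw; rewrite /= -Jw (smeas_E hE)//; last exact: measurableC.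
by rewrite /smeas setICl (E_set0 hE) /hnorm normr0 expr0n.
Qed.

Lemma spmeas_integrable_id v : (spmeas v).-integrable setT EFin.
Proof.
case: hET => _ [M hM] _; set K := [set` `[-M, M]] : set R.
have mK : measurable K by exact: measurable_itv.
apply/(@negligible_integrable _ _ _ _ _ (~` K)) => //.
- exact: measurableC.
- exact: spmeas_ran_supp.
rewrite setTD setCK.
have -> : EFin = EFin \o (@idfun R) by [].
apply: measurable_bounded_integrable => //.
  by rewrite ltey_eq fin_num_measure.
  exact: measurable_id.
exists M; split; first exact: num_real.
move=> y My x /=; rewrite /K /= in_itv/= => /andP[h1 h2].
rewrite ler_norml; apply/andP; split; lra.
Qed.

Lemma quadE v : rdot (T v) v = fine (\int[spmeas v]_x x%:E).
Proof.
case: hET => _ _ /(_ v); rewrite /rdot => -> /=; congr fine.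
by apply: eq_setfun_integral => A mA; rewrite (spectral_distributionE hd hE).
Qed.

Lemma quad_real v : rdot (T v) ('i *: v) = 0.
Proof. by rewrite -Im_dot; case: hET => _ _ /(_ v) ->. Qed.

(** Polarization: the quadratic form of T is real at u + i w as well as at u
    and i w. *)
Lemma T_sym u w : rdot (T u) w = rdot u (T w).
Proof.
have h a b : rdot (T a) ('i *: b) + rdot (T b) ('i *: a) = 0.
  have := quad_real (a + b); rewrite linearD scalerDr rdotDl !rdotDr !quad_real; lra.
have := h u ('i *: w); rewrite scalerA -expr2 sqr_i scaleN1r rdotNr linearZ/= rdotii.
rewrite (rdotC _ u (T w)); lra.
Qed.

(** The measure of a vector in the range of E J lives on J, so the integral of
    x against it is bounded by the bounds of J. *)
Lemma quad_bounds J (lo hi : R) w : measurable J -> E J w = w ->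
  (forall x, J x -> lo <= x <= hi) ->
  lo * hnorm w ^+ 2 <= rdot (T w) w <= hi * hnorm w ^+ 2.
Proof.
move=> mJ Jw hJ; rewrite quadE.
have mJC : measurable (~` J) by exact: measurableC.
have iJ := integrableS measurableT mJ (@subsetT _ _) (spmeas_integrable_id w).
have icst c : (spmeas w).-integrable J (EFin \o cst c).
  exact: finite_measure_integrable_cst.
have sJ : spmeas w J = (hnorm w ^+ 2)%:E by rewrite /= /smeas Jw.
rewrite (@negligible_integral _ _ _ _ _ (~` J))//; last 2 first.
  exact: spmeas_integrable_id.
  exact: spmeas_ran_supp.
rewrite setTD setCK -!lee_fin !fineK ?integrable_fin_num//.
rewrite (EFinM lo) (EFinM hi) -sJ; apply/andP; split.
  rewrite -integral_cst//; apply: le_integral => //; first exact: (icst lo).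
  by move=> x /set_mem /hJ/andP[]; rewrite lee_fin.
rewrite -integral_cst//; apply: le_integral => //; first exact: (icst hi).
by move=> x /set_mem /hJ/andP[]; rewrite lee_fin.
Qed.

Lemma ran_orth A B u w : measurable A -> measurable B ->
  E B u = u -> E (~` B) w = w -> rdot (E A u) (E A w) = 0.
Proof.
move=> mA mB Bu Bw; have mBC : measurable (~` B) by exact: measurableC.
rewrite -Bu -Bw (E_rsym hE)// (E_idem hE)// (E_rsym hE)//.
rewrite -(E_setI hE)// -(E_setI hE)//; last exact: measurableI.
rewrite (setIC B) -setIA setICr setI0 (E_set0 hE).
by rewrite /rdot linear0r.
Qed.

(** The measures of vectors in the ranges of complementary projections add
    up: their cross terms <E A u, E A w> vanish by [ran_orth]. *)
Lemma quad_orth_add B u w : measurable B -> E B u = u -> E (~` B) w = w ->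
  rdot (T (u + w)) (u + w) = rdot (T u) u + rdot (T w) w.
Proof.
move=> mB Bu Bw; rewrite !quadE -fineD ?integrable_fin_num//; last 2 first.
- exact: spmeas_integrable_id.
- exact: spmeas_integrable_id.
congr fine; rewrite -integral_measure_add//; last 2 first.
- exact: spmeas_integrable_id.
- exact: spmeas_integrable_id.
apply: eq_measure_integral => A mA _.
transitivity (measure_add (spmeas u) (spmeas w) A) => //.
rewrite measure_addE /= /smeas linearD (hnormD2 hd)//.
by rewrite (ran_orth mA mB)// mulr0 addr0.
Qed.

Lemma T_orth B u w : measurable B -> E B u = u -> E (~` B) w = w ->
  rdot (T u) w = 0.
Proof.
move=> mB Bu Bw; have := quad_orth_add mB Bu Bw.
rewrite linearD rdotDl !rdotDr (T_sym w u) (rdotC _ w (T u)); lra.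
Qed.

Lemma E_setC B w : measurable B -> E B w + E (~` B) w = w.
Proof.
move=> mB; have mBC : measurable (~` B) by exact: measurableC.
have e0 a : E B (E (~` B) a) = 0.
  by rewrite -(E_setI hE)// setICr (E_set0 hE).
have e1 a : E (~` B) (E B a) = 0.
  by rewrite -(E_setI hE)// setICl (E_set0 hE).
apply/esym/subr0_eq/hnorm_eq0/eqP; rewrite -sqrf_eq0; apply/eqP.
set x := _ - _.
have Bx : E B x = 0.
  by rewrite /x linearB linearD (E_idem hE)// e0 addr0 subrr.
have BCx : E (~` B) x = 0.
  by rewrite /x linearB linearD (E_idem hE)// e1 add0r subrr.
have := smeas_setT hE x; rewrite -(setUv B) => /(congr1 fine) /= <-.
have := measureU (spmeas x) mB mBC (setICr B).
by rewrite /= /smeas Bx BCx /hnorm normr0 expr0n adde0 => /(congr1 fine).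
Qed.

(** T maps the range of each projection into itself, because by [T_orth] the
    image is orthogonal to the complementary range. *)
Lemma T_comm B v : measurable B -> E B (T v) = T (E B v).
Proof.
move=> mB; have mBC : measurable (~` B) by exact: measurableC.
have e0 a : E B (T (E (~` B) a)) = 0.
  apply: (rdot_eq0 hd) => y; rewrite (E_rsym hE)// (@T_orth (~` B))//.
  - exact: (E_idem hE).
  - by rewrite setCK (E_idem hE).
have e1 a : E (~` B) (T (E B a)) = 0.
  apply: (rdot_eq0 hd) => y; rewrite (E_rsym hE)// (@T_orth B)//.
  - exact: (E_idem hE).
  - exact: (E_idem hE).
rewrite -{1}(E_setC v mB) !linearD/= e0 addr0.
by rewrite -[RHS](E_setC _ mB) e1 addr0.
Qed.

(** For u = T w - c w the form of T - c is bounded by d on w + u / d and on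
    w - u / d, both in the range of E J. The difference of the two values is
    4 |u|^2 / d, which gives |u| <= d |w|. *)
Lemma localization J (c d : R) w : measurable J -> E J w = w -> 0 < d ->
  (forall x, J x -> `|x - c| <= d) -> hnorm (T w - c%:C *: w) <= d * hnorm w.
Proof.
move=> mJ Jw d0 hJ.
have [u uE] : {u | u = T w - c%:C *: w} by exists (T w - c%:C *: w).
rewrite -uE.
have Ju : E J u = u by rewrite uE linearB T_comm// linearZ/= Jw.
have hq y : E J y = y ->
    `|rdot (T y) y - c * hnorm y ^+ 2| <= d * hnorm y ^+ 2.
  move=> Jy; have := @quad_bounds J (c - d) (c + d) y mJ Jy.
  have h x : J x -> c - d <= x <= c + d.
    by move=> /hJ; rewrite ler_norml => /andP[? ?]; apply/andP; split; lra.
  move=> /(_ h) /andP[h1 h2]; rewrite ler_norml; apply/andP; split; lra.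
(* the scale which balances the two terms |w|^2 and t^2 |u|^2 *)
set t := d^-1.
have Jp : E J (w + t%:C *: u) = w + t%:C *: u.
  by rewrite linearD linearZ/= Ju Jw.
have Jm : E J (w - t%:C *: u) = w - t%:C *: u.
  by rewrite linearB linearZ/= Ju Jw.
have uu : hnorm u ^+ 2 = rdot (T w) u - c * rdot w u.
  by rewrite -(rdotvv hd) {1}uE rdotBl rdotZl.
have n1 : hnorm (w + t%:C *: u) ^+ 2 =
    hnorm w ^+ 2 + t ^+ 2 * hnorm u ^+ 2 + 2 * (t * rdot w u).
  by rewrite (hnormD2 hd) rdotZr -!(rdotvv hd) rdotZl rdotZr; ring.
have n2 : hnorm (w - t%:C *: u) ^+ 2 =
    hnorm w ^+ 2 + t ^+ 2 * hnorm u ^+ 2 - 2 * (t * rdot w u).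
  by rewrite (hnormD2 hd) rdotNr rdotZr hnormN -!(rdotvv hd) rdotZl rdotZr; ring.
have q1 : rdot (T (w + t%:C *: u)) (w + t%:C *: u) =
    rdot (T w) w + t ^+ 2 * rdot (T u) u + 2 * (t * rdot (T w) u).
  rewrite linearD linearZ/= !rdotDl !rdotDr !rdotZl !rdotZr (T_sym u w).
  by rewrite (rdotC _ u (T w)); ring.
have q2 : rdot (T (w - t%:C *: u)) (w - t%:C *: u) =
    rdot (T w) w + t ^+ 2 * rdot (T u) u - 2 * (t * rdot (T w) u).
  rewrite linearB linearZ/= !rdotBl !rdotBr !rdotZl !rdotZr (T_sym u w).
  by rewrite (rdotC _ u (T w)); ring.
have := hq _ Jp; have := hq _ Jm; rewrite n1 n2 q1 q2 !ler_norml.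
move=> /andP[h1 _] /andP[_ h2].
have h3 : 4 * t * hnorm u ^+ 2 <= 2 * d * (hnorm w ^+ 2 + t ^+ 2 * hnorm u ^+ 2).
  by rewrite uu; rewrite uu in h1 h2; lra.
have dt : d * t = 1 by rewrite /t mulfV ?gt_eqF.
have h4 : hnorm u ^+ 2 <= (d * hnorm w) ^+ 2.
  have := ler_wpM2l (ltW d0) h3.
  have -> : d * (4 * t * hnorm u ^+ 2) = 4 * (d * t) * hnorm u ^+ 2 by ring.
  have -> : d * (2 * d * (hnorm w ^+ 2 + t ^+ 2 * hnorm u ^+ 2)) =
     2 * (d * hnorm w) ^+ 2 + 2 * (d * t) ^+ 2 * hnorm u ^+ 2 by ring.
  rewrite dt; lra.
by move: h4; rewrite ler_pXn2r ?nnegrE ?mulr_ge0 ?hnorm_ge0// ltW.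
Qed.

(** E J commutes with T, which is close to c on its range; so (T - z) u = v
    nearly says (c - z) E J u = E J v. *)
Lemma resolvent_slice J (x e c d : R) u v : measurable J -> 0 < d ->
  (forall y, J y -> `|y - c| <= d) ->
  T u - (x +i* e) *: u = v ->
  `|hnorm (E J v) - Normc.normc (c%:C - (x +i* e)) * hnorm (E J u)|
     <= d * hnorm (E J u).
Proof.
move=> mJ d0 hJ Tu.
have JJ : E J (E J u) = E J u by exact: (E_idem hE).
have := localization mJ JJ d0 hJ; set w := E J u.
have vE : E J v = (T w - c%:C *: w) + (c%:C - (x +i* e)) *: w.
  by rewrite -Tu linearB T_comm// linearZ/= scalerBl addrA subrK.
rewrite -hnormZ => h.
have h1 := hnormD (T w - c%:C *: w) ((c%:C - (x +i* e)) *: w).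
have h2 := hnormD (E J v) (- (T w - c%:C *: w)).
rewrite -vE in h1; rewrite {1}vE addrAC subrr add0r hnormN in h2.
by rewrite ler_norml; apply/andP; split; lra.
Qed.

End spectral_operator.

(** * The norm of a resolvent vector as an integral *)

Section cauchy_kernel.
Context {R : realType}.
Implicit Types x y c e : R.

(** This is |y - z|^-2 for z = x + i e; the Poisson kernel is e / pi times
    it. *)
Definition cker e x y : R := ((y - x) ^+ 2 + e ^+ 2)^-1.

Definition cdist e x y : R := Num.sqrt ((y - x) ^+ 2 + e ^+ 2).

Lemma cdist_ge e x y : `|e| <= cdist e x y.
Proof. by rewrite -sqrtr_sqr ler_sqrt ?addr_ge0 ?sqr_ge0// lerDr sqr_ge0. Qed.

Lemma cker_cdist e x y : cker e x y = (cdist e x y ^+ 2)^-1.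
Proof. by rewrite /cker sqr_sqrtr// addr_ge0 ?sqr_ge0. Qed.

Lemma cker_ge0 e x y : 0 <= cker e x y.
Proof. by rewrite invr_ge0 addr_ge0 ?sqr_ge0. Qed.

Lemma normc_cdist e x y : Normc.normc (y%:C - (x +i* e)) = cdist e x y.
Proof. by rewrite /= sub0r sqrrN. Qed.

Lemma cdist_lip e x y c : `|cdist e x y - cdist e x c| <= `|y - c|.
Proof.
have h a b : cdist e x a <= `|a - b| + cdist e x b.
  have abE : a%:C - (x +i* e) = (a - b)%:C + (b%:C - (x +i* e)).
    by rewrite rmorphB addrA subrK.
  rewrite -(normc_cdist e x a) abE; apply: (le_trans (le_normcD _ _)).
  by rewrite normc_cdist lerD2r /= expr0n addr0 sqrtr_sqr.
rewrite ler_norml; apply/andP; split; last by have := h y c; lra.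
by have := h c y; rewrite distrC; lra.
Qed.

Lemma continuous_cker e x : 0 < e -> continuous (cker e x).
Proof.
move=> e0 y; apply: cvgV.
  by rewrite gt_eqF// ltr_wpDl ?sqr_ge0 ?exprn_gt0.
apply: cvgD; last exact: cvg_cst.
apply: cvgM; apply: cvgB; [exact: cvg_id|exact: cvg_cst|exact: cvg_id|exact: cvg_cst].
Qed.

Lemma measurable_cker e x (D : set R) : 0 < e ->
  measurable_fun D (fun y => (cker e x y)%:E).
Proof.
move=> e0; apply/measurable_EFinP; apply: measurable_funTS.
by apply: continuous_measurable_fun; exact: continuous_cker.
Qed.

End cauchy_kernel.

Section spectral_resolvent.
Context {R : realType} {H : completeNormedModType R[i]}.
Variable dot : {dot H for Num.conj}.
Hypothesis hd : norm_of_dot dot.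
Variable T : {linear H -> H}.
Variable E : set R -> {linear H -> H}.
Hypothesis hE : projection_valued_measure dot E.
Hypothesis hET : is_spectral_measure dot E T.
Implicit Types (u v w : H) (A B J : set R).
Local Notation rdot := (rdot dot).
Local Notation spmeas := (spmeas hd hE).

Section fixed.
Variables (x e : R) (u v : H).
Hypothesis e0 : 0 < e.
Hypothesis Tu : T u - (x +i* e) *: u = v.

(** On a cell of length at most e t the kernel varies by a factor at most
    1 + 16 t, since |y - z| is at least e there; and by [resolvent_slice] the
    norms of E J v and E J u are then in the ratio |c - z|, up to a relative
    error t. *)
Lemma slice_compare J (t : R) : measurable J -> 0 < t <= 2^-1 ->
  (forall y y', J y -> J y' -> `|y - y'| <= e * t) ->
  (\int[spmeas v]_(y in J) (cker e x y)%:E <= (1 + 16 * t)%:E * spmeas u J)%E /\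
  (spmeas u J <= (1 + 16 * t)%:E * \int[spmeas v]_(y in J) (cker e x y)%:E)%E.
Proof.
move=> mJ /andP[t0 t1] dJ.
have [->|/set0P[c Jc]] := eqVneq J set0.
  by rewrite integral_set0 measure0 mule0.
have et0 : 0 < e * t by rewrite mulr_gt0.
have := resolvent_slice hd hET mJ et0 (fun y Jy => dJ y c Jy Jc) Tu.
rewrite normc_cdist.
set s := cdist e x c; set a := hnorm (E J v); set b := hnorm (E J u) => hab.
have b0 : 0 <= b by exact: hnorm_ge0.
have a0 : 0 <= a by exact: hnorm_ge0.
have se : e <= s by have := cdist_ge e x c; rewrite gtr0_norm.
have s0 : 0 < s by exact: lt_le_trans se.
have est : e * t <= s * t by rewrite ler_wpM2r// ltW.
have estb : e * t * b <= s * t * b by rewrite ler_wpM2r.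
move: hab; rewrite ler_norml => /andP[hab1 hab2].
have st0 : 0 < s * (1 - t) by rewrite mulr_gt0//; lra.
have st1 : 0 < s * (1 + t) by rewrite mulr_gt0//; lra.
have k y : J y -> s * (1 - t) <= cdist e x y <= s * (1 + t).
  move=> Jy; have := cdist_lip e x y c; have := dJ y c Jy Jc.
  rewrite -/s => h1 /le_trans/(_ h1); rewrite ler_norml => /andP[? ?].
  by apply/andP; split; lra.
have sv : spmeas v J = (a ^+ 2)%:E by [].
have su : spmeas u J = (b ^+ 2)%:E by [].
have I1 : (\int[spmeas v]_(y in J) (cker e x y)%:E <=
   (((s * (1 - t)) ^+ 2)^-1 * a ^+ 2)%:E)%E.
  rewrite EFinM -sv -integral_cst//; apply: ge0_le_integral => //;
    do ?[exact: measurable_cker|by move=> y _; rewrite lee_fin cker_ge0].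
  move=> y /k /andP[h1 h2]; rewrite lee_fin cker_cdist lef_pV2 ?posrE ?exprn_gt0//.
      by rewrite ler_pXn2r ?nnegrE ?sqrtr_ge0// ltW.
    exact: lt_le_trans h1.
have I2 : ((((s * (1 + t)) ^+ 2)^-1 * a ^+ 2)%:E <=
    \int[spmeas v]_(y in J) (cker e x y)%:E)%E.
  rewrite EFinM -sv -integral_cst//; apply: ge0_le_integral => //;
    do ?[exact: measurable_cker|by move=> y _; rewrite lee_fin ?cker_ge0// invr_ge0 sqr_ge0].
  move=> y /k /andP[h1 h2]; rewrite lee_fin cker_cdist lef_pV2 ?posrE ?exprn_gt0//.
      by rewrite ler_pXn2r ?nnegrE ?sqrtr_ge0// ltW.
    exact: lt_le_trans h1.
have ab1 : a <= s * (1 + t) * b by lra.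
have ab2 : s * (1 - t) * b <= a by lra.
have A1 : a ^+ 2 <= (s * (1 + t) * b) ^+ 2.
  by apply: lerXn2r; rewrite ?nnegrE//; exact: mulr_ge0 (ltW st1) b0.
have A2 : (s * (1 - t) * b) ^+ 2 <= a ^+ 2.
  by apply: lerXn2r; rewrite ?nnegrE//; exact: mulr_ge0 (ltW st0) b0.
have t2 : (1 + t) ^+ 2 <= (1 + 16 * t) * (1 - t) ^+ 2.
  have -> : (1 + 16 * t) * (1 - t) ^+ 2 =
     (1 + t) ^+ 2 + t * (1 - 2 * t) * (12 - 8 * t) by ring.
  by rewrite lerDl !mulr_ge0//; lra.
split.
  apply: (le_trans I1); rewrite su -EFinM lee_fin.
  rewrite mulrC ler_pdivrMr ?exprn_gt0//.
  apply: (le_trans A1).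
  have -> : (s * (1 + t) * b) ^+ 2 = s ^+ 2 * b ^+ 2 * (1 + t) ^+ 2 by ring.
  have -> : (1 + 16 * t) * b ^+ 2 * (s * (1 - t)) ^+ 2 =
    s ^+ 2 * b ^+ 2 * ((1 + 16 * t) * (1 - t) ^+ 2) by ring.
  by rewrite ler_wpM2l// mulr_ge0 ?sqr_ge0.
rewrite su; apply: (@le_trans _ _ ((1 + 16 * t)%:E * ((((s * (1 + t)) ^+ 2)^-1 * a ^+ 2)%:E))%E).
  rewrite -EFinM lee_fin mulrCA mulrC ler_pdivlMr ?exprn_gt0//.
  apply: (@le_trans _ _ ((1 + 16 * t) * (s * (1 - t) * b) ^+ 2)); last first.
    by rewrite ler_wpM2l//; lra.
  have -> : b ^+ 2 * (s * (1 + t)) ^+ 2 = s ^+ 2 * b ^+ 2 * (1 + t) ^+ 2 by ring.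
  have -> : (1 + 16 * t) * (s * (1 - t) * b) ^+ 2 =
    s ^+ 2 * b ^+ 2 * ((1 + 16 * t) * (1 - t) ^+ 2) by ring.
  by rewrite ler_wpM2l// mulr_ge0 ?sqr_ge0.
by rewrite lee_wpmul2l// lee_fin; lra.
Qed.

(* The cells have length e t; they are numbered by a bijection of the integers
   with a set of naturals, to index a series. *)
Let cell (t : R) n : set R := [set y | pickle (Num.floor (y / (e * t))) = n].

Let cell_dist (t : R) n y y' : 0 < t -> cell t n y -> cell t n y' -> `|y - y'| <= e * t.
Proof.
move=> t0; rewrite /cell/= => <- /(pcan_inj pickleK)/esym h.
have et0 : 0 < e * t by rewrite mulr_gt0.
have hf z : (Num.floor (z / (e * t)))%:~R * (e * t) <= z <
    ((Num.floor (z / (e * t)))%:~R + 1) * (e * t).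
  have := floor_itv (z / (e * t)).
  by rewrite intrD ler_pdivlMr// ltr_pdivrMr.
have := hf y; have := hf y'; rewrite h => /andP[? ?] /andP[? ?].
by rewrite ler_norml; apply/andP; split; lra.
Qed.

Let measurable_cell (t : R) n : 0 < t -> measurable (cell t n).
Proof.
move=> t0.
have et0 : 0 < e * t by rewrite mulr_gt0.
have [->|/set0P[c Jc]] := eqVneq (cell t n) set0; first exact: measurable0.
set k := Num.floor (c / (e * t)).
have -> : cell t n = [set` `[k%:~R * (e * t), (k%:~R + 1) * (e * t)[ ].
  apply/seteqP; split => y /=.
    rewrite in_itv/= -ler_pdivlMr// -ltr_pdivrMr//.
    move=> yn; have <- : Num.floor (y / (e * t)) = k.
      by apply: (pcan_inj pickleK); rewrite [LHS]yn [RHS]Jc.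
    by have := floor_itv (y / (e * t)); rewrite intrD.
  rewrite in_itv/= -ler_pdivlMr// -ltr_pdivrMr// => h.
  rewrite /cell/=; move: Jc; rewrite /cell/= => <-; congr pickle.
  by apply: floor_def; rewrite intrD.
exact: measurable_itv.
Qed.

Let cell_triv t : trivIset setT (cell t).
Proof. by move=> i j _ _ [y []]; rewrite /cell/= => <- <-. Qed.

Let cell_cover t : \bigcup_n (cell t n) = setT.
Proof.
by apply/seteqP; split => // y _; exists (pickle (Num.floor (y / (e * t)))).
Qed.

Let resolvent_compare (t : R) : 0 < t <= 2^-1 ->
  (\int[spmeas v]_y (cker e x y)%:E <= (1 + 16 * t)%:E * (hnorm u ^+ 2)%:E)%E /\
  ((hnorm u ^+ 2)%:E <= (1 + 16 * t)%:E * \int[spmeas v]_y (cker e x y)%:E)%E.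
Proof.
move=> ht; have t0 : 0 < t by case/andP: ht.
have h n := slice_compare (measurable_cell n t0) ht
  (fun y y' h1 h2 => cell_dist t0 h1 h2).
have k0 n : (0 <= \int[spmeas v]_(y in cell t n) (cker e x y)%:E)%E.
  by apply: integral_ge0 => y _; rewrite lee_fin cker_ge0.
have -> : (\int[spmeas v]_y (cker e x y)%:E =
   \sum_(n <oo) \int[spmeas v]_(y in cell t n) (cker e x y)%:E)%E.
  rewrite -ge0_integral_bigcup ?cell_cover//.
  - by move=> n; exact: measurable_cell.
  - exact: measurable_cker.
  - by move=> y _; rewrite lee_fin cker_ge0.
have -> : (hnorm u ^+ 2)%:E = (\sum_(n <oo) spmeas u (cell t n))%E.
  rewrite -(smeas_setT hE u) -(cell_cover t).
  apply: (measure_semi_bigcup (spmeas u)) => //.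
  - by move=> n; exact: measurable_cell.
  - by apply: bigcupT_measurable => n; exact: measurable_cell.
rewrite -!nneseriesZl//; split; apply: lee_nneseries => //.
- by move=> n _; case: (h n).
- by move=> n _; case: (h n).
Qed.

(** Summing over the cells shows that the two sides agree up to a factor
    1 + 16 t; then t tends to 0. *)
Lemma resolvent_integral :
  (\int[spmeas v]_y (cker e x y)%:E)%E = (hnorm u ^+ 2)%:E.
Proof.
have hhalf : 0 < (2^-1 : R) <= 2^-1 by rewrite lexx invr_gt0 ltr0n.
have [/le_lt_trans/(_ (ltry _)) Ioo _] := resolvent_compare hhalf.
have I0 : (0 <= \int[spmeas v]_y (cker e x y)%:E)%E.
  by apply: integral_ge0 => y _; rewrite lee_fin cker_ge0.
move: Ioo I0 resolvent_compare.
case: (\int[spmeas v]_y (cker e x y)%:E)%E => // i _; rewrite lee_fin => i0 h.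
congr EFin; set b := hnorm u ^+ 2 in h *.
have b0 : 0 <= b by exact: sqr_ge0.
have key (p q : R) : 0 <= p -> (forall t, 0 < t <= 2^-1 -> q <= (1 + 16 * t) * p) -> q <= p.
  move=> p0 hpq; apply/ler_addgt0Pr => d d0.
  have d'0 : 0 < d / (16 * (p + 1)) by rewrite divr_gt0//; lra.
  set t := Num.min 2^-1 (d / (16 * (p + 1))).
  have t0 : 0 < t <= 2^-1.
    by rewrite /t lt_min d'0 ge_min lexx invr_gt0 ltr0n.
  apply: (le_trans (hpq t t0)).
  have : t * (16 * (p + 1)) <= d.
    by rewrite -ler_pdivlMr; [rewrite /t ge_min lexx orbT|lra].
  case/andP: t0 => t0 _; lra.
apply/eqP; rewrite eq_le; apply/andP; split; apply: key => // t /h[].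
  by rewrite -EFinM lee_fin.
by rewrite -EFinM lee_fin.
Qed.

End fixed.

End spectral_resolvent.

(** * Jacobi operators with constant coefficients from index 2 on *)

Section jacobi.
Context {R : realType} {H : completeNormedModType R[i]}.
Variable dot : {dot H for Num.conj}.
Hypothesis hd : norm_of_dot dot.
Variable Phi : nat -> H.
Hypothesis Phi_orth : forall m n, dot (Phi m) (Phi n) = (m == n)%:R.
Variable T : {linear H -> H}.
Variables al1 al2 al b1 b2 be : R[i].
Hypothesis T0 : T (Phi 0%N) = al1 *: Phi 0%N + b1 *: Phi 1%N.
Hypothesis T1 : T (Phi 1%N) = al2 *: Phi 1%N + b2 *: Phi 2%N + b1 *: Phi 0%N.
Hypothesis T2 : T (Phi 2%N) = al *: Phi 2%N + be *: Phi 3%N + b2 *: Phi 1%N.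
Hypothesis T3 : forall n, T (Phi n.+3) =
  al *: Phi n.+3 + be *: Phi n.+4 + be *: Phi n.+2.
Hypothesis be0 : be != 0.
Variables z ze : R[i].
Hypothesis hz : ze * (z - al) = be * (ze ^+ 2 + 1).

Lemma dot_inj u v : (forall y, dot u y = dot v y) -> u = v.
Proof.
move=> h; apply/subr0_eq/(rdot_eq0 hd) => y.
by rewrite /rdot dotDl dotNl h subrr.
Qed.

(** The equation at index 1 forces the coordinate of Phi 0 once that of Phi 1
    is set to b1; the equation at index 0 then fails by [jacobi_den]. *)
Definition jacobi_num := z - al2 - b2 ^+ 2 / be * ze.
Definition jacobi_den := (z - al1) * jacobi_num - b1 ^+ 2.
Let ka := b1 * b2 / be.

(** The partial sums of the vector with coordinates [jacobi_num], b1 and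
    ka ze^m: the equation at index 2 gives the factor ka, and at the later
    indices the recurrence is the equation [hz] of ze. *)
Fixpoint jacobi_trunc (m : nat) : H :=
  if m is m'.+1 then jacobi_trunc m' + (ka * ze ^+ m) *: Phi m.+1
  else jacobi_num *: Phi 0%N + b1 *: Phi 1%N.

Let TZ a v : T (a *: v) = a *: T v. Proof. exact: linearZ. Qed.
Let TD u v : T (u + v) = T u + T v. Proof. exact: linearD. Qed.

(** Truncation leaves two errors at the end, of the size of the last
    coordinates. *)
Lemma jacobi_truncE m : T (jacobi_trunc m.+1) - z *: jacobi_trunc m.+1 =
  (- jacobi_den) *: Phi 0%N - (be * ka * ze ^+ m.+2) *: Phi m.+2
    + (be * ka * ze ^+ m.+1) *: Phi m.+3.
Proof.
elim: m => [|m IH].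
  rewrite [jacobi_trunc 1]/= !TD !TZ T0 T1 T2; apply: dot_inj => y.
  rewrite !(dotDl, dotNl, dotZl).
  set p0 := dot _ _; set p1 := dot _ _; set p2 := dot _ _; set p3 := dot _ _.
  apply/eqP; rewrite -subr_eq0; apply/eqP.
  transitivity (ka * (be * (ze ^+ 2 + 1) - ze * (z - al)) * p2); last first.
    by rewrite hz subrr mulr0 mul0r.
  rewrite /jacobi_den /jacobi_num /ka expr1; field; exact: be0.
rewrite [jacobi_trunc _]/= -/(jacobi_trunc m.+1) TD [X in _ - X]scalerDr opprD addrACA IH TZ T3.
apply: dot_inj => y; rewrite !(dotDl, dotNl, dotZl).
set p0 := dot _ _; set p1 := dot _ _; set p2 := dot _ _; set p3 := dot _ _.
apply/eqP; rewrite -subr_eq0; apply/eqP.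
transitivity (ka * ze ^+ m.+1 * (be * (ze ^+ 2 + 1) - ze * (z - al)) * p2); last first.
  by rewrite hz subrr mulr0 mul0r.
rewrite !(exprS ze); ring.
Qed.

Lemma jacobi_trunc_orth m k : (m.+1 < k)%N -> dot (jacobi_trunc m) (Phi k) = 0.
Proof.
elim: m => [|m IH] mk /=.
  rewrite dotDl !dotZl !Phi_orth (ltn_eqF (ltn_trans _ mk))// (ltn_eqF mk).
  by rewrite !mulr0 addr0.
by rewrite dotDl dotZl IH ?(ltn_trans _ mk)// Phi_orth (ltn_eqF mk) mulr0 addr0.
Qed.

Lemma dot_jacobi_trunc m : dot (jacobi_trunc m) (Phi 0%N) = jacobi_num.
Proof.
elim: m => [|m IH] /=.
  by rewrite dotDl !dotZl !Phi_orth/= mulr1 mulr0 addr0.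
by rewrite dotDl dotZl IH Phi_orth/= mulr0 addr0.
Qed.

Lemma hnorm_Phi k : hnorm (Phi k) = 1.
Proof.
apply/eqP; rewrite -(@eqrXn2 _ 2)// ?hnorm_ge0// expr1n; apply/eqP.
by apply: complexI; rewrite -(dotvv hd) Phi_orth eqxx.
Qed.

Lemma hnorm_jacobi_truncS m : hnorm (jacobi_trunc m.+1) ^+ 2 =
  hnorm (jacobi_trunc m) ^+ 2 + Normc.normc (ka * ze ^+ m.+1) ^+ 2.
Proof.
rewrite [jacobi_trunc _]/= (hnormD2 hd) hnormZ hnorm_Phi mulr1.
by rewrite /rdot dotZr jacobi_trunc_orth// mulr0 /= mulr0 addr0.
Qed.

Lemma hnorm_jacobi_residual m :
  hnorm (T (jacobi_trunc m.+1) - z *: jacobi_trunc m.+1 + jacobi_den *: Phi 0%N) <=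
  Normc.normc (be * ka) * (Normc.normc (ze ^+ m.+2) + Normc.normc (ze ^+ m.+1)).
Proof.
rewrite jacobi_truncE scaleNr addrC !addrA subrr add0r.
apply: (le_trans (hnormD _ _)).
by rewrite hnormN !hnormZ !hnorm_Phi !mulr1 !Normc.normcM -mulrDr.
Qed.

End jacobi.

Section geometric_limit.
Context {R : realType} {H : completeNormedModType R[i]}.

Lemma gt0_complexE (e : R[i]) : 0 < e -> exists2 e' : R, 0 < e' & e = e'%:C.
Proof.
case: e => a b; rewrite ltcE/= => /andP[/eqP-> a0]; by exists a.
Qed.

Lemma geometric_cvg (u : nat -> H) (C q : R) : 0 <= C -> 0 <= q < 1 ->
  (forall n, hnorm (u n.+1 - u n) <= C * q ^+ n) ->
  exists l : H, u @ \oo --> l.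
Proof.
move=> C0 /andP[q0 q1] hu.
have q1' : 0 < 1 - q by rewrite subr_gt0.
have bound n k : hnorm (u (n + k)%N - u n) <= C * q ^+ n / (1 - q).
  suff : hnorm (u (n + k)%N - u n) <= C * q ^+ n * ((1 - q ^+ k) / (1 - q)).
    move=> /le_trans; apply; rewrite mulrA ler_pM2r ?invr_gt0//.
    by rewrite ler_piMr ?mulr_ge0 ?exprn_ge0// gerBl exprn_ge0.
  elim: k => [|k IH].
    by rewrite addn0 subrr /hnorm normr0 expr0 subrr mul0r mulr0.
  have -> : u (n + k.+1)%N - u n = (u (n + k).+1 - u (n + k)%N) + (u (n + k)%N - u n).
    by rewrite addnS addrA subrK.
  apply: (le_trans (hnormD _ _)); apply: (le_trans (lerD (hu _) IH)).
  rewrite exprD mulrA -mulrDr ler_wpM2l ?mulr_ge0 ?exprn_ge0//.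
  rewrite -{1}(@mulfK _ (1 - q) _ (q ^+ k)) ?gt_eqF// -mulrDl.
  by rewrite ler_pM2r ?invr_gt0// exprS; lra.
suff : cvg (u @ \oo) by move=> h; exists (lim (u @ \oo)).
apply/cauchy_cvgP; apply/cauchy_exP => e /gt0_complexE[e' e'0 ->].
have : (fun n => C * q ^+ n / (1 - q)) @ \oo --> 0.
  have -> : 0 = C * 0 / (1 - q) :> R by rewrite mulr0 mul0r.
  apply: cvgM; last exact: cvg_cst.
  apply: cvgM; first exact: cvg_cst.
  by apply: cvg_expr; rewrite ger0_norm.
move=> /cvgrPdist_lt/(_ _ e'0) [N _ hN].
exists (u N); exists N => // n /= Nn.
rewrite -ball_normE /= hnormE ltcR -hnormN opprB -(subnKC Nn).
apply: (le_lt_trans (bound _ _)).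
have := hN N (leqnn N); rewrite sub0r normrN; apply: le_lt_trans.
exact: ler_norm.
Qed.

Lemma cvg_hnorm_eq0 (u : nat -> H) (l w : H) (a : nat -> R) (M : R) :
  0 <= M -> u @ \oo --> l -> a @ \oo --> 0 ->
  (forall n, hnorm w <= M * hnorm (l - u n) + a n) -> w = 0.
Proof.
move=> M0 /cvgrPdist_lt ul /cvgrPdist_lt a0 h.
apply: hnorm_eq0; apply/eqP; rewrite eq_le hnorm_ge0 andbT.
apply/ler_addgt0Pl => e e0; rewrite addr0.
have e2 : 0 < e / 2 by rewrite divr_gt0.
have e3 : 0 < e / 2 / (M + 1) by rewrite divr_gt0// ltr_wpDl.
have e3c : (0 : R[i]) < (e / 2 / (M + 1))%:C by rewrite ltcR.
have [N1 _ h1] := ul _ e3c; have [N2 _ h2] := a0 _ e2.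
have := h1 (maxn N1 N2) (leq_maxl _ _); rewrite /= hnormE ltcR.
rewrite ltr_pdivlMr ?ltr_wpDl// => h1'.
have := h2 (maxn N1 N2) (leq_maxr _ _); rewrite /= sub0r normrN => h2'.
apply: (le_trans (h (maxn N1 N2))).
have := ler_norm (a (maxn N1 N2)).
have := hnorm_ge0 (l - u (maxn N1 N2)); set x := hnorm _ in h1' *.
lra.
Qed.

End geometric_limit.

Section jacobi_resolvent.
Context {R : realType} {H : completeNormedModType R[i]}.
Variable dot : {dot H for Num.conj}.
Hypothesis hd : norm_of_dot dot.
Variable Phi : nat -> H.
Hypothesis Phi_orth : forall m n, dot (Phi m) (Phi n) = (m == n)%:R.
Variable T : {linear H -> H}.
Variable M : R.
Hypothesis T_bounded : forall v, hnorm (T v) <= M * hnorm v.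
Variables al1 al2 al b1 b2 be : R[i].
Hypothesis T0 : T (Phi 0%N) = al1 *: Phi 0%N + b1 *: Phi 1%N.
Hypothesis T1 : T (Phi 1%N) = al2 *: Phi 1%N + b2 *: Phi 2%N + b1 *: Phi 0%N.
Hypothesis T2 : T (Phi 2%N) = al *: Phi 2%N + be *: Phi 3%N + b2 *: Phi 1%N.
Hypothesis T3 : forall n, T (Phi n.+3) =
  al *: Phi n.+3 + be *: Phi n.+4 + be *: Phi n.+2.
Hypothesis be0 : be != 0.
Local Notation normc := Normc.normc.

Lemma normc_dot_Phi v : normc (dot v (Phi 0%N)) <= 2 * hnorm v.
Proof.
apply: (le_trans (normc_le _)); rewrite Im_dot mulr_natl mulr2n.
have P1 := hnorm_Phi hd Phi_orth 0.
apply: lerD; apply: (le_trans (cauchy_schwarz hd _ _)).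
  by rewrite P1 mulr1.
by rewrite hnormZ P1 /= expr0n expr1n add0r sqrtr1 !mulr1.
Qed.

(** For |ze| < 1 the truncations converge and their end errors vanish, so
    T - z maps the limit to - D Phi 0. *)
Lemma jacobi_resolvent (z ze : R[i]) : ze * (z - al) = be * (ze ^+ 2 + 1) ->
  normc ze < 1 -> jacobi_den al1 al2 b1 b2 be z ze != 0 ->
  exists2 u, T u - z *: u = Phi 0%N &
    dot u (Phi 0%N) = - jacobi_num al2 b2 be z ze / jacobi_den al1 al2 b1 b2 be z ze.
Proof.
move=> hz ze1 D0; set D := jacobi_den _ _ _ _ _ _ _; set N := jacobi_num _ _ _ _ _.
have q0 := normc_ge0 ze.
pose w := jacobi_trunc Phi al2 b1 b2 be z ze.
have [l wl] : exists l : H, w @ \oo --> l.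
  apply: (@geometric_cvg _ _ _ (normc (b1 * b2 / be * ze)) (normc ze)).
  - exact: normc_ge0.
  - by rewrite q0.
  - move=> n; rewrite /w /= addrAC subrr add0r hnormZ (hnorm_Phi hd)// mulr1.
    by rewrite exprS mulrA Normc.normcM normcX.
have cg (C : R) : (fun n => C * normc ze ^+ n) @ \oo --> 0.
  have -> : 0 = C * 0 :> R by rewrite mulr0.
  apply: cvgM; first exact: cvg_cst.
  by apply: cvg_expr; rewrite ger0_norm.
have wl1 : (fun n => w n.+1) @ \oo --> l by rewrite (cvg_shiftS w).
have lT : T l - z *: l + D *: Phi 0%N = 0.
  apply: (@cvg_hnorm_eq0 _ _ _ l _
    (fun n => normc (be * (b1 * b2 / be)) * (normc ze ^+ 2 + normc ze) * normc ze ^+ n)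
    (M + normc z) _ wl1 (cg _)).
    rewrite addr_ge0 ?normc_ge0//; have := T_bounded (Phi 0%N).
    by rewrite (hnorm_Phi hd)// mulr1; apply: le_trans; exact: hnorm_ge0.
  move=> n.
  have -> : T l - z *: l + D *: Phi 0%N =
     (T (l - w n.+1) - z *: (l - w n.+1)) +
     (T (w n.+1) - z *: w n.+1 + D *: Phi 0%N).
    by rewrite linearB scalerBr addrA -[X in _ = X + _]addrACA subrK -opprD subrK.
  apply: (le_trans (hnormD _ _)); apply: lerD.
    apply: (le_trans (hnormD _ _)); rewrite hnormN hnormZ mulrDl.
    by rewrite lerD2r; exact: T_bounded.
  have := hnorm_jacobi_residual hd Phi_orth T0 T1 T2 T3 be0 hz n.
  rewrite -/w -/D !normcX => /le_trans; apply.
  rewrite le_eqVlt; apply/orP; left; apply/eqP.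
  by rewrite !(exprS (normc ze)) expr0; ring.
have ldot : dot l (Phi 0%N) = N.
  have h v : hnorm (v *: Phi 0%N) = normc v.
    by rewrite hnormZ (hnorm_Phi hd)// mulr1.
  suff /eqP : (dot l (Phi 0%N) - N) *: Phi 0%N = 0.
    rewrite scaler_eq0 => /orP[|/eqP P0]; first by rewrite subr_eq0 => /eqP.
    by have := hnorm_Phi hd Phi_orth 0; rewrite P0 /hnorm normr0 => /eqP; rewrite eq_sym oner_eq0.
  apply: (@cvg_hnorm_eq0 _ _ _ l _ (cst 0) 2 _ wl (@cvg_cst _ _ _ _ _)) => //.
  move=> n; rewrite h.
  have -> : dot l (Phi 0%N) - N = dot (l - w n) (Phi 0%N).
    by rewrite dotDl dotNl /w (dot_jacobi_trunc Phi_orth).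
  by rewrite /= addr0; exact: normc_dot_Phi.
exists ((- D^-1) *: l).
  rewrite linearZ/= scalerA mulrC -scalerA -scalerBr.
  have -> : T l - z *: l = - (D *: Phi 0%N) by apply/eqP; rewrite -addr_eq0 lT.
  by rewrite scalerN scaleNr opprK scalerA mulVf// scale1r.
by rewrite dotZl ldot mulrC mulrN mulNr.
Qed.

(** If D vanishes, T - x maps the truncation w to its end errors, of size
    |ze|^m, whereas |w|^2 is at least m times the square of that size, as the
    coordinates decrease. So no bounded operator inverts T - x, and this also
    holds in the case |ze| = 1, where x need not be an eigenvalue. *)
Lemma jacobi_spectrum (x ze : R) :
  ze%:C * (x%:C - al) = be * (ze%:C ^+ 2 + 1) ->
  `|ze| <= 1 -> b1 != 0 -> b2 != 0 -> jacobi_den al1 al2 b1 b2 be x%:C ze%:C = 0 ->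
  spectrum T x%:C.
Proof.
move=> hz ze1 b10 b20 D0 [S [[C hC] SK _]].
have ze0 : ze != 0.
  apply/eqP => z0; move: hz; rewrite z0 mul0r expr0n add0r mulr1 => /eqP.
  by rewrite eq_sym (negbTE be0).
have [C' C'0 hC'] : exists2 C' : R, 0 <= C' & forall v, hnorm (S v) <= C' * hnorm v.
  case: C hC => c1 c2 hC; exists `|c1| => // v; have := hC v.
  rewrite !hnormE lecE => /andP[_]; rewrite /= mulr0 subr0 => /le_trans; apply.
  by rewrite ler_wpM2r ?hnorm_ge0// ler_norm.
pose w := jacobi_trunc Phi al2 b1 b2 be x%:C ze%:C.
pose k := normc (b1 * b2 / be).
have normc_gt0 (a : R[i]) : a != 0 -> 0 < normc a.
  move=> a0; rewrite lt_def normc_ge0 andbT; apply: contra_neq a0.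
  exact: Normc.eq0_normc.
have k0 : 0 < k by apply: normc_gt0; rewrite !mulf_neq0 ?invr_eq0.
set q := `|ze| in ze1; have q0 : 0 < q by rewrite normr_gt0.
have qn n : 0 < q ^+ n by rewrite exprn_gt0.
have low n : n%:R * (k * q ^+ n) ^+ 2 <= hnorm (w n) ^+ 2.
  elim: n => [|n IH]; first by rewrite mul0r sqr_ge0.
  rewrite /w (hnorm_jacobi_truncS hd Phi_orth) -/w Normc.normcM normcX normc_real -/k -/q.
  rewrite -natr1 mulrDl mul1r lerD2r; apply: le_trans IH.
  rewrite ler_wpM2l// lerXn2r ?nnegrE ?mulr_ge0// ?(ltW k0)// ?(ltW (qn _))//.
  by rewrite ler_pM2l// exprS ler_piMl// ltW.
have up n : hnorm (w n.+1) <= C' * (normc be * k * (2 * q ^+ n.+1)).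
  rewrite -[w n.+1]SK; apply: (le_trans (hC' _)); rewrite ler_wpM2l//.
  have := hnorm_jacobi_residual hd Phi_orth T0 T1 T2 T3 be0 hz n.
  rewrite D0 scale0r addr0 => /le_trans; apply.
  rewrite Normc.normcM -/k ler_wpM2l ?mulr_ge0 ?normc_ge0// !normcX normc_real -/q.
  by rewrite mulr_natl mulr2n lerD2r exprS ler_piMl// ltW.
have bnd n : n.+1%:R <= (2 * C' * normc be) ^+ 2.
  have := low n.+1.
  have h2 : hnorm (w n.+1) ^+ 2 <= (C' * (normc be * k * (2 * q ^+ n.+1))) ^+ 2.
    rewrite lerXn2r ?nnegrE ?hnorm_ge0//.
    by rewrite (le_trans _ (up n))// hnorm_ge0.
  move=> /le_trans/(_ h2).
  have -> : (C' * (normc be * k * (2 * q ^+ n.+1))) ^+ 2 =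
    (2 * C' * normc be) ^+ 2 * (k * q ^+ n.+1) ^+ 2 by ring.
  by rewrite ler_pM2r// exprn_gt0// mulr_gt0.
set B := _ ^+ 2 in bnd.
have [N _ /(_ N (leqnn N)) hN] := nbhs_infty_ger B.
have := bnd N; rewrite -natr1; move: hN; lra.
Qed.

End jacobi_resolvent.

(** * The equation of the geometric ratio *)

Section joukowski.
Context {R : realType}.
Implicit Types x e al be s : R.
Local Notation normc := Normc.normc.

(** The inverse of the Joukowski map: ze + 1 / ze = (z - al) / be, without
    division by ze. *)
Definition joukowski al be (z ze : R[i]) := ze * (z - al%:C) = be%:C * (ze ^+ 2 + 1).

Lemma joukowskiE al be x e a b : joukowski al be (x +i* e) (a +i* b) <->
  (a * (x - al) - b * e = be * (a ^+ 2 - b ^+ 2 + 1)) /\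
  (a * e + b * (x - al) = be * (2 * (a * b))).
Proof.
rewrite /joukowski; split.
  move/eqP; rewrite eq_complex /= !expr2 /= => /andP[/eqP h1 /eqP h2].
  by split; lra.
move=> [h1 h2]; apply/eqP; rewrite eq_complex /= ?expr2 /=.
by apply/andP; split; apply/eqP; lra.
Qed.

Lemma joukowski_Im al be x e a b : joukowski al be (x +i* e) (a +i* b) ->
  e * (a ^+ 2 + b ^+ 2) = be * (b * (a ^+ 2 + b ^+ 2 - 1)).
Proof.
move=> /joukowskiE[h1 h2].
have -> : e * (a ^+ 2 + b ^+ 2) =
  a * (a * e + b * (x - al)) - b * (a * (x - al) - b * e) by ring.
by rewrite h1 h2; ring.
Qed.

(** The product of the two roots is 1. *)
Lemma joukowski_root_exists al be (z : R[i]) : be != 0 ->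
  exists2 ze, joukowski al be z ze & normc ze <= 1.
Proof.
move=> be0; have bec : be%:C != 0 by rewrite eq_complex /= eqxx andbT.
pose W := (z - al%:C) / be%:C; pose s := sqrtc (W ^+ 2 - 4).
have s2 : s ^+ 2 = W ^+ 2 - 4 by rewrite sqr_sqrtc.
have zW : z - al%:C = be%:C * W by rewrite /W mulrC divfK.
have two : (2 : R[i]) != 0 by rewrite pnatr_eq0.
have root q : q ^+ 2 = W ^+ 2 - 4 -> joukowski al be z ((W + q) / 2).
  move=> q2; rewrite /joukowski zW.
  have -> : ((W + q) / 2) ^+ 2 = (W ^+ 2 + 2 * W * q + q ^+ 2) / 4 by field.
  by rewrite q2; field.
have prod : ((W + s) / 2) * ((W - s) / 2) = 1.
  have -> : ((W + s) / 2) * ((W - s) / 2) = (W ^+ 2 - s ^+ 2) / 4 by field.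
  by rewrite s2; field.
have := congr1 (@Normc.normc R) prod; rewrite Normc.normcM Normc.normc1 => prodn.
have [h|h] := leP (normc ((W + s) / 2)) 1.
  by exists ((W + s) / 2) => //; exact: root.
exists ((W - s) / 2); first by apply: root; rewrite sqrrN.
set p := normc _ in prodn h; set q := normc _ in prodn *.
have p0 : 0 < p by exact: lt_trans ltr01 h.
rewrite -(ler_pM2l p0) prodn mulr1; exact: ltW.
Qed.

(** The imaginary part of the equation, after multiplication by the conjugate
    of ze, ties the sign of Im ze to that of |ze| - 1. *)
Lemma joukowski_root_lower al be x e (ze : R[i]) : 0 < be -> 0 < e ->
  joukowski al be (x +i* e) ze -> normc ze <= 1 ->
  normc ze < 1 /\ complex.Im ze < 0.
Proof.
move=> be0 e0; case: ze => a b hz; have := joukowski_Im hz.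
have [h1 _] := (joukowskiE _ _ _ _ _ _).1 hz.
have n0 : 0 <= normc (a +i* b) by exact: sqrtr_ge0.
have n2 := normc_sq (a +i* b); rewrite [complex.Re _]/= [complex.Im _]/= in n2 *.
rewrite -!n2 => h le1.
have n2le : normc (a +i* b) ^+ 2 <= 1 by rewrite expr_le1.
set n := normc (a +i* b) in h n0 n2 n2le le1 *.
have npos : 0 < n.
  rewrite lt_def n0 andbT; apply/eqP => nz.
  move: n2; rewrite nz expr0n => /esym/eqP.
  rewrite paddr_eq0 ?sqr_ge0// !sqrf_eq0 => /andP[/eqP a0 /eqP b0].
  by move: h1; rewrite a0 b0; lra.
have L : 0 < be * (b * (n ^+ 2 - 1)) by rewrite -h mulr_gt0// exprn_gt0.
have L' : 0 < b * (n ^+ 2 - 1) by rewrite -(pmulr_rgt0 _ be0).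
have n1 : n ^+ 2 < 1.
  rewrite lt_def n2le andbT; apply/eqP => n21.
  by move: L'; rewrite -n21 subrr mulr0 ltxx.
split; first by move: n1; rewrite expr_lt1.
rewrite ltNge; apply/negP => b0.
by have := mulr_ge0 b0 (_ : 0 <= 1 - n ^+ 2); lra.
Qed.

(** The root for real x, as a limit from the upper half plane: both square
    roots are truncated at 0, so that the formula for the real part is right
    inside and outside the band [al - 2 be, al + 2 be]. The sign s only matters
    outside: 1 is the branch to the left of the band and -1 the branch to its
    right. *)
Definition bd_root_re s al be x :=
  (x - al + s * Num.sqrt ((x - al) ^+ 2 - 4 * be ^+ 2)) / (2 * be).
Definition bd_root_im al be x := - Num.sqrt (4 * be ^+ 2 - (x - al) ^+ 2) / (2 * be).
Definition bd_root s al be x := bd_root_re s al be x +i* bd_root_im al be x.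

(** The range in which the branch s is the correct boundary value. *)
Definition root_side s al be x :=
  (s = 1 /\ x <= al + 2 * be) \/ (s = -1 /\ al - 2 * be <= x).

Section boundary.
Variables (s al be x : R).
Hypothesis be0 : 0 < be.
Hypothesis hs : root_side s al be x.

Let s2 : s ^+ 2 = 1.
Proof. by case: hs => [[-> _]|[-> _]]; rewrite ?sqrrN expr1n. Qed.

Lemma bd_root_joukowski : joukowski al be x%:C (bd_root s al be x).
Proof.
apply/joukowskiE; rewrite /bd_root_re /bd_root_im mulr0 subr0 mulr0 add0r.
set X := x - al; have b2 : 2 * be != 0 by rewrite mulf_neq0 ?gt_eqF.
have be0' : be != 0 by rewrite gt_eqF.
have [h|h] := leP (X ^+ 2) (4 * be ^+ 2).
  rewrite (ler0_sqrtr (_ : X ^+ 2 - _ <= 0)) ?subr_le0// mulr0 addr0.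
  have := sqr_sqrtr (_ : 0 <= 4 * be ^+ 2 - X ^+ 2); rewrite subr_ge0 => /(_ h).
  set q := Num.sqrt _ => q2; split; last by field.
  have -> : be * ((X / (2 * be)) ^+ 2 - (- q / (2 * be)) ^+ 2 + 1) =
    be * ((X ^+ 2 - q ^+ 2) / (4 * be ^+ 2) + 1) by field.
  by rewrite q2; field.
rewrite [Num.sqrt (4 * _ - _)]ler0_sqrtr ?subr_le0 ?(ltW h)// oppr0 mul0r.
have := sqr_sqrtr (_ : 0 <= X ^+ 2 - 4 * be ^+ 2); rewrite subr_ge0 => /(_ (ltW h)).
set q := Num.sqrt _ => q2; split; last by rewrite mul0r !mulr0.
have -> : be * (((X + s * q) / (2 * be)) ^+ 2 - 0 ^+ 2 + 1) =
   be * ((X ^+ 2 + 2 * s * X * q + s ^+ 2 * q ^+ 2) / (4 * be ^+ 2) + 1) by field.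
by rewrite q2 s2; field.
Qed.

Lemma bd_root_im_le0 : bd_root_im al be x <= 0.
Proof. by rewrite /bd_root_im mulNr oppr_le0 divr_ge0 ?sqrtr_ge0// mulr_ge0// ltW. Qed.

Lemma normc_bd_root_in : (x - al) ^+ 2 <= 4 * be ^+ 2 -> normc (bd_root s al be x) = 1.
Proof.
move=> h; apply/eqP; rewrite -(@eqrXn2 _ 2)// ?sqrtr_ge0// normc_sq /=.
rewrite /bd_root_re /bd_root_im expr1n.
have be0' : be != 0 by rewrite gt_eqF.
rewrite (ler0_sqrtr (_ : _ - 4 * _ <= 0)) ?subr_le0// mulr0 addr0.
have := sqr_sqrtr (_ : 0 <= 4 * be ^+ 2 - (x - al) ^+ 2); rewrite subr_ge0 => /(_ h).
set q := Num.sqrt _ => q2.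
rewrite !expr_div_n sqrrN q2 -mulrDl addrC subrK exprMn.
by apply/eqP; field.
Qed.

Lemma bd_root_im_out : 4 * be ^+ 2 <= (x - al) ^+ 2 -> bd_root_im al be x = 0.
Proof. by move=> h; rewrite /bd_root_im ler0_sqrtr ?subr_le0// oppr0 mul0r. Qed.

Lemma bd_root_re_lt1 : 4 * be ^+ 2 < (x - al) ^+ 2 -> `|bd_root_re s al be x| < 1.
Proof.
move=> h; have h' := ltW h.
have b2 : 0 < 2 * be by rewrite mulr_gt0.
have := sqr_sqrtr (_ : 0 <= (x - al) ^+ 2 - 4 * be ^+ 2); rewrite subr_ge0 => /(_ h').
rewrite /bd_root_re; set q := Num.sqrt _ => q2; have q0 : 0 <= q by exact: sqrtr_ge0.
have key Y : 0 <= Y -> Y ^+ 2 = (x - al) ^+ 2 -> 0 < Y - q < 2 * be.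
  move=> Y0 Y2; rewrite -Y2 in q2 h.
  have Yb : 2 * be < Y.
    by rewrite -(@ltr_pXn2r _ 2)// ?nnegrE ?(ltW b2)//; lra.
  have qY : q < Y.
    rewrite -(@ltr_pXn2r _ 2)// ?nnegrE// q2 ltrBlDr ltrDl.
    by rewrite mulr_gt0// exprn_gt0.
  have qY2 : Y - 2 * be < q.
    rewrite -(@ltr_pXn2r _ 2)// ?nnegrE//; last by rewrite subr_ge0 ltW.
    rewrite q2.
    have -> : (Y - 2 * be) ^+ 2 = Y ^+ 2 - 4 * be ^+ 2 - 4 * be * (Y - 2 * be) by ring.
    by rewrite ltrBlDr ltrDl mulr_gt0// ?mulr_gt0// subr_gt0.
  by apply/andP; split; lra.
rewrite normrM [X in _ * X]gtr0_norm ?invr_gt0// ltr_pdivrMr// mul1r.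
have hX : 2 * be < `|x - al|.
  rewrite -(@ltr_pXn2r _ 2)// ?nnegrE ?(ltW b2)// real_normK ?num_real//; lra.
case: hs => -[-> hx].
  have xal : x - al <= 0.
    rewrite leNgt; apply/negP => hh; move: hX; rewrite gtr0_norm//; lra.
  have xal' : 0 <= - (x - al) by rewrite oppr_ge0.
  have /andP[k1 k2] := key _ xal' (sqrrN _).
  by rewrite mul1r ltr_norml; apply/andP; split; lra.
have xal : 0 <= x - al.
  rewrite leNgt; apply/negP => hh; move: hX; rewrite ltr0_norm//; lra.
have /andP[k1 k2] := key (x - al) xal erefl.
by rewrite mulN1r ltr_norml; apply/andP; split; lra.
Qed.

Lemma normc_bd_root_out : 4 * be ^+ 2 <= (x - al) ^+ 2 ->
  normc (bd_root s al be x) = `|bd_root_re s al be x|.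
Proof. by move=> h; rewrite /bd_root bd_root_im_out//= expr0n addr0 sqrtr_sqr. Qed.

Lemma normc_bd_root_le1 : normc (bd_root s al be x) <= 1.
Proof.
have [h|h] := leP ((x - al) ^+ 2) (4 * be ^+ 2); first by rewrite normc_bd_root_in.
by rewrite normc_bd_root_out ?(ltW h)// ltW// bd_root_re_lt1.
Qed.

(** A lower bound, by [root_gap_le], for the distance of the root ze to the
    other root at x, which is the inverse of the boundary value. Outside the
    band the gain comes from the modulus, inside from the imaginary part. *)
Definition root_gap := 1 - normc (bd_root s al be x) - bd_root_im al be x.

Lemma root_gap_gt0 : (x - al) ^+ 2 != 4 * be ^+ 2 -> 0 < root_gap.
Proof.
move=> h; rewrite /root_gap; have [h'|h'] := ltP ((x - al) ^+ 2) (4 * be ^+ 2).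
  rewrite normc_bd_root_in ?(ltW h')// subrr sub0r /bd_root_im mulNr opprK divr_gt0 ?mulr_gt0//.
  by rewrite sqrtr_gt0 subr_gt0.
rewrite bd_root_im_out// subr0 normc_bd_root_out// subr_gt0 bd_root_re_lt1//.
by rewrite lt_def h h'.
Qed.

Lemma root_gap_le (ze : R[i]) : normc ze <= 1 -> complex.Im ze <= 0 ->
  root_gap <= normc (ze * bd_root s al be x - 1).
Proof.
move=> n1 im0; rewrite /root_gap.
have [h|h] := leP ((x - al) ^+ 2) (4 * be ^+ 2); last first.
  rewrite bd_root_im_out ?(ltW h)// subr0.
  have := le_normcD (ze * bd_root s al be x) (1 - ze * bd_root s al be x).
  rewrite addrC subrK Normc.normc1 Normc.normcM -(normcN (1 - _)) opprB.
  have : normc ze * normc (bd_root s al be x) <= normc (bd_root s al be x).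
    by rewrite ler_piMl// normc_ge0.
  lra.
rewrite normc_bd_root_in// subrr sub0r.
have e1 : bd_root_re s al be x ^+ 2 + bd_root_im al be x ^+ 2 = 1.
  by have := normc_sq (bd_root s al be x); rewrite normc_bd_root_in// expr1n /= => <-.
have := bd_root_im_le0; rewrite /bd_root; move: e1 im0.
set c := bd_root_re _ _ _ _; set d := bd_root_im _ _ _; case: ze n1 => a b _ e1 /= b0 d0.
apply: (@le_trans _ _ `|b + d|); first by rewrite ler0_norm; lra.
rewrite -sqrtr_sqr ler_wsqrtr//.
have -> : (a * c - b * d - 1) ^+ 2 + (a * d + b * c - 0) ^+ 2 =
   (a ^+ 2 + b ^+ 2) * (c ^+ 2 + d ^+ 2) - 2 * (a * c - b * d) + 1 by ring.
rewrite e1 mulr1 -{2}e1.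
have -> : a ^+ 2 + b ^+ 2 - 2 * (a * c - b * d) + (c ^+ 2 + d ^+ 2) =
  (b + d) ^+ 2 + (a - c) ^+ 2 by ring.
by rewrite lerDl sqr_ge0.
Qed.

(** For the boundary value w, subtracting the equations of ze and of w
    factorizes into be (ze - w) (ze w - 1) = i e ze w. *)
Lemma joukowski_root_close e (ze : R[i]) : 0 < e -> joukowski al be (x +i* e) ze ->
  normc ze <= 1 ->
  be * (normc (ze - bd_root s al be x) * normc (ze * bd_root s al be x - 1)) <= e.
Proof.
move=> e0 hz n1.
have E : be%:C * ((ze - bd_root s al be x) * (ze * bd_root s al be x - 1)) =
   ze * bd_root s al be x * (0 +i* e).
  have xe : x +i* e = x%:C + (0 +i* e).
    by apply/eqP; rewrite eq_complex /= add0r addr0 !eqxx.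
  move: hz bd_root_joukowski; rewrite /joukowski xe; set w := bd_root _ _ _ _.
  set i := _ +i* e => h1 h2.
  apply/eqP; rewrite -subr_eq0; apply/eqP.
  transitivity (ze * (w * (x%:C - al%:C) - be%:C * (w ^+ 2 + 1)) -
    w * (ze * (x%:C + i - al%:C) - be%:C * (ze ^+ 2 + 1))); first by ring.
  by rewrite h1 h2 !subrr !mulr0 subrr.
have := congr1 (@Normc.normc R) E; rewrite !Normc.normcM.
have -> : normc be%:C = be by rewrite /= expr0n addr0 sqrtr_sqr gtr0_norm.
have -> : normc (0 +i* e) = e by rewrite /= expr0n add0r sqrtr_sqr gtr0_norm.
move=> ->; rewrite ler_piMl ?(ltW e0)// mulr_ile1 ?normc_ge0//.
exact: normc_bd_root_le1.
Qed.

End boundary.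

End joukowski.

(** * Boundary values of the Green function *)

Section green.
Context {R : realType}.
Variables al1 al2 al w1 w2 be : R.
Hypothesis be0 : 0 < be.
Hypothesis w10 : 0 < w1.
Hypothesis w20 : 0 < w2.
Implicit Types (x e s : R) (z ze : R[i]).
Local Notation normc := Normc.normc.
Local Notation z0 s := (bd_root s al be).

(** The expressions [jacobi_num] and [jacobi_den], with the off-diagonal
    entries given by their squares w1 and w2. *)
Definition green_num z ze := z - al2%:C - (w2 / be)%:C * ze.
Definition green_den z ze := (z - al1%:C) * green_num z ze - w1%:C.

(* Lipschitz estimates around a boundary point (x, zt): the constant K bounds
   the factors of D, and the closeness d is small against the lower bound eta
   for |D|. *)
Section perturb.
Variables (K d eta x : R) (z ze zt : R[i]).
Hypothesis d01 : 0 < d <= 1.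
Hypothesis hz : normc (z - x%:C) <= d.
Hypothesis hze : normc (ze - zt) <= d.
Hypothesis zt1 : normc zt <= 1.
Hypothesis ze1 : normc ze <= 1.
Hypothesis K1 : `|x - al1| + 1 <= K.
Hypothesis K2 : `|x - al2| + 1 + w2 / be <= K.
Hypothesis eta0 : 0 < eta.
Hypothesis hD : eta <= normc (green_den x%:C zt).
Let L := 1 + w2 / be.
Hypothesis hd : d * (K * L + K) <= eta / 2.

Let wb0 : 0 <= w2 / be. Proof. by rewrite divr_ge0// ltW. Qed.
Let K0 : 1 <= K. Proof. by have := normr_ge0 (x - al1); move: K1; lra. Qed.
Let d0 : 0 < d. Proof. by case/andP: d01. Qed.

Lemma perturb_N : normc (green_num z ze) <= K.
Proof.
have -> : green_num z ze = (x - al2)%:C + (z - x%:C) - (w2 / be)%:C * ze.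
  by rewrite /green_num rmorphB/=; ring.
apply: (le_trans (le_normcD _ _)); rewrite normcN Normc.normcM.
rewrite normc_real (ger0_norm wb0).
have := le_normcD (x - al2)%:C (z - x%:C); rewrite normc_real.
have := ler_wpM2l wb0 ze1; case/andP: d01 => _; move: hz K2; lra.
Qed.

Let N0_K : normc (green_num x%:C zt) <= K.
Proof.
rewrite /green_num -rmorphB; apply: (le_trans (le_normcD _ _)); rewrite normcN Normc.normcM.
rewrite !normc_real (ger0_norm wb0).
have := ler_wpM2l wb0 zt1; move: K2; lra.
Qed.

Let N_close : normc (green_num z ze - green_num x%:C zt) <= d * L.
Proof.
have -> : green_num z ze - green_num x%:C zt = (z - x%:C) - (w2 / be)%:C * (ze - zt).
  by rewrite /green_num; ring.
apply: (le_trans (le_normcD _ _)); rewrite normcN Normc.normcM normc_real (ger0_norm wb0).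
have := ler_wpM2l wb0 hze; rewrite /L; move: hz; lra.
Qed.

Let D_close : normc (green_den z ze - green_den x%:C zt) <= d * (K * L + K).
Proof.
have -> : green_den z ze - green_den x%:C zt = (z - al1%:C) * (green_num z ze - green_num x%:C zt) +
   (z - x%:C) * green_num x%:C zt by rewrite /green_den; ring.
apply: (le_trans (le_normcD _ _)); rewrite !Normc.normcM.
have zK : normc (z - al1%:C) <= K.
  have -> : z - al1%:C = (x - al1)%:C + (z - x%:C) by rewrite rmorphB/=; ring.
  apply: (le_trans (le_normcD _ _)); rewrite normc_real.
  case/andP: d01 => _; move: hz K1; lra.
rewrite mulrDr; apply: lerD.
  by rewrite mulrCA; apply: ler_pM => //; exact: normc_ge0.
by apply: ler_pM => //; exact: normc_ge0.
Qed.

Lemma perturb_D : eta / 2 <= normc (green_den z ze).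
Proof.
have := le_normcD (green_den z ze) (green_den x%:C zt - green_den z ze).
rewrite addrC subrK (normcB (green_den x%:C zt)); move: hD hd D_close; lra.
Qed.

Let green_diff (N N' D D' : R[i]) : D != 0 -> D' != 0 ->
  N / D - N' / D' = (N * D' - N' * D) * (D^-1 * D'^-1).
Proof. by move=> *; field; apply/andP. Qed.

(** The products of z - al1 with the two numerators cancel in N D' - N' D, up
    to the difference of the two values of z. *)
Lemma perturb_G : normc (green_num z ze / green_den z ze - green_num x%:C zt / green_den x%:C zt) <=
  d * (2 * (K ^+ 2 + w1 * L) / eta ^+ 2).
Proof.
have e2 : 0 < eta / 2 by rewrite divr_gt0.
have nz a : 0 < normc a -> a != 0.
  by apply: contraTneq => ->; rewrite Normc.normc0 ltxx.
have Dn : green_den z ze != 0 by apply: nz; exact: lt_le_trans perturb_D.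
have D0n : green_den x%:C zt != 0 by apply: nz; exact: lt_le_trans hD.
have -> : green_num z ze / green_den z ze - green_num x%:C zt / green_den x%:C zt =
  ((x%:C - z) * green_num z ze * green_num x%:C zt - w1%:C * (green_num z ze - green_num x%:C zt))
    * ((green_den z ze)^-1 * (green_den x%:C zt)^-1).
  by rewrite green_diff//; congr (_ * _); rewrite /green_den; ring.
rewrite !Normc.normcM !Normc.normcV.
have NK := perturb_N.
have num : normc ((x%:C - z) * green_num z ze * green_num x%:C zt -
      w1%:C * (green_num z ze - green_num x%:C zt))
   <= d * (K ^+ 2 + w1 * L).
  apply: (le_trans (le_normcD _ _)); rewrite normcN !Normc.normcM normc_real.
  rewrite (gtr0_norm w10) (normcB x%:C) mulrDr; apply: lerD.
    rewrite expr2 mulrA; apply: ler_pM => //; rewrite ?mulr_ge0 ?normc_ge0//.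
    by apply: ler_pM => //; rewrite ?normc_ge0.
  by rewrite mulrCA ler_wpM2l// ltW.
apply: (@le_trans _ _ (d * (K ^+ 2 + w1 * L) * ((eta / 2)^-1 * eta^-1))).
  apply: ler_pM => //; rewrite ?mulr_ge0 ?invr_ge0 ?normc_ge0//.
  apply: ler_pM; rewrite ?invr_ge0 ?normc_ge0// lef_pV2 ?posrE//.
  - exact: perturb_D.
  - exact: lt_le_trans perturb_D.
  - exact: lt_le_trans hD.
rewrite le_eqVlt; apply/orP; left; apply/eqP; field; by rewrite gt_eqF.
Qed.

End perturb.

(** Real and imaginary part of N, and |D|^2, at the boundary. *)
Definition bd_num_re s x := x - al2 - w2 / be * bd_root_re s al be x.
Definition bd_num_im x := - (w2 / be) * bd_root_im al be x.
Definition bd_den2 s x := ((x - al1) * bd_num_re s x - w1) ^+ 2 + ((x - al1) * bd_num_im x) ^+ 2.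

Lemma green_num_bd s x : green_num x%:C (z0 s x) = bd_num_re s x +i* bd_num_im x.
Proof.
apply/eqP; rewrite eq_complex /green_num /bd_root /bd_num_re /bd_num_im /=.
by apply/andP; split; apply/eqP; ring.
Qed.

Lemma green_den_bd s x : green_den x%:C (z0 s x) =
  ((x - al1) * bd_num_re s x - w1) +i* ((x - al1) * bd_num_im x).
Proof.
rewrite /green_den green_num_bd; apply/eqP; rewrite eq_complex /=.
by apply/andP; split; apply/eqP; ring.
Qed.

Lemma normc_green_den_bd s x : normc (green_den x%:C (z0 s x)) = Num.sqrt (bd_den2 s x).
Proof. by rewrite green_den_bd. Qed.

Lemma Im_green_bd s x : complex.Im (- (green_num x%:C (z0 s x) / green_den x%:C (z0 s x))) =
  w1 * bd_num_im x / bd_den2 s x.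
Proof.
rewrite green_num_bd green_den_bd /bd_den2 /=; set u := _ - w1; set v := _ * bd_num_im x.
move: (u ^+ 2 + v ^+ 2)^-1 => w; rewrite /u /v; ring.
Qed.

Lemma continuous_bd_root_re s : continuous (bd_root_re s al be).
Proof.
move=> x; apply: cvgM; last exact: cvg_cst.
have c1 : (fun x => x - al) y @[y --> x] --> x - al.
  by apply: cvgB; [exact: cvg_id|exact: cvg_cst].
apply: cvgD => //; apply: cvgM; first exact: cvg_cst.
apply: continuous_cvg; first exact: sqrt_continuous.
by apply: cvgB; [apply: cvgM|exact: cvg_cst].
Qed.

Lemma continuous_bd_root_im : continuous (bd_root_im al be).
Proof.
move=> x; apply: cvgM; last exact: cvg_cst.
have c1 : (fun x => x - al) y @[y --> x] --> x - al.
  by apply: cvgB; [exact: cvg_id|exact: cvg_cst].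
apply: cvgN; apply: continuous_cvg; first exact: sqrt_continuous.
by apply: cvgB; [exact: cvg_cst|apply: cvgM].
Qed.

Lemma continuous_bd_den2 s : continuous (bd_den2 s).
Proof.
move=> x.
have ca : bd_num_re s y @[y --> x] --> bd_num_re s x.
  apply: cvgB; first by apply: cvgB; [exact: cvg_id|exact: cvg_cst].
  by apply: cvgM; [exact: cvg_cst|exact: continuous_bd_root_re].
have cb : bd_num_im y @[y --> x] --> bd_num_im x.
  by apply: cvgM; [exact: cvg_cst|exact: continuous_bd_root_im].
have c1 : (fun x => x - al1) y @[y --> x] --> x - al1.
  by apply: cvgB; [exact: cvg_id|exact: cvg_cst].
apply: cvgD; apply: cvgM; try (apply: cvgB; [exact: cvgM|exact: cvg_cst]);
  exact: cvgM.
Qed.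

Lemma continuous_root_gap s : continuous (root_gap s al be).
Proof.
move=> x; apply: cvgB; last exact: continuous_bd_root_im.
apply: cvgB; first exact: cvg_cst.
apply: continuous_cvg; first exact: sqrt_continuous.
by apply: cvgD; apply: cvgM; (exact: continuous_bd_root_re || exact: continuous_bd_root_im).
Qed.

Lemma compact_lower (f : R -> R) (c d : R) : c <= d -> continuous f ->
  (forall x, c <= x <= d -> 0 < f x) ->
  exists2 m, 0 < m & forall x, c <= x <= d -> m <= f x.
Proof.
move=> cd cf f0; have [x0 x0in h] := EVT_min cd (continuous_subspaceT cf).
exists (f x0); first by apply: f0; move: x0in; rewrite in_itv.
by move=> x xin; apply: h; rewrite in_itv.
Qed.

(** On a compact interval the continuous functions [root_gap] and [bd_den2] are
    bounded below. So the root is within a multiple of e of its boundary value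
    by [joukowski_root_close], uniformly, and the Green function with it. *)
Lemma green_uniform_limit s c d eps : c <= d -> 0 < eps ->
  (forall x, c <= x <= d ->
     [/\ root_side s al be x, (x - al) ^+ 2 != 4 * be ^+ 2 & bd_den2 s x != 0]) ->
  exists2 e0, 0 < e0 & forall e x ze, 0 < e < e0 -> c <= x <= d ->
    joukowski al be (x +i* e) ze -> normc ze <= 1 -> complex.Im ze <= 0 ->
    `|complex.Im (- (green_num (x +i* e) ze / green_den (x +i* e) ze)) -
      w1 * bd_num_im x / bd_den2 s x| <= eps.
Proof.
move=> cd eps0 hx.
have [k k0 hk] := compact_lower cd (@continuous_root_gap s) (fun x xin =>
  let: And3 h1 h2 _ := hx x xin in root_gap_gt0 be0 h1 h2).
have D20 x : c <= x <= d -> 0 < bd_den2 s x.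
  by move=> /hx[_ _ h]; rewrite lt_def h addr_ge0 ?sqr_ge0.
have [m m0 hm] := compact_lower cd (@continuous_bd_den2 s) D20.
pose eta := Num.sqrt m; have eta0 : 0 < eta by rewrite sqrtr_gt0.
pose K := `|c| + `|d| + `|al1| + `|al2| + 1 + w2 / be.
pose L := 1 + w2 / be.
have wb0 : 0 < w2 / be by rewrite divr_gt0.
have K0 : 0 < K by rewrite /K; have := normr_ge0 c; have := normr_ge0 d;
  have := normr_ge0 al1; have := normr_ge0 al2; lra.
have L0 : 0 < L by rewrite /L; lra.
pose d1 := Num.min 1 (Num.min (eta / 2 / (K * L + K))
   (eps / (2 * (K ^+ 2 + w1 * L) / eta ^+ 2))).
have KL : 0 < K * L + K by rewrite addr_gt0// mulr_gt0.
have QQ : 0 < 2 * (K ^+ 2 + w1 * L) / eta ^+ 2.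
  by rewrite divr_gt0 ?exprn_gt0// mulr_gt0// addr_gt0 ?exprn_gt0// mulr_gt0.
have d10 : 0 < d1.
  rewrite /d1 !lt_min ltr01 /=; apply/andP; split; last exact: divr_gt0.
  by rewrite !divr_gt0.
exists (Num.min d1 (d1 * (be * k))).
  by rewrite lt_min d10 !mulr_gt0.
move=> e x ze /andP[e0]; rewrite lt_min => /andP[ed1 edk] xin hz n1 im0.
have [h1 h2 h3] := hx x xin.
have close : normc (ze - z0 s x) <= d1.
  have := joukowski_root_close be0 h1 e0 hz n1.
  have kk : k <= normc (ze * z0 s x - 1).
    by apply: (le_trans (hk x xin)); exact: root_gap_le.
  have := ler_wpM2l (normc_ge0 (ze - z0 s x)) kk => q1 q2.
  have bk : 0 < be * k by rewrite mulr_gt0.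
  rewrite -(ler_pM2r bk); apply: le_trans (ltW edk).
  rewrite mulrCA; apply: le_trans q2; rewrite ler_wpM2l//; exact: ltW.
have xc : `|x| <= `|c| + `|d|.
  case/andP: xin => ? ?; have := ler_norm c; have := ler_norm (- c);
  have := ler_norm d; have := ler_norm (- d); rewrite !normrN => ? ? ? ?.
  by rewrite ler_norml; apply/andP; split; lra.
have d11 : 0 < d1 <= 1 by rewrite d10 /d1 ge_min lexx.
have p1 : normc (x +i* e - x%:C) <= d1 by rewrite normc_imag gtr0_norm// ltW.
have K1 : `|x - al1| + 1 <= K.
  have := ler_normB x al1; rewrite /K; have := normr_ge0 al2; lra.
have K2 : `|x - al2| + 1 + w2 / be <= K.
  have := ler_normB x al2; rewrite /K; have := normr_ge0 al1; lra.
have hD : eta <= normc (green_den x%:C (z0 s x)).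
  by rewrite normc_green_den_bd ler_wsqrtr//; exact: hm.
have hd1 : d1 * (K * L + K) <= eta / 2.
  by rewrite -ler_pdivlMr// /d1 !ge_min lexx orbT.
have hd2 : d1 * (2 * (K ^+ 2 + w1 * L) / eta ^+ 2) <= eps.
  by rewrite -ler_pdivlMr// /d1 !ge_min lexx !orbT.
have := perturb_G d11 p1 close (normc_bd_root_le1 be0 h1) n1 K1 K2 eta0 hD hd1.
move=> /le_trans/(_ hd2); apply: le_trans.
rewrite -Im_green_bd -raddfB -opprD raddfN normrN; exact: ler_normc_Im.
Qed.

(** At a band edge [root_gap] vanishes, but the two roots coincide there, so
    [joukowski_root_close] bounds the square of the distance by a multiple of
    e, which is enough for boundedness. *)
Lemma green_pointwise_bound s x : root_side s al be x -> bd_den2 s x != 0 ->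
  exists C e0, 0 < e0 /\ forall e ze, 0 < e < e0 ->
    joukowski al be (x +i* e) ze -> normc ze <= 1 -> complex.Im ze <= 0 ->
    `|complex.Im (- (green_num (x +i* e) ze / green_den (x +i* e) ze))| <= C.
Proof.
move=> hs hD2.
pose eta := Num.sqrt (bd_den2 s x).
have eta0 : 0 < eta.
  by rewrite sqrtr_gt0 lt_def hD2 addr_ge0 ?sqr_ge0.
pose K := `|x - al1| + `|x - al2| + 1 + w2 / be.
pose L := 1 + w2 / be.
have wb0 : 0 < w2 / be by rewrite divr_gt0.
have K0 : 0 < K by rewrite /K; have := normr_ge0 (x - al1);
  have := normr_ge0 (x - al2); lra.
have L0 : 0 < L by rewrite /L; lra.
have KL : 0 < K * L + K by rewrite addr_gt0// mulr_gt0.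
pose d1 := Num.min 1 (eta / 2 / (K * L + K)).
have d10 : 0 < d1 by rewrite /d1 !lt_min ltr01 !divr_gt0.
have d11 : 0 < d1 <= 1 by rewrite d10 /d1 ge_min lexx.
have close : exists2 e0, 0 < e0 & forall e ze, 0 < e < e0 ->
    joukowski al be (x +i* e) ze -> normc ze <= 1 -> complex.Im ze <= 0 ->
    normc (ze - z0 s x) <= d1.
  have [E|E] := eqVneq ((x - al) ^+ 2) (4 * be ^+ 2).
    exists (be * d1 ^+ 2); first by rewrite mulr_gt0// exprn_gt0.
    move=> e ze /andP[e0 e1] hz n1 im0.
    have := joukowski_root_close be0 hs e0 hz n1.
    have zi0 : bd_root_im al be x = 0 by apply: bd_root_im_out; rewrite E.
    have zr2 : bd_root_re s al be x ^+ 2 = 1.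
      have := normc_sq (z0 s x); rewrite (normc_bd_root_in s be0) ?E//= zi0 expr0n addr0 expr1n.
      by move=> <-.
    have -> : normc (ze * z0 s x - 1) = normc (ze - z0 s x).
      have zE : z0 s x = (bd_root_re s al be x)%:C by rewrite /bd_root zi0.
      have -> : ze * z0 s x - 1 = z0 s x * (ze - z0 s x).
        by rewrite mulrBr zE -[X in _ = _ - X]expr2 -rmorphXn/= zr2 mulrC.
      by rewrite Normc.normcM (normc_bd_root_in s be0) ?E// mul1r.
    move=> q; rewrite -(@ler_pXn2r _ 2)// ?nnegrE ?normc_ge0 ?(ltW d10)//.
    rewrite -(ler_pM2l be0) expr2; apply: (le_trans q); exact: ltW.
  have k0 := root_gap_gt0 be0 hs E.
  exists (d1 * (be * root_gap s al be x)); first by rewrite !mulr_gt0.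
  move=> e ze /andP[e0 e1] hz n1 im0.
  have := joukowski_root_close be0 hs e0 hz n1.
  have kk : root_gap s al be x <= normc (ze * z0 s x - 1) by exact: root_gap_le.
  have := ler_wpM2l (normc_ge0 (ze - z0 s x)) kk => q1 q2.
  have bk : 0 < be * root_gap s al be x by rewrite mulr_gt0.
  rewrite -(ler_pM2r bk); apply: le_trans (ltW e1).
  rewrite mulrCA; apply: le_trans q2; rewrite ler_wpM2l//; exact: ltW.
have [e0 e00 he] := close.
exists (K / (eta / 2)), (Num.min e0 d1); split; first by rewrite lt_min e00.
move=> e ze /andP[ep]; rewrite lt_min => /andP[ee0 ed1] hz n1 im0.
have eint : 0 < e < e0 by rewrite ep.
have cl := he e ze eint hz n1 im0.
have p1 : normc (x +i* e - x%:C) <= d1 by rewrite normc_imag gtr0_norm// ltW.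
have K1 : `|x - al1| + 1 <= K.
  rewrite /K; have := normr_ge0 (x - al2); lra.
have K2 : `|x - al2| + 1 + w2 / be <= K.
  rewrite /K; have := normr_ge0 (x - al1); lra.
have hD : eta <= normc (green_den x%:C (z0 s x)) by rewrite normc_green_den_bd.
have hd1 : d1 * (K * L + K) <= eta / 2.
  by rewrite -ler_pdivlMr// /d1 !ge_min lexx orbT.
have Dl := perturb_D d11 p1 cl (normc_bd_root_le1 be0 hs) K1 K2 hD hd1.
apply: (le_trans (ler_normc_Im _)); rewrite normcN Normc.normcM Normc.normcV.
apply: ler_pM; rewrite ?invr_ge0 ?normc_ge0//.
  exact: (perturb_N d11 p1 n1 K2).
by rewrite lef_pV2 ?posrE ?divr_gt0//; apply: lt_le_trans Dl; exact: divr_gt0.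
Qed.

End green.

(** * Zeros of the denominator outside the band *)

Section joukowski_mono.
Context {R : realType}.
Implicit Types X Y c : R.

(** The function X - sqrt (X^2 - c) is c over the increasing function
    X + sqrt (X^2 - c). *)
Lemma sqrt_diff_mono X Y c : 0 <= c -> X < Y -> 0 < Y ->  c <= X ^+ 2 -> 0 <= X ->
  Y - Num.sqrt (Y ^+ 2 - c) <= X - Num.sqrt (X ^+ 2 - c).
Proof.
move=> c0 XY Y0 cX X0.
have XY2 : X ^+ 2 < Y ^+ 2 by rewrite ltr_pXn2r ?nnegrE// ltW.
have := sqr_sqrtr (_ : 0 <= X ^+ 2 - c); rewrite subr_ge0 => /(_ cX).
have cY : c <= Y ^+ 2 by lra.
have := sqr_sqrtr (_ : 0 <= Y ^+ 2 - c); rewrite subr_ge0 => /(_ cY).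
set p := Num.sqrt _; set q := Num.sqrt _ => p2 q2.
have p0 : 0 <= p by exact: sqrtr_ge0.
have q0 : 0 <= q by exact: sqrtr_ge0.
have pY : p <= Y by rewrite -(@ler_pXn2r _ 2)// ?nnegrE ?(ltW Y0)// p2; lra.
have qX : q <= X by rewrite -(@ler_pXn2r _ 2)// ?nnegrE// q2; lra.
have pq : q < p by rewrite -(@ltr_pXn2r _ 2)// ?nnegrE// p2 q2; lra.
have pq0 : 0 < p + q by lra.
have : (Y - X) * (p + q) <= (p - q) * (p + q).
  have -> : (p - q) * (p + q) = (Y - X) * (Y + X).
    transitivity (p ^+ 2 - q ^+ 2); first by ring.
    by rewrite p2 q2; ring.
  by rewrite ler_pM2l ?subr_gt0//; lra.
by rewrite ler_pM2r//; lra.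
Qed.

Variables (al be : R).
Hypothesis be0 : 0 < be.

Lemma bd_root_re_noninc s x y : (s = 1 /\ y <= al - 2 * be) \/ (s = -1 /\ al + 2 * be <= x) ->
  x < y -> bd_root_re s al be y <= bd_root_re s al be x.
Proof.
move=> hs xy; have b2 : 0 < 2 * be by rewrite mulr_gt0.
have c0 : 0 <= 4 * be ^+ 2 by rewrite mulr_ge0 ?exprn_ge0 ?(ltW be0).
have sq a : 2 * be <= a -> 4 * be ^+ 2 <= a ^+ 2.
  move=> h; have -> : 4 * be ^+ 2 = (2 * be) ^+ 2 by ring.
  by rewrite lerXn2r ?nnegrE ?(ltW b2)// (le_trans (ltW b2)).
rewrite /bd_root_re ler_pM2r ?invr_gt0//; case: hs => -[-> h].
  have y2 : 4 * be ^+ 2 <= (- (y - al)) ^+ 2 by apply: sq; lra.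
  have p1 : - (y - al) < - (x - al) by lra.
  have p2 : 0 < - (x - al) by lra.
  have p3 : 0 <= - (y - al) by lra.
  by have := sqrt_diff_mono c0 p1 p2 y2 p3; rewrite !sqrrN; lra.
have x2 : 4 * be ^+ 2 <= (x - al) ^+ 2 by apply: sq; lra.
have p1 : x - al < y - al by lra.
have p2 : 0 < y - al by lra.
have p3 : 0 <= x - al by lra.
by have := sqrt_diff_mono c0 p1 p2 x2 p3; lra.
Qed.

End joukowski_mono.

Section qw_parameters.
Context {R : realType}.
Variables r lam : R.
Hypothesis r0 : 0 < r.
Hypothesis r1 : r < 1.
Hypothesis lam0 : 0 < lam.

Local Notation t := (Num.sqrt (1 - r ^+ 2)).
Local Notation l := (Num.sqrt lam).
(** The square root of [omt], that is the constant off-diagonal entry; the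
    band has half-width [2 * qw_beta]. *)
Definition qw_beta : R := Num.sqrt lam * r / 2.

Lemma sqr_qt : t ^+ 2 = 1 - r ^+ 2.
Proof. by rewrite sqr_sqrtr// subr_ge0 expr_le1// ltW. Qed.

Lemma qt_gt0 : 0 < t.
Proof. by rewrite sqrtr_gt0 subr_gt0 expr_lt1// ltW. Qed.

Lemma qt_lt1 : t < 1.
Proof.
have := sqr_qt; have := exprn_gt0 2 r0 => h1 h2.
by rewrite -(@ltr_pXn2r _ 2)// ?nnegrE ?sqrtr_ge0// expr1n; lra.
Qed.

Lemma sqr_r : r ^+ 2 = (1 - t) * (1 + t).
Proof. have := sqr_qt; lra. Qed.

Lemma sqr_sqrt_lam : l ^+ 2 = lam. Proof. by rewrite sqr_sqrtr// ltW. Qed.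
Lemma sqrt_lam_gt0 : 0 < l. Proof. by rewrite sqrtr_gt0. Qed.

Lemma om1E : om r 1 = 1 - t. Proof. by []. Qed.
Lemma om2E : om r 2 = t / 2 * (1 - t). Proof. by []. Qed.
Lemma om3E n : om r n.+3 = r ^+ 2 / 4. Proof. by []. Qed.

Lemma om3t n : om r n.+3 = (1 - t) * (1 + t) / 4.
Proof. by rewrite om3E; have := sqr_r; lra. Qed.

Lemma om_gt0 n : 0 < om r n.+1.
Proof.
have := qt_gt0; have := qt_lt1 => t1 t0.
case: n => [|[|n]]; rewrite ?om1E ?om2E ?om3E.
- by rewrite subr_gt0.
- by rewrite mulr_gt0 ?divr_gt0// subr_gt0.
- by rewrite divr_gt0// exprn_gt0.
Qed.

Lemma qw_beta_gt0 : 0 < qw_beta.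
Proof. by rewrite /qw_beta divr_gt0// mulr_gt0// sqrt_lam_gt0. Qed.

Lemma sqr_qw_beta : qw_beta ^+ 2 = omt r lam.
Proof.
by rewrite /qw_beta /omt om3E expr_div_n exprMn sqr_sqrt_lam; field.
Qed.

Lemma omtE : Num.sqrt (omt r lam) = qw_beta.
Proof. by rewrite -sqr_qw_beta sqrtr_sqr gtr0_norm// qw_beta_gt0. Qed.

Lemma SminusE : Sminus r lam = alt r lam - 2 * qw_beta.
Proof. by rewrite /Sminus omtE. Qed.

Lemma SplusE : Splus r lam = alt r lam + 2 * qw_beta.
Proof. by rewrite /Splus omtE. Qed.

Lemma omt1_gt0 : 0 < omt1 r lam. Proof. by rewrite mulr_gt0 ?om_gt0. Qed.
Lemma omt2_gt0 : 0 < omt2 r lam. Proof. by rewrite mulr_gt0 ?om_gt0. Qed.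
Lemma omt_gt0 : 0 < omt r lam. Proof. by rewrite mulr_gt0 ?om_gt0. Qed.

(** The distance of [alt1] to the centre of the band. *)
Definition qw_kappa : R := (1 - t) * (3 - t) / 4.

Lemma alt1_alt : alt1 r lam = alt r lam + qw_kappa.
Proof. by rewrite /alt1 /alt om1E om3t /qw_kappa; field. Qed.

Lemma qw_kappa_gt0 : 0 < qw_kappa.
Proof. by have := qt_lt1 => t1; rewrite /qw_kappa divr_gt0// mulr_gt0; lra. Qed.

Lemma Sminus_ge0 : 0 <= Sminus r lam.
Proof.
rewrite SminusE /alt om3E /qw_beta -{1}sqr_sqrt_lam.
have -> : l ^+ 2 + r ^+ 2 / 4 - 2 * (l * r / 2) = (l - r / 2) ^+ 2 by field.
exact: sqr_ge0.
Qed.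

Lemma Sminus_lt_alt1 : Sminus r lam < alt1 r lam.
Proof.
by rewrite SminusE alt1_alt; have := qw_kappa_gt0; have := qw_beta_gt0; lra.
Qed.

Local Notation bA := (bd_num_re (alt2 r lam) (alt r lam) (omt2 r lam) qw_beta).

(** Outside the band the boundary value of D is real, and equal to this. *)
Definition qw_den s x := (x - alt1 r lam) * bA s x - omt1 r lam.

Lemma omt2_qw_beta : omt2 r lam / qw_beta = l * t * (1 - t) / r.
Proof.
rewrite /omt2 om2E /qw_beta -{1}sqr_sqrt_lam.
by field; rewrite !gt_eqF// sqrt_lam_gt0.
Qed.

Lemma bd_root_re_edge s x : (x - alt r lam) ^+ 2 = 4 * qw_beta ^+ 2 ->
  bd_root_re s (alt r lam) qw_beta x = (x - alt r lam) / (2 * qw_beta).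
Proof. by move=> e; rewrite /bd_root_re e subrr sqrtr0 mulr0 addr0. Qed.

(** At an edge the root is -1 or 1, so D is a polynomial in r, sqrt lam and
    t = sqrt (1 - r^2), and r^2 = (1 - t) (1 + t) makes it factorize. *)
Lemma qw_den_Sminus : r * qw_den 1 (Sminus r lam) =
  (1 - t) ^+ 2 / 4 * (l * (t ^+ 2 - t + 2) - qw_kappa * r).
Proof.
have r0' : r != 0 by rewrite gt_eqF.
have b0 : qw_beta != 0 by rewrite gt_eqF// qw_beta_gt0.
rewrite /qw_den /bd_num_re bd_root_re_edge; last by rewrite SminusE; ring.
rewrite SminusE alt1_alt omt2_qw_beta.
have -> : (alt r lam - 2 * qw_beta - alt r lam) / (2 * qw_beta) = -1 by field.
have -> : alt r lam - 2 * qw_beta - alt2 r lam = (1 - t) ^+ 2 / 4 - l * r.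
  by rewrite /alt /alt2 om2E om3t /qw_beta; field.
have -> : omt1 r lam = l ^+ 2 * (1 - t) by rewrite sqr_sqrt_lam.
have -> : alt r lam - 2 * qw_beta - (alt r lam + qw_kappa) =
  - (l * r + qw_kappa) by rewrite /qw_beta; field.
transitivity ((l * r + qw_kappa) * (l * r ^+ 2 - (1 - t) ^+ 2 / 4 * r - l * t * (1 - t))
  - r * l ^+ 2 * (1 - t)); first by field.
have q2 := sqr_r; rewrite /qw_kappa; move: q2; set T := t => q2; rewrite q2.
transitivity (l * (1 - T) ^+ 2 * (3 - T) / 4 - l * (1 - T) ^+ 2 / 4 * r ^+ 2
  - (1 - T) * (3 - T) / 4 * ((1 - T) ^+ 2 / 4) * r); first by field.
by rewrite q2; field.
Qed.

Lemma qw_den_Splus : r * qw_den (-1) (Splus r lam) =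
  - ((1 - t) ^+ 2 / 4 * (l * (t ^+ 2 - t + 2) + qw_kappa * r)).
Proof.
have r0' : r != 0 by rewrite gt_eqF.
have b0 : qw_beta != 0 by rewrite gt_eqF// qw_beta_gt0.
rewrite /qw_den /bd_num_re bd_root_re_edge; last by rewrite SplusE; ring.
rewrite SplusE alt1_alt omt2_qw_beta.
have -> : (alt r lam + 2 * qw_beta - alt r lam) / (2 * qw_beta) = 1 by field.
have -> : alt r lam + 2 * qw_beta - alt2 r lam = (1 - t) ^+ 2 / 4 + l * r.
  by rewrite /alt /alt2 om2E om3t /qw_beta; field.
have -> : omt1 r lam = l ^+ 2 * (1 - t) by rewrite sqr_sqrt_lam.
have -> : alt r lam + 2 * qw_beta - (alt r lam + qw_kappa) =
  l * r - qw_kappa by rewrite /qw_beta; field.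
transitivity ((l * r - qw_kappa) * (l * r ^+ 2 + (1 - t) ^+ 2 / 4 * r - l * t * (1 - t))
  - r * l ^+ 2 * (1 - t)); first by field.
have q2 := sqr_r; rewrite /qw_kappa; move: q2; set T := t => q2; rewrite q2.
transitivity (- (l * (1 - T) ^+ 2 * (3 - T) / 4) + l * (1 - T) ^+ 2 / 4 * r ^+ 2
  - (1 - T) * (3 - T) / 4 * ((1 - T) ^+ 2 / 4) * r); first by field.
by rewrite q2; field.
Qed.

Lemma qt_quadratic_gt0 : 0 < t ^+ 2 - t + 2.
Proof. by have := sqr_ge0 t; have := qt_lt1; lra. Qed.

Lemma qw_den_Splus_lt0 : qw_den (-1) (Splus r lam) < 0.
Proof.
have : r * qw_den (-1) (Splus r lam) < 0.
  rewrite qw_den_Splus oppr_lt0 mulr_gt0//.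
    by rewrite divr_gt0// exprn_gt0// subr_gt0 qt_lt1.
  by rewrite addr_gt0// mulr_gt0// ?sqrt_lam_gt0 ?qt_quadratic_gt0 ?qw_kappa_gt0.
by rewrite pmulr_rlt0.
Qed.

Lemma qw_den_Sminus_le0 : (qw_den 1 (Sminus r lam) <= 0) = (lam <= LambdaM r).
Proof.
rewrite -(pmulr_rle0 _ r0) qw_den_Sminus.
have u0 : 0 < (1 - t) ^+ 2 / 4 by rewrite divr_gt0// exprn_gt0// subr_gt0 qt_lt1.
rewrite pmulr_rle0// subr_le0 -ler_pdivlMr ?qt_quadratic_gt0//.
have -> : qw_kappa * r / (t ^+ 2 - t + 2) = r * (1 - t) * (3 - t) / (4 * (t ^+ 2 - t + 2)).
  by rewrite /qw_kappa; field; rewrite gt_eqF// qt_quadratic_gt0.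
rewrite /LambdaM -{2}sqr_sqrt_lam ler_pXn2r// ?nnegrE ?sqrtr_ge0//.
have := qt_lt1 => t1.
by rewrite divr_ge0 ?mulr_ge0 ?(ltW r0) ?(ltW qt_quadratic_gt0)//; lra.
Qed.

Lemma Splus_alt1 : (Splus r lam < alt1 r lam) = (lam < LambdaP r).
Proof.
rewrite SplusE alt1_alt ltrD2l /LambdaP -[X in _ = (X < _)]sqr_sqrt_lam.
rewrite ltr_pXn2r// ?nnegrE ?sqrtr_ge0//; last first.
  by have := qt_lt1 => t1; rewrite divr_ge0 ?mulr_ge0 ?(ltW r0)//; lra.
rewrite [RHS]ltr_pdivlMr ?mulr_gt0//.
have -> : l * (4 * r) = 4 * (2 * qw_beta) by rewrite /qw_beta; field.
by rewrite /qw_kappa ltr_pdivlMr// mulrC.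
Qed.

Lemma LambdaM_ltP : LambdaM r < LambdaP r.
Proof.
have := qt_lt1; have := qt_gt0 => t0 t1.
have h : 0 < (1 - t) * (3 - t) by rewrite mulr_gt0; lra.
rewrite /LambdaM /LambdaP ltr_pXn2r// ?nnegrE.
- rewrite ltr_pdivlMr ?mulr_gt0// mulrAC ltr_pdivrMr ?mulr_gt0 ?qt_quadratic_gt0//.
  have -> : r * (1 - t) * (3 - t) * (4 * r) = (1 - t) * (3 - t) * (4 * r ^+ 2) by ring.
  rewrite ltr_pM2l// ltr_pM2l// -subr_gt0.
  have := sqr_qt; have := exprn_gt0 2 t0; lra.
- by rewrite -(mulrA r) divr_ge0// mulr_ge0 ?(ltW r0) ?(ltW qt_quadratic_gt0) ?(ltW h).
- by rewrite divr_ge0 ?(ltW h)// mulr_ge0// ltW.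
Qed.

(** At 0 the square root in the root is |lam - om 3|. For lam at least om 3 the
    value is lam^2; for smaller lam it is (1 - t) / (1 + t) times a sum of
    positive terms. *)
Lemma qw_den0_gt0 : 0 < qw_den 1 0.
Proof.
have b0 : 0 < qw_beta := qw_beta_gt0; have := qt_lt1; have := qt_gt0 => t0 t1.
have s3 := om_gt0 2.
have E : (0 - alt r lam) ^+ 2 - 4 * qw_beta ^+ 2 = (lam - om r 3) ^+ 2.
  by rewrite sqr_qw_beta /omt /alt; ring.
rewrite /qw_den /bd_num_re /bd_root_re E sqrtr_sqr mul1r.
have e4 : omt2 r lam / qw_beta / qw_beta = om r 2 / om r 3.
  rewrite -mulrA -invfM -expr2 sqr_qw_beta /omt2 /omt; field.
  by rewrite !gt_eqF.
have [h|h] := leP lam (om r 3).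
  rewrite ler0_norm ?subr_le0//.
  have -> : omt2 r lam / qw_beta * ((0 - alt r lam - (lam - om r 3)) / (2 * qw_beta)) =
     - (omt2 r lam / qw_beta / qw_beta) * lam.
    by rewrite /alt; field; rewrite gt_eqF.
  rewrite e4.
  have -> : om r 2 / om r 3 = 2 * t / (1 + t).
    by rewrite om2E om3t; field; rewrite ?gt_eqF//; lra.
  rewrite om3t in h.
  rewrite -(pmulr_rgt0 _ (_ : 0 < 1 + t)); last by lra.
  have -> : (1 + t) * ((0 - alt1 r lam) * (0 - alt2 r lam - - (2 * t / (1 + t)) * lam)
     - omt1 r lam) = (1 - t) * (lam ^+ 2 + t / 2 * ((1 - t) * (1 + t) - lam * (3 - t))).
    rewrite /alt1 /alt2 /omt1 om1E om2E; field; rewrite gt_eqF//; lra.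
  rewrite mulr_gt0//; first by lra.
  rewrite addr_gt0 ?exprn_gt0// mulr_gt0 ?divr_gt0// subr_gt0.
  have : lam * (3 - t) <= (1 - t) * (1 + t) / 4 * (3 - t) by rewrite ler_pM2r//; lra.
  move/le_lt_trans; apply.
  have p : 0 < (1 - t) * (1 + t) by rewrite mulr_gt0; lra.
  by rewrite -mulrA gtr_pMr//; lra.
have h' : 0 < lam - om r 3 by rewrite subr_gt0.
rewrite (gtr0_norm h').
have -> : omt2 r lam / qw_beta * ((0 - alt r lam + (lam - om r 3)) / (2 * qw_beta)) =
   - (omt2 r lam / qw_beta / qw_beta) * om r 3.
  by rewrite /alt; field; rewrite gt_eqF.
rewrite e4 mulNr divfK ?gt_eqF//.
have -> : (0 - alt1 r lam) * (0 - alt2 r lam - - om r 2) - omt1 r lam = lam ^+ 2.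
  by rewrite /alt1 /alt2 /omt1; ring.
by rewrite exprn_gt0.
Qed.

(** The upper bound U of the interval which contains the zero of g. *)
Definition qw_top : R := (Num.sqrt (om r 1) + Num.sqrt lam) ^+ 2.

Lemma qw_top_Splus : Splus r lam < qw_top.
Proof.
have t0 := qt_gt0; have t1 := qt_lt1; have l0 := sqrt_lam_gt0.
rewrite SplusE /alt om3E /qw_beta /qw_top -{1}sqr_sqrt_lam.
have -> : l ^+ 2 + r ^+ 2 / 4 + 2 * (l * r / 2) = (r / 2 + l) ^+ 2 by field.
have v0 : 0 <= Num.sqrt (om r 1) by exact: sqrtr_ge0.
rewrite ltr_pXn2r// ?nnegrE ?addr_ge0 ?divr_ge0 ?(ltW r0) ?(ltW l0)// ltrD2r.
rewrite -(@ltr_pXn2r _ 2)// ?nnegrE ?divr_ge0 ?(ltW r0)//.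
rewrite sqr_sqrtr ?(ltW (om_gt0 0))// om1E.
have a1 : 0 < 1 - t by lra.
have a2 : 0 < 3 - t by lra.
have := mulr_gt0 a1 a2; have := sqr_r; lra.
Qed.

Lemma qw_top_alt1 : alt1 r lam < qw_top.
Proof.
rewrite /alt1 /qw_top sqrrD sqr_sqrt_lam sqr_sqrtr ?(ltW (om_gt0 0))//.
have : 0 < Num.sqrt (om r 1) * Num.sqrt lam.
  by rewrite mulr_gt0// sqrtr_gt0// om_gt0.
lra.
Qed.

(** With v = sqrt (om 1) one has U - alt1 = 2 v sqrt lam and
    omt1 = (v sqrt lam)^2, so it is enough that the numerator at U exceeds
    v sqrt lam / 2. The root is at most 1 and omt2 / qw_beta is at most
    v sqrt lam, because t v <= r. *)
Lemma qw_den_top_gt0 : 0 < qw_den (-1) qw_top.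
Proof.
have t0 := qt_gt0; have t1 := qt_lt1; have l0 := sqrt_lam_gt0; have b0 := qw_beta_gt0.
set v := Num.sqrt (om r 1).
have v0 : 0 < v by rewrite sqrtr_gt0 om_gt0.
have v2 : v ^+ 2 = 1 - t by rewrite sqr_sqrtr ?(ltW (om_gt0 0)).
have tv : t * v <= r.
  rewrite -(@ler_pXn2r _ 2)// ?nnegrE ?(ltW r0) ?mulr_ge0 ?(ltW t0) ?(ltW v0)//.
  rewrite exprMn v2; have t21 : t ^+ 2 <= 1 by rewrite expr_le1 ?(ltW t1) ?(ltW t0).
  have a1 : 0 <= 1 - t by lra.
  have a2 : 0 <= 1 + t - t ^+ 2 by lra.
  have := mulr_ge0 a1 a2; have := sqr_qt; lra.
have zr1 : bd_root_re (-1) (alt r lam) qw_beta qw_top <= 1.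
  have hs : root_side (-1) (alt r lam) qw_beta qw_top.
    by right; split => //; have := qw_top_Splus; rewrite SplusE; lra.
  apply: le_trans (normc_bd_root_le1 b0 hs); rewrite /bd_root/=.
  apply: (le_trans (ler_norm _)); rewrite -sqrtr_sqr ler_wsqrtr// lerDl.
  exact: sqr_ge0.
have w : omt2 r lam / qw_beta <= l * v.
  rewrite omt2_qw_beta -v2 ler_pdivrMr//.
  have -> : l * t * v ^+ 2 = l * v * (t * v) by ring.
  by rewrite ler_pM2l// mulr_gt0.
have w0 : 0 < omt2 r lam / qw_beta by rewrite divr_gt0// omt2_gt0.
have A : l * v < bA (-1) qw_top.
  rewrite /bd_num_re.
  have h1 : omt2 r lam / qw_beta * bd_root_re (-1) (alt r lam) qw_beta qw_top <= l * v.
    apply: le_trans w; rewrite -[leRHS]mulr1 ler_pM2l//.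
  have qUE : qw_top = v ^+ 2 + l ^+ 2 + 2 * (l * v) by rewrite /qw_top -/v; ring.
  have e : alt2 r lam = l ^+ 2 + t / 2 * v ^+ 2 by rewrite /alt2 om2E v2 sqr_sqrt_lam.
  have h2 : 0 < v ^+ 2 * (1 - t / 2) by rewrite mulr_gt0 ?exprn_gt0//; lra.
  lra.
rewrite /qw_den.
have -> : qw_top - alt1 r lam = 2 * (l * v).
  by have := sqr_sqrt_lam; rewrite /qw_top -/v /alt1 om1E -v2; lra.
have -> : omt1 r lam = (l * v) * (l * v).
  by rewrite /omt1 om1E -v2 -{1}sqr_sqrt_lam; ring.
have lv : 0 < l * v by rewrite mulr_gt0.
have := ltr_pM2l lv (l * v) (bA (-1) qw_top); rewrite A => h.
have h' : l * v * (l * v) < l * v * bA (-1) qw_top by rewrite h.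
have h'' : 0 < l * v * (l * v) by rewrite mulr_gt0.
lra.
Qed.

Local Notation al := (alt r lam).

(** The formula of f for s = 1 and of g for s = -1. *)
Definition qw_fg s x := (x - alt1 r lam)^-1 - (omt1 r lam)^-1 * bA s x.

Lemma f_formulaE x : f_formula r lam x = qw_fg 1 x.
Proof.
have b0 := qw_beta_gt0; have o0 := omt_gt0.
rewrite /f_formula /qw_fg /bd_num_re /bd_root_re sqr_qw_beta mul1r; congr (_ - _ * (_ - _)).
set q := _ + Num.sqrt _; rewrite -sqr_qw_beta; field; rewrite gt_eqF//.
Qed.

Lemma g_formulaE x : g_formula r lam x = qw_fg (-1) x.
Proof.
have b0 := qw_beta_gt0; have o0 := omt_gt0.
rewrite /g_formula /qw_fg /bd_num_re /bd_root_re sqr_qw_beta mulN1r; congr (_ - _ * (_ - _)).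
set q := _ - Num.sqrt _; rewrite -sqr_qw_beta; field; rewrite gt_eqF//.
Qed.

Lemma qw_fg_den s x : x != alt1 r lam ->
  qw_den s x = - ((x - alt1 r lam) * omt1 r lam * qw_fg s x).
Proof.
move=> xa; rewrite /qw_den /qw_fg; field; rewrite (gt_eqF omt1_gt0) subr_eq0 xa//.
Qed.

Lemma qw_fg_eq0 s (x : R) : x != alt1 r lam -> (qw_fg s x == 0) = (qw_den s x == 0).
Proof.
move=> xa; rewrite qw_fg_den// oppr_eq0 mulf_eq0 (mulf_eq0 (x - _)) (subr_eq0 x) (negbTE xa).
by rewrite (gt_eqF omt1_gt0).
Qed.

Lemma qw_den_alt1 s : qw_den s (alt1 r lam) < 0.
Proof. by rewrite /qw_den subrr mul0r sub0r oppr_lt0 omt1_gt0. Qed.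

(** Both 1 / (x - alt1) and minus the numerator decrease, the latter because
    the root decreases by [bd_root_re_noninc]. *)
Lemma qw_fg_decr s x y :
  (s = 1 /\ y <= Sminus r lam) \/ (s = -1 /\ Splus r lam <= x) ->
  (y < alt1 r lam) || (alt1 r lam < x) -> x < y -> qw_fg s y < qw_fg s x.
Proof.
move=> hs ha xy.
have zm : bd_root_re s al qw_beta y <= bd_root_re s al qw_beta x.
  by apply: (bd_root_re_noninc qw_beta_gt0) => //; rewrite -SminusE -SplusE.
have Am : bA s x < bA s y.
  rewrite /bd_num_re; have w0 : 0 <= omt2 r lam / qw_beta.
    by rewrite divr_ge0// ltW// ?omt2_gt0 ?qw_beta_gt0.
  have := ler_wpM2l w0 zm; lra.
have i0 : 0 < (omt1 r lam)^-1 by rewrite invr_gt0 omt1_gt0.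
have := ltr_pM2l i0 (bA s x) (bA s y); rewrite Am => h1.
have h1' : (omt1 r lam)^-1 * bA s x < (omt1 r lam)^-1 * bA s y by rewrite h1.
have h2 : (y - alt1 r lam)^-1 < (x - alt1 r lam)^-1.
  case/orP: ha => h.
    rewrite -ltrN2 -!invrN ltf_pV2 ?posrE; lra.
  rewrite ltf_pV2 ?posrE; lra.
by rewrite /qw_fg; lra.
Qed.

Lemma continuous_qw_den s : continuous (qw_den s).
Proof.
move=> x; apply: cvgB; last exact: cvg_cst.
apply: cvgM; first by apply: cvgB; [exact: cvg_id|exact: cvg_cst].
apply: cvgB; first by apply: cvgB; [exact: cvg_id|exact: cvg_cst].
by apply: cvgM; [exact: cvg_cst|exact: continuous_bd_root_re].
Qed.

(** If f is positive at the left edge, it is positive to the left of it. *)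
Lemma qw_den_f_neq0 : LambdaM r < lam -> forall y, y <= Sminus r lam -> qw_den 1 y != 0.
Proof.
move=> hl y yS; have Sa := Sminus_lt_alt1.
have ya : y != alt1 r lam by rewrite lt_eqF// (le_lt_trans yS).
have Sn : Sminus r lam != alt1 r lam by rewrite lt_eqF.
have DS : 0 < qw_den 1 (Sminus r lam) by rewrite ltNge qw_den_Sminus_le0 -ltNge.
have fS : 0 < qw_fg 1 (Sminus r lam).
  move: DS; rewrite qw_fg_den// -mulNr -mulNr pmulr_rgt0// mulr_gt0 ?omt1_gt0//; lra.
rewrite -qw_fg_eq0// gt_eqF//.
have [->//|yn] := eqVneq y (Sminus r lam).
apply: (lt_trans fS); apply: qw_fg_decr; first by left.
  by rewrite Sa.
by rewrite lt_neqAle yn.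
Qed.

Lemma qw_den_f_zero : lam <= LambdaM r -> exists x0,
  [/\ 0 < x0 <= Sminus r lam, qw_den 1 x0 = 0
    & forall y, y <= Sminus r lam -> qw_den 1 y = 0 -> y = x0].
Proof.
move=> hl; have Sa := Sminus_lt_alt1.
have DS : qw_den 1 (Sminus r lam) <= 0 by rewrite qw_den_Sminus_le0.
have D0 := qw_den0_gt0.
have [x0 x0in x0z] : exists2 c, c \in `[0, Sminus r lam] & qw_den 1 c = 0.
  apply: IVT; first exact: Sminus_ge0.
    by apply: continuous_subspaceT; exact: continuous_qw_den.
  by rewrite ge_min le_max DS (ltW D0) orbT.
move: x0in; rewrite in_itv/= => /andP[x00 x0S].
have x0a : x0 != alt1 r lam by rewrite lt_eqF// (le_lt_trans x0S).
exists x0; split=> //.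
  rewrite x0S andbT lt_neqAle x00 andbT; apply/eqP => e.
  by rewrite -e in x0z; rewrite x0z ltxx in D0.
move=> y yS yz.
have ya : y != alt1 r lam by rewrite lt_eqF// (le_lt_trans yS).
have fx : qw_fg 1 x0 = 0 by apply/eqP; rewrite qw_fg_eq0// x0z.
have fy : qw_fg 1 y = 0 by apply/eqP; rewrite qw_fg_eq0// yz.
apply/eqP; case: (ltgtP y x0) => // h.
  have := @qw_fg_decr 1 y x0 (or_introl (conj erefl x0S)).
  by rewrite (le_lt_trans x0S Sa)/= => /(_ isT h); rewrite fx fy ltxx.
have := @qw_fg_decr 1 x0 y (or_introl (conj erefl yS)).
by rewrite (le_lt_trans yS Sa)/= => /(_ isT h); rewrite fx fy ltxx.
Qed.

(** Between the larger one of S+ and alt1, where D is negative, and U, where it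
    is positive, there is a zero. To the left of alt1 there is none, since g is
    already negative at S+. *)
Lemma qw_den_g_zero : exists x1,
  [/\ Splus r lam < x1, alt1 r lam < x1 < qw_top, qw_den (-1) x1 = 0
    & forall y, Splus r lam <= y -> qw_den (-1) y = 0 -> y = x1].
Proof.
pose m := Num.max (Splus r lam) (alt1 r lam).
have mU : m < qw_top by rewrite gt_max qw_top_Splus qw_top_alt1.
have Dm : qw_den (-1) m < 0.
  have [->|->] : m = Splus r lam \/ m = alt1 r lam.
    by rewrite /m /Order.max; case: ifP; [right|left].
    exact: qw_den_Splus_lt0.
  exact: qw_den_alt1.
have DU := qw_den_top_gt0.
have [x1 x1in x1z] : exists2 c, c \in `[m, qw_top] & qw_den (-1) c = 0.
  apply: IVT; first exact: ltW.
    by apply: continuous_subspaceT; exact: continuous_qw_den.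
  by rewrite ge_min le_max (ltW Dm) (ltW DU) orbT.
move: x1in; rewrite in_itv/= => /andP[mx1 x1U].
have mx1' : m < x1.
  by rewrite lt_neqAle mx1 andbT; apply/eqP => e; move: Dm; rewrite e x1z ltxx.
have x1U' : x1 < qw_top.
  by rewrite lt_neqAle x1U andbT; apply/eqP => e; move: DU; rewrite -e x1z ltxx.
move: mx1'; rewrite gt_max => /andP[Sx1 ax1].
exists x1; split=> //; first by rewrite ax1.
move=> y Sy yz.
have ya : y != alt1 r lam.
  by apply/eqP => e; have := qw_den_alt1 (-1); rewrite -e yz ltxx.
have gx : qw_fg (-1) x1 = 0 by apply/eqP; rewrite qw_fg_eq0 ?x1z// gt_eqF.
have gy : qw_fg (-1) y = 0 by apply/eqP; rewrite qw_fg_eq0 ?yz.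
have [ylt|ygt|//] := ltgtP y (alt1 r lam); last by move=> e; rewrite e eqxx in ya.
  have Sa : Splus r lam < alt1 r lam by exact: le_lt_trans ylt.
  have Sn : Splus r lam != alt1 r lam by rewrite lt_eqF.
  have gS : qw_fg (-1) (Splus r lam) < 0.
    have := qw_den_Splus_lt0; rewrite qw_fg_den// -mulNr -mulNr pmulr_rlt0//.
    rewrite mulr_gt0 ?omt1_gt0//; lra.
  have : qw_fg (-1) y <= qw_fg (-1) (Splus r lam).
    have [->//|yn] := eqVneq y (Splus r lam).
    apply/ltW/qw_fg_decr; [by right|by rewrite ylt|].
    by rewrite lt_neqAle Sy eq_sym yn.
  by rewrite gy leNgt gS.
apply/eqP; case: (ltgtP y x1) => // h.
  have := @qw_fg_decr (-1) y x1 (or_intror (conj erefl Sy)).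
  by rewrite ygt orbT => /(_ isT h); rewrite gx gy ltxx.
have := @qw_fg_decr (-1) x1 y (or_intror (conj erefl (ltW Sx1))).
by rewrite ax1 orbT => /(_ isT h); rewrite gx gy ltxx.
Qed.

End qw_parameters.

(** * Stieltjes inversion *)

Section poisson_kernel.
Context {R : realType}.
Implicit Types x y c d e : R.

(** The integral of the Poisson kernel over [c, d], up to the factor pi. *)
Definition atan_diff e c d y : R := atan ((d - y) / e) - atan ((c - y) / e).

Lemma ckerC e x y : cker e x y = cker e y x.
Proof. by rewrite /cker -(sqrrN (y - x)) opprB. Qed.

Lemma is_derive_atan_cker e x y : 0 < e ->
  is_derive x (1 : R) (fun t => atan ((t - y) / e)) (e * cker e y x).
Proof.
move=> e0; have e0' : e != 0 by rewrite gt_eqF.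
have h : is_derive x (1 : R) (fun t : R => (t - y) * e^-1) e^-1.
  apply: (@is_derive_eq _ _ _ (fun t => (t - y) * e^-1) x 1 _ _
   (is_deriveM (is_deriveB (is_derive_id _ _) (is_derive_cst _ _ _))
      (is_derive_cst _ _ _))).
  by rewrite subr0 scaler0 add0r /GRing.scale/= mulr1.
have H := @is_derive1_comp _ (@atan R) (fun t : R => (t - y) * e^-1) x _ _
  (is_derive1_atan ((x - y) / e)) h.
rewrite [X in is_derive _ _ _ X](_ : _ = (1 + ((x - y) / e) ^+ 2)^-1 * e^-1).
  exact: H.
have -> : 1 + ((x - y) / e) ^+ 2 = ((x - y) ^+ 2 + e ^+ 2) / e ^+ 2 by field.
by rewrite invf_div /cker [RHS]mulrAC expr2 mulfK.
Qed.

Lemma integral_cker e c d y : 0 < e -> c < d ->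
  (\int[@lebesgue_measure R]_(x in `[c, d]) (e * cker e x y)%:E =
   (atan_diff e c d y)%:E)%E.
Proof.
move=> e0 cd; rewrite /atan_diff EFinB.
under eq_integral do rewrite ckerC.
have dF x := is_derive_atan_cker x y e0.
have cF x : {for x, continuous (fun t => atan ((t - y) / e))}.
  apply: differentiable_continuous; apply/derivable1_diffP.
  by have [] := dF x.
apply: (@continuous_FTC2 _ (fun x => e * cker e y x) (fun t => atan ((t - y) / e))) => //.
- apply: continuous_subspaceT => x; apply: cvgM; first exact: cvg_cst.
  exact: continuous_cker.
- split.
  + by move=> x _; have [] := dF x.
  + exact: cvg_at_right_filter (cF c).
  + exact: cvg_at_left_filter (cF d).
- by move=> x _; rewrite derive1E; have [_ ->] := dF x.
Qed.

Lemma atan_diff_ge0 e c d y : 0 < e -> c < d -> 0 <= atan_diff e c d y.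
Proof.
move=> e0 cd; rewrite subr_ge0 le_atan// ler_pM2r ?invr_gt0//; lra.
Qed.

Lemma atan_diff_lepi e c d y : atan_diff e c d y <= pi.
Proof.
by have := atan_ltpi2 ((d - y) / e); have := atan_gtNpi2 ((c - y) / e);
  rewrite /atan_diff; lra.
Qed.

Lemma cvg_atan_scale (a : R) : 0 < a ->
  atan (a / n.+1%:R^-1) @[n --> \oo] --> (pi / 2 : R).
Proof.
move=> a0; have h : (n.+1%:R * a : R) @[n --> \oo] --> +oo.
  apply/cvgryPge => M; near=> n.
  rewrite -ler_pdivrMr// (@le_trans _ _ n%:R) ?ler_nat//.
  by near: n; exact: nbhs_infty_ger.
have := cvg_comp _ _ h (@cvgy_atan R).
suff -> : (fun n => atan (a / n.+1%:R^-1)) = atan \o (fun n => n.+1%:R * a) by [].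
by apply/funext => n /=; rewrite invrK mulrC.
Unshelve. all: by end_near. Qed.

Lemma cvg_atan_scaleN (a : R) : a < 0 ->
  atan (a / n.+1%:R^-1) @[n --> \oo] --> (- (pi / 2) : R).
Proof.
move=> a0; have a0' : 0 < - a by rewrite oppr_gt0.
rewrite (_ : (fun n => _) = \- (fun n => atan (- a / n.+1%:R^-1))).
  by apply: cvgN; exact: cvg_atan_scale.
by apply/funext => n /=; rewrite mulNr atanN opprK.
Qed.

Lemma cvg_atan_diff c d y : c < d -> y != c -> y != d ->
  atan_diff n.+1%:R^-1 c d y @[n --> \oo] --> (pi * \1_(`]c, d[%classic) y : R).
Proof.
move=> cd yc yd; rewrite indicE.
have [yc'|yc'|yE] := ltgtP y c; last by rewrite yE eqxx in yc.
  rewrite memNset/=; last by rewrite in_itv/= => /andP[]; lra.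
  have -> : pi * 0 = pi / 2 - pi / 2 :> R by ring.
  by apply: cvgB; apply: cvg_atan_scale; lra.
have [yd'|yd'|yE] := ltgtP y d; last by rewrite yE eqxx in yd.
  rewrite mem_set/=; last by rewrite in_itv/= yc' yd'.
  have -> : pi * 1 = pi / 2 - (- (pi / 2)) :> R by field.
  by apply: cvgB; [apply: cvg_atan_scale|apply: cvg_atan_scaleN]; lra.
rewrite memNset/=; last by rewrite in_itv/= => /andP[]; lra.
have -> : pi * 0 = - (pi / 2) - (- (pi / 2)) :> R by ring.
by apply: cvgB; apply: cvg_atan_scaleN; lra.
Qed.

Lemma measurable_cker_pair e : 0 < e ->
  measurable_fun [set: R * R] (fun z => cker e z.1 z.2).
Proof.
move=> e0.
have -> : (fun z : R * R => cker e z.1 z.2) = cker e 0 \o (fun z => z.2 - z.1).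
  by apply/funext => z /=; rewrite /cker subr0.
apply: measurableT_comp.
  by apply: continuous_measurable_fun; exact: continuous_cker.
by apply: measurable_funB; [exact: measurable_snd|exact: measurable_fst].
Qed.

Section density.
Variable mu : {finite_measure set R -> \bar R}.
Variable h : R -> R -> R.
Hypothesis hE : forall e x, 0 < e -> (\int[mu]_y (cker e x y)%:E)%E = (h e x)%:E.

Let h_ge0 e x : 0 < e -> 0 <= h e x.
Proof.
move=> e0; rewrite -lee_fin -hE//; apply: integral_ge0 => y _.
by rewrite lee_fin cker_ge0.
Qed.

(** The kernel is e^-2 at its centre. *)
Lemma poisson_atom x e : 0 < e -> (mu [set x] <= (e * (e * h e x))%:E)%E.
Proof.
move=> e0; rewrite mulrA EFinM -hE// -ge0_integralZl//; last 3 first.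
- exact: measurable_cker.
- by move=> y _; rewrite lee_fin cker_ge0.
- by rewrite lee_fin mulr_ge0// ltW.
have -> : mu [set x] = (\int[mu]_(y in [set x]) cst 1 y)%E.
  by rewrite integral_cst// mul1e.
apply: (@le_trans _ _ (\int[mu]_(y in [set x]) ((e * e)%:E * (cker e x y)%:E))%E).
  apply: ge0_le_integral => //.
    by apply: emeasurable_funM => //; exact: measurable_cker.
  move=> y ->; rewrite -EFinM lee_fin /cker subrr expr0n add0r -expr2.
  by rewrite mulfV// sqrf_eq0 gt_eqF.
apply: ge0_subset_integral => //.
  by apply: emeasurable_funM => //; exact: measurable_cker.
by move=> y _; rewrite -EFinM lee_fin !mulr_ge0 ?cker_ge0// ltW.
Qed.

Lemma poisson_fubini e c d : 0 < e -> c < d ->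
  (\int[@lebesgue_measure R]_(x in `[c, d]) (e * h e x)%:E =
   \int[mu]_y (atan_diff e c d y)%:E)%E.
Proof.
move=> e0 cd.
pose f (z : R * R) : \bar R := (\1_(`[c, d]%classic) z.1 * (e * cker e z.1 z.2))%:E.
have mf : measurable_fun setT f.
  apply/measurable_EFinP; apply: measurable_funM.
    by apply: measurableT_comp => //; exact: measurable_fst.
  by apply: measurable_funM => //; exact: measurable_cker_pair.
have f0 z : (0 <= f z)%E.
  by rewrite lee_fin !mulr_ge0 ?cker_ge0// ltW.
have := @fubini_tonelli _ _ _ _ _ (@lebesgue_measure R) mu f mf f0.
have -> : (\int[@lebesgue_measure R]_x \int[mu]_y f (x, y) =
  \int[@lebesgue_measure R]_(x in `[c, d]) (e * h e x)%:E)%E.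
  rewrite [RHS]integral_mkcond; apply: eq_integral => x _.
  rewrite patchE /f/=; under eq_integral do rewrite mulrA EFinM.
  rewrite ge0_integralZl//; last 3 first.
  - exact: measurable_cker.
  - by move=> y _; rewrite lee_fin cker_ge0.
  - by rewrite lee_fin mulr_ge0// ltW.
  rewrite hE// -EFinM indicE; case: ifPn => xD; first by rewrite mul1r.
  by rewrite !mul0r.
move=> ->; apply: eq_integral => y _; rewrite -integral_cker//.
rewrite [RHS]integral_mkcond; apply: eq_integral => x _.
rewrite patchE /f/= indicE; case: ifPn => xD; first by rewrite mul1r.
by rewrite mul0r.
Qed.

(** By Fubini the integral of e h over [c, d] is the integral of
    [atan_diff e c d] against mu. As e tends to 0 this function tends boundedly
    to pi times the indicator of ]c, d[, except at c and d, which are null. *)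
Lemma poisson_density (p : R -> R) c d : c < d ->
  measurable_fun setT p -> (forall x, 0 <= p x) ->
  mu [set c] = 0%E -> mu [set d] = 0%E ->
  (forall eta, 0 < eta -> exists2 e0, 0 < e0 & forall e x, 0 < e < e0 ->
     c <= x <= d -> `|e * h e x - pi * p x| <= eta) ->
  (mu `]c, d[%classic = \int[@lebesgue_measure R]_(x in `]c, d[) (p x)%:E)%E.
Proof.
move=> cd mp p0 muc mud hp.
pose a n : R := n.+1%:R^-1.
have a0 n : 0 < a n by rewrite invr_gt0 ltr0n.
pose A n : \bar R := (\int[@lebesgue_measure R]_(x in `[c, d]) (a n * h (a n) x)%:E)%E.
have AE n : A n = (\int[mu]_y (atan_diff (a n) c d y)%:E)%E.
  exact: poisson_fubini.
have matan e : measurable_fun setT (fun y => (atan_diff e c d y)%:E).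
  apply/measurable_EFinP; apply: continuous_measurable_fun => y.
  have ca (z : R) : atan ((z - t) / e) @[t --> y] --> atan ((z - y) / e).
    apply: continuous_cvg; first exact: continuous_atan.
    apply: cvgM; last exact: cvg_cst.
    by apply: cvgB; [exact: cvg_cst|exact: cvg_id].
  by apply: cvgB; exact: ca.
have lim1 : A n @[n --> \oo] --> (pi%:E * mu `]c, d[%classic)%E.
  have -> : A = (fun n => \int[mu]_y (atan_diff (a n) c d y)%:E)%E.
    by apply/funext.
  have -> : (pi%:E * mu `]c, d[%classic = \int[mu]_y (pi * \1_(`]c, d[%classic) y)%:E)%E.
    under eq_integral do rewrite EFinM.
    rewrite ge0_integralZl//; do ?[by rewrite lee_fin pi_ge0|
      by apply/measurable_EFinP].
    by rewrite integral_indic// setIT.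
  have mD : measurable [set: R] by [].
  have := @dominated_convergence _ _ _ mu setT mD
    (fun n y => (atan_diff (a n) c d y)%:E)
    (fun y => (pi * \1_(`]c, d[%classic) y)%:E) (cst (pi%:E)).
  case => //.
  - by apply/measurable_EFinP; apply: measurable_funM.
  - exists ([set c] `|` [set d]); split.
    + exact: measurableU.
    + apply/eqP; rewrite -measure_le0.
      have z (x y : \bar R) : x = 0%E -> y = 0%E -> (x + y <= 0)%E.
        by move=> -> ->; rewrite adde0.
      apply: (le_trans (measureU2 mu (measurable_set1 c) (measurable_set1 d))).
      exact: (z _ _ muc mud).
    + move=> y /= /not_implyP[_ hy]; apply: contrapT => /not_orP[yc yd].
      apply: hy; apply: cvg_EFin; first exact: nearW.
      by apply: cvg_atan_diff => //; exact/eqP.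
  - exact: finite_measure_integrable_cst.
  - apply: aeW => y n _; rewrite lee_fin ger0_norm ?atan_diff_ge0//.
    exact: atan_diff_lepi.
pose P := (\int[@lebesgue_measure R]_(x in `[c, d]) (pi * p x)%:E)%E.
have PE : P = (pi%:E * \int[@lebesgue_measure R]_(x in `]c, d[) (p x)%:E)%E.
  rewrite -(integral_itv_bndoo true false); last first.
    by apply/measurable_EFinP; exact: measurable_funTS.
  rewrite -ge0_integralZl//; last 3 first.
  - by apply/measurable_EFinP; exact: measurable_funTS.
  - by move=> x _; rewrite lee_fin.
  - by rewrite lee_fin pi_ge0.
suff : (pi%:E * mu `]c, d[%classic)%E = P.
  rewrite PE => /(congr1 (fun z => (pi^-1)%:E * z)%E).
  by rewrite !muleA -!EFinM mulVf ?mul1e// gt_eqF// pi_gt0.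
have A0 n : (0 <= A n)%E.
  by apply: integral_ge0 => x _; rewrite lee_fin mulr_ge0 ?h_ge0// ltW.
have Afin n : A n \is a fin_num.
  rewrite ge0_fin_numE// AE.
  apply: (@le_lt_trans _ _ (\int[mu]_y cst pi%:E y)%E).
    apply: ge0_le_integral => //.
    - by move=> y _; rewrite lee_fin atan_diff_ge0.
    - by move=> y _; rewrite lee_fin atan_diff_lepi.
  by rewrite integral_cst// ltey_eq fin_numM// fin_num_measure.
have mAn n : measurable_fun (`[c, d]%classic : set R) (fun x => (a n * h (a n) x)%:E).
  apply: measurable_funTS; apply/measurable_EFinP; apply: measurable_funM => //.
  apply/measurable_EFinP.
  rewrite (_ : EFin \o _ = fun x => (\int[mu]_y (cker (a n) x y)%:E)%E); last first.
    by apply/funext => x /=; rewrite hE.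
  apply: (@measurable_fun_fubini_tonelli_F _ _ _ _ _ mu
    (fun z : R * R => (cker (a n) z.1 z.2)%:E)).
    by apply/measurable_EFinP; exact: measurable_cker_pair.
  by move=> z; rewrite lee_fin cker_ge0.
have mp' : measurable_fun (`[c, d]%classic : set R) (fun x => (pi * p x)%:E).
  by apply/measurable_EFinP; apply: measurable_funM => //; exact: measurable_funTS.
have close eta : 0 < eta -> \forall n \near \oo,
    (A n <= P + (eta * (d - c))%:E)%E /\ (P <= A n + (eta * (d - c))%:E)%E.
  move=> eta0; have [e1 e10 he] := hp _ eta0.
  near=> n.
  have an : 0 < a n < e1.
    by rewrite a0/=; near: n; exact: near_infty_natSinv_lt (PosNum e10).
  have hn x : x \in `[c, d] -> `|a n * h (a n) x - pi * p x| <= eta.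
    by rewrite in_itv/= => hx; exact: he.
  have etaE : ((eta * (d - c))%:E = \int[@lebesgue_measure R]_(x in `[c, d]) cst eta%:E x)%E.
    by rewrite integral_cst//= lebesgue_measure_itv/= lte_fin cd -EFinD -EFinM.
  rewrite etaE; split; rewrite -ge0_integralD//; do ?[exact: mAn|
    by move=> x _; rewrite lee_fin ?mulr_ge0 ?pi_ge0// ?h_ge0// ltW].
  - apply: ge0_le_integral => //; do ?[exact: mAn|
      by apply: emeasurable_funD => //; exact: mAn|by apply: emeasurable_funD|
      by move=> x _; rewrite lee_fin ?mulr_ge0 ?pi_ge0// ?h_ge0// ltW].
    move=> x /hn; rewrite ler_norml -EFinD lee_fin => /andP[? ?]; lra.
  - apply: ge0_le_integral => //; do ?[exact: mAn|
      by apply: emeasurable_funD => //; exact: mAn|by apply: emeasurable_funD|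
      by move=> x _; rewrite lee_fin ?mulr_ge0 ?pi_ge0// ?h_ge0// ltW].
    move=> x /hn; rewrite ler_norml -EFinD lee_fin => /andP[? ?]; lra.
have P0 : (0 <= P)%E.
  by apply: integral_ge0 => x _; rewrite lee_fin mulr_ge0 ?pi_ge0.
have Pfin : P \is a fin_num.
  have [N _ /(_ N (leqnn N)) [_ PN]] := close _ ltr01.
  rewrite ge0_fin_numE//; apply: (le_lt_trans PN).
  by rewrite ltey_eq fin_numD Afin.
have lim2 : A n @[n --> \oo] --> P.
  rewrite -(fineK Pfin) (_ : A = EFin \o (fine \o A)); last first.
    by apply/funext => n /=; rewrite fineK.
  apply: cvg_EFin; first exact: nearW.
  apply/cvgrPdist_le => eps eps0; have dc0 : 0 < d - c by rewrite subr_gt0.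
  apply: filterS (close _ (divr_gt0 eps0 dc0)) => n.
  rewrite divfK ?gt_eqF// -(fineK Pfin) -(fineK (Afin n)) -!EFinD !lee_fin.
  by move=> [h1 h2]; rewrite /= ler_norml; apply/andP; split; lra.
exact: (cvg_unique (@ereal_hausdorff R) lim1 lim2).
Unshelve. all: by end_near. Qed.

End density.
End poisson_kernel.

(** * Measures that have a density off finitely many points *)

Section density_measure.
Context {R : realType}.
Variable p : R -> R.
Hypothesis mp : measurable_fun setT p.
Hypothesis p0 : forall x, 0 <= p x.

Definition dens (B : set R) : \bar R := (\int[@lebesgue_measure R]_(x in B) (p x)%:E)%E.

Let dens0 : dens set0 = 0%E. Proof. exact: integral_set0. Qed.

Let dens_ge0 B : (0 <= dens B)%E.
Proof. by apply: integral_ge0 => x _; rewrite lee_fin. Qed.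

Lemma measurable_densfun (B : set R) : measurable_fun B (fun x => (p x)%:E).
Proof. by apply: measurable_funTS; exact/measurable_EFinP. Qed.

Let dens_sigma : semi_sigma_additive dens.
Proof.
move=> F mF tF mUF; rewrite /dens ge0_integral_bigcup//.
- by apply: is_cvg_nneseries => n _ _; exact: dens_ge0.
- exact: measurable_densfun.
- by move=> x _; rewrite lee_fin.
Qed.

HB.instance Definition _ := isMeasure.Build _ _ _ dens dens0 dens_ge0 dens_sigma.

Definition dens_measure : {measure set R -> \bar R} := dens.

Lemma dens_set1 x : dens [set x] = 0%E.
Proof. exact: integral_set1. Qed.

Lemma dens_dominated : dens_measure `<< @lebesgue_measure R.
Proof.
move=> N hN A mA AN; apply: null_set_integral => //.
- exact: measurable_densfun.
- exact: hN.
Qed.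

End density_measure.

Section glue.
Context {R : realType}.
Variable p : R -> R.
Hypothesis mp : measurable_fun setT p.
Hypothesis p0 : forall x, 0 <= p x.
Variable mu : {finite_measure set R -> \bar R}.

Lemma measurable_seq (Z : seq R) : measurable [set` Z].
Proof.
elim: Z => [|z Z IH].
  by rewrite (_ : [set` _] = set0)//; apply/seteqP; split.
rewrite (_ : [set` _] = [set z] `|` [set` Z]); first exact: measurableU.
apply/seteqP; split => x /=; first by rewrite inE => /orP[/eqP|]; [left|right].
by move=> [->|xZ]; rewrite inE ?eqxx// xZ orbT.
Qed.

Variable Z : seq R.
Hypothesis hZ : forall c d, c < d -> (forall x, c <= x <= d -> x \notin Z) ->
  mu `]c, d[%classic = dens p `]c, d[%classic.

Let mZ : measurable (~` [set` Z]) := measurableC (measurable_seq Z).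
Let muZ := mrestr mu mZ.
Let nu := dens_measure mp p0.

Let glue_open a b : (forall x, a < x < b -> x \notin Z) ->
  mu `]a, b[%classic = nu `]a, b[%classic.
Proof.
move=> hab.
pose F n : set R := `]a + n.+1%:R^-1, b - n.+1%:R^-1[%classic.
have FU : `]a, b[%classic = \bigcup_n F n.
  apply/seteqP; split => x /=.
    rewrite in_itv/= => /andP[ax xb].
    have m0 : 0 < Num.min (x - a) (b - x) by rewrite lt_min !subr_gt0 ax xb.
    have [N _ /(_ N (leqnn N))/=] := near_infty_natSinv_lt (PosNum m0).
    rewrite lt_min => /andP[h1 h2]; exists N => //.
    have aux (j : R) : j < x - a -> j < b - x -> a + j < x < b - j.
      by move=> ? ?; apply/andP; split; lra.
    by rewrite /F/= in_itv/=; exact: aux.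
  move=> [n _]; rewrite /F/= !in_itv/= => /andP[h1 h2].
  have aux (j : R) : 0 < j -> a + j < x -> x < b - j -> a < x < b.
    by move=> ? ? ?; apply/andP; split; lra.
  by apply: aux h1 h2; rewrite invr_gt0 ltr0n.
have mF n : measurable (F n) by exact: measurable_itv.
have mUF : measurable (\bigcup_n F n) by rewrite -FU; exact: measurable_itv.
have ndF : nondecreasing_seq F.
  apply/nondecreasing_seqP => n; apply/subsetPset => x.
  rewrite /F/= !in_itv/= => /andP[h1 h2].
  have aux (i j : R) : i <= j -> a + j < x -> x < b - j -> a + i < x < b - i.
    by move=> ? ? ?; apply/andP; split; lra.
  by apply: aux h1 h2; rewrite lef_pV2 ?posrE ?ltr0n// ler_nat.
have FE n : mu (F n) = nu (F n).
  have [h|h] := ltP (a + n.+1%:R^-1) (b - n.+1%:R^-1); last first.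
    by rewrite /F set_itv_ge ?measure0// bnd_simp -leNgt.
  apply: hZ => // x /andP[h1 h2]; apply: hab.
  have aux (j : R) : 0 < j -> a + j <= x -> x <= b - j -> a < x < b.
    by move=> ? ? ?; apply/andP; split; lra.
  by apply: aux h1 h2; rewrite invr_gt0 ltr0n.
rewrite FU.
have c1 := nondecreasing_cvg_mu (mu := mu) mF mUF ndF.
have c2 := nondecreasing_cvg_mu (mu := nu) mF mUF ndF.
have E : mu \o F = nu \o F by apply/funext => n; exact: FE.
rewrite E in c1.
exact: (cvg_unique (@ereal_hausdorff R) c1 c2).
Qed.

Let glue_split a z b : a < z < b -> z \in Z ->
  muZ `]a, b[%classic = (muZ `]a, z[%classic + muZ `]z, b[%classic)%E.
Proof.
move=> /andP[az zb] zZ; rewrite /muZ /mrestr -measureU.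
- congr (mu _); apply/seteqP; split => x /=.
    rewrite !in_itv/= => -[/andP[ax xb] xZ].
    by case: (ltgtP x z) => h; [left; rewrite ax|right; rewrite xb|rewrite h in xZ].
  rewrite !in_itv/= => -[[/andP[h1 h2] h3]|[/andP[h1 h2] h3]]; split => //.
    by rewrite h1 (lt_trans h2).
  by rewrite h2 (lt_trans _ h1).
- by apply: measurableI => //; exact: measurable_itv.
- by apply: measurableI => //; exact: measurable_itv.
- apply/seteqP; split => // x /= [[+ _] [+ _]].
  by rewrite !in_itv/= => /andP[_ h1] /andP[h2 _]; have := lt_trans h1 h2; rewrite ltxx.
Qed.

Let dens_split a z b : a < z < b ->
  nu `]a, b[%classic = (nu `]a, z[%classic + nu `]z, b[%classic)%E.
Proof.
move=> /andP[az zb].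
have -> : `]a, b[%classic = `]a, z[%classic `|` ([set z] `|` `]z, b[%classic) :> set R.
  apply/seteqP; split => x /=.
    rewrite !in_itv/= => /andP[ax xb].
    by case: (ltgtP x z) => h; [left; rewrite ax|right; right; rewrite xb|right; left].
  rewrite !in_itv/= => -[/andP[h1 h2]|[->|/andP[h1 h2]]].
  - by rewrite h1 (lt_trans h2).
  - by rewrite az zb.
  - by rewrite h2 (lt_trans _ h1).
rewrite measureU//.
- congr (_ + _)%E; rewrite measureU//.
    transitivity (0 + nu `]z, b[%classic)%E; last by rewrite add0e.
    by congr (_ + _)%E; exact: dens_set1.
  apply/seteqP; split => // x /= [->]; by rewrite in_itv/= ltxx.
- by apply: measurableU => //; exact: measurable_set1.
- apply/seteqP; split => // x /= [].
  rewrite !in_itv/= => /andP[_ h1] [h|/andP[h2 _]].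
    by rewrite h ltxx in h1.
  by have := lt_trans h1 h2; rewrite ltxx.
Qed.

Let glue_list (L : seq R) (a b : R) : (forall x, a < x < b -> x \in Z -> x \in L) ->
  muZ `]a, b[%classic = nu `]a, b[%classic.
Proof.
elim: L a b => [|z L IH] a b hL.
  rewrite -glue_open.
    rewrite /muZ /mrestr; congr (mu _); apply/seteqP; split => x /=; first by case.
    move=> h; split => // xZ; move: h; rewrite in_itv/= => /hL/(_ xZ).
    by rewrite in_nil.
  by move=> x /hL h; apply/negP => /h; rewrite in_nil.
have [zab|zab] := boolP (a < z < b); last first.
  apply: IH => x xab xZ; have := hL x xab xZ; rewrite inE => /orP[/eqP xz|//].
  by rewrite xz (negbTE zab) in xab.
have [zZ|zZ] := boolP (z \in Z); last first.
  apply: IH => x xab xZ; have := hL x xab xZ; rewrite inE => /orP[/eqP xz|//].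
  by rewrite -xz xZ in zZ.
rewrite (glue_split zab zZ) (dens_split zab); case/andP: zab => az zb.
congr (_ + _)%E; apply: IH => x /andP[h1 h2] xZ.
  have := hL x _ xZ; rewrite h1 (lt_trans h2 zb) inE => /(_ isT) /orP[/eqP xz|//].
  by rewrite xz ltxx in h2.
have := hL x _ xZ; rewrite h2 (lt_trans az h1) inE => /(_ isT) /orP[/eqP xz|//].
by rewrite xz ltxx in h1.
Qed.

(** An open interval is cut at the points of Z, and each piece is exhausted by
    smaller intervals whose closure avoids Z. So mu off Z and p dx agree on open
    intervals, a family closed under intersection that generates the Borel
    sets. *)
Lemma measure_off_points B : measurable B -> mu (B `\` [set` Z]) = dens p B.
Proof.
move=> mB.
have mE : (R.-ocitv.-measurable).-sigma.-measurable = <<s @RGenOpens.G R >>.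
  by rewrite RGenOpens.measurableE.
apply: (@measure_unique _ _ _ (@RGenOpens.G R) (fun n => `](- n%:R), n%:R[%classic)
  mE _ _ _ muZ nu _ _ B mB).
- move=> _ _ [a [b ->]] [c [d ->]]; exists (Num.max a c), (Num.min b d).
  apply/seteqP; split => x /=; rewrite !in_itv/= gt_max lt_min.
    by move=> [/andP[-> ->] /andP[-> ->]].
  by move=> /andP[/andP[-> ->] /andP[-> ->]].
- by move=> n; exists (- n%:R), n%:R.
- apply/seteqP; split => // x _; have [N _ /(_ N (leqnn N)) hN] := nbhs_infty_gtr `|x|.
  by exists N => //=; rewrite in_itv/= -ltr_norml.
- by move=> _ [a [b ->]]; apply: (@glue_list Z).
- by move=> n; rewrite ltey_eq fin_num_measure//; apply: measurableI.
Qed.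

End glue.

(** * The density and the functions f and g in terms of boundary values *)

Section measurable_inverse.
Context {R : realType}.

Lemma measurable_invr : measurable_fun [set: R] (@GRing.inv R).
Proof.
rewrite -(setUv [set (0 : R)]); apply/measurable_funU => //.
  exact: measurableC.
split; first exact: measurable_fun_set1.
apply: subspace_continuous_measurable_fun; first exact: measurableC.
apply: continuous_in_subspaceT => x; rewrite inE/= => /eqP x0.
exact: inv_continuous.
Qed.

Lemma measurable_fun_inv d (T : measurableType d) (D : set T) (f : T -> R) :
  measurable_fun D f -> measurable_fun D (fun x => (f x)^-1).
Proof. by move=> mf; apply: measurableT_comp => //; exact: measurable_invr. Qed.

End measurable_inverse.

Section density_algebra.
Context {R : realType}.
Implicit Types a b p n X w A B : R.

Lemma density_cancel a b p n : a != 0 -> p != 0 -> n != 0 ->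
  2 * a * b / (2 * p * (a * n)) = b / (p * n).
Proof. by move=> a0 p0 n0; field; rewrite a0 p0 n0. Qed.

Lemma mulf_cancel a b n : a != 0 -> a * b / (a * n) = b / n.
Proof. by move=> a0; rewrite invfM mulrACA mulfV// mul1r. Qed.

Lemma density_algebra X w A B p n : p != 0 -> n != 0 -> n = A ^+ 2 + B ^+ 2 ->
  (X * A - w) ^+ 2 + (X * B) ^+ 2 != 0 ->
  p * (w * (B / (p * n)) / ((X - w * (A / n)) ^+ 2 + (p * w * (B / (p * n))) ^+ 2)) =
  w * B / ((X * A - w) ^+ 2 + (X * B) ^+ 2).
Proof.
move=> p0 n0 nE D20.
have -> : (X - w * (A / n)) ^+ 2 + (p * w * (B / (p * n))) ^+ 2 =
  ((X * A - w) ^+ 2 + (X * B) ^+ 2) / n.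
  apply: (mulIf n0); rewrite divfK//.
  transitivity ((X ^+ 2 * n - 2 * X * w * A + w ^+ 2 * (A ^+ 2 + B ^+ 2) / n)).
    by field; rewrite p0 n0.
  by rewrite -nE mulfK// nE; ring.
by field; rewrite p0 D20 n0.
Qed.

End density_algebra.

Section qw_density_facts.
Context {R : realType}.
Variables r lam : R.
Hypothesis r0 : 0 < r.
Hypothesis r1 : r < 1.
Hypothesis lam0 : 0 < lam.
Local Notation be := (qw_beta r lam).
Local Notation al := (alt r lam).
Local Notation al1 := (alt1 r lam).
Local Notation al2 := (alt2 r lam).
Local Notation w1 := (omt1 r lam).
Local Notation w2 := (omt2 r lam).
Local Notation bA s := (bd_num_re al2 al w2 be s).
Local Notation bB := (bd_num_im al w2 be).
Local Notation bD2 s := (bd_den2 al1 al2 al w1 w2 be s).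

Let be0 : 0 < be := qw_beta_gt0 r0 lam0.
Let be2 : be ^+ 2 = omt r lam := sqr_qw_beta r lam0.
Let w10 : 0 < w1 := omt1_gt0 r0 r1 lam0.
Let w20 : 0 < w2 := omt2_gt0 r0 r1 lam0.
Let om0 : 0 < omt r lam := omt_gt0 r0 r1 lam0.

Lemma in_bandE x : (x \in `[Sminus r lam, Splus r lam]) = ((x - al) ^+ 2 <= 4 * be ^+ 2).
Proof.
rewrite in_itv/= SminusE// SplusE//.
have -> : 4 * be ^+ 2 = (2 * be) ^+ 2 by ring.
have b2 : 0 < 2 * be by rewrite mulr_gt0.
rewrite -(real_normK (num_real (x - al))) ler_pXn2r ?nnegrE ?normr_ge0 ?(ltW b2)//.
by rewrite ler_norml; apply/idP/idP => /andP[h1 h2]; apply/andP; split; lra.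
Qed.

Lemma bd_num_im_gt0 x : (x - al) ^+ 2 < 4 * be ^+ 2 -> 0 < bB x.
Proof.
move=> h; rewrite /bd_num_im /bd_root_im !mulNr mulrN opprK.
apply: mulr_gt0; first exact: divr_gt0 w20 be0.
by apply: divr_gt0; [rewrite sqrtr_gt0 subr_gt0|exact: mulr_gt0].
Qed.

Lemma bd_num_im_out x : 4 * be ^+ 2 <= (x - al) ^+ 2 -> bB x = 0.
Proof. by move=> h; rewrite /bd_num_im bd_root_im_out// mulr0. Qed.

Lemma bd_den2_in s x : (x - al) ^+ 2 < 4 * be ^+ 2 -> bD2 s x != 0.
Proof.
move=> /bd_num_im_gt0 B0; rewrite /bd_den2 paddr_eq0 ?sqr_ge0// !sqrf_eq0 mulf_eq0.
rewrite (gt_eqF B0) orbF subr_eq0; apply/negP => /andP[/eqP h /eqP h'].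
by move: h; rewrite h' mul0r => /eqP; rewrite lt_eqF.
Qed.

Lemma bd_den2_out s x : 4 * be ^+ 2 <= (x - al) ^+ 2 -> bD2 s x = qw_den r lam s x ^+ 2.
Proof. by move=> h; rewrite /bd_den2 bd_num_im_out// mulr0 expr0n addr0. Qed.

(** Up to the factor omt, the denominator of the free Meixner law is |N|^2 on
    the boundary. *)
Lemma meixner_denE x : (x - al) ^+ 2 <= 4 * be ^+ 2 ->
  meixner_den w2 (al - al2) (omt r lam - w2) (x - al2) =
  omt r lam * (bA 1 x ^+ 2 + bB x ^+ 2).
Proof.
move=> h; have b0 : be != 0 by rewrite gt_eqF.
rewrite /meixner_den /bd_num_re /bd_num_im /bd_root_re /bd_root_im.
rewrite (ler0_sqrtr (_ : _ - 4 * _ <= 0)) ?subr_le0// mulr0 addr0.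
have := sqr_sqrtr (_ : 0 <= 4 * be ^+ 2 - (x - al) ^+ 2); rewrite subr_ge0 => /(_ h).
set q := Num.sqrt _ => q2; rewrite -be2.
transitivity (be ^+ 2 * (x - al2) ^+ 2 - w2 * (x - al2) * (x - al)
  + w2 ^+ 2 * ((x - al) ^+ 2 + q ^+ 2) / (4 * be ^+ 2)).
  by rewrite q2; field.
by field.
Qed.

(** So P and R are, up to normalization, the imaginary and the real part of
    the boundary value of 1 / N. *)
Lemma meixner_in x : (x - al) ^+ 2 <= 4 * be ^+ 2 ->
  qwP r lam (x - al2) = w2 * Num.sqrt (4 * be ^+ 2 - (x - al) ^+ 2) /
    (2 * pi * (omt r lam * (bA 1 x ^+ 2 + bB x ^+ 2))) /\
  qwR r lam (x - al2) = omt r lam * bA 1 x /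
    (omt r lam * (bA 1 x ^+ 2 + bB x ^+ 2)).
Proof.
move=> h; have b0 : be != 0 by rewrite gt_eqF.
have e1 : w2 + (omt r lam - w2) = be ^+ 2 by rewrite be2; ring.
have e2 : x - al2 - (al - al2) = x - al by ring.
split.
  rewrite /qwP /meixnerP e1 e2 meixner_denE// ifT//.
  move: h; rewrite -in_bandE !in_itv/= SminusE// SplusE// sqrtr_sqr (gtr0_norm be0).
  by move=> /andP[h1 h2]; apply/andP; split; lra.
rewrite /qwR /meixnerR meixner_denE//.
rewrite invfM mulrA; congr (_ / _).
rewrite /bd_num_re /bd_root_re (ler0_sqrtr (_ : _ - 4 * _ <= 0)) ?subr_le0// mulr0 addr0 -be2.
by field.
Qed.

(** Both sides are the imaginary part of - N / D = 1 / (omt1 / N - (x - alt1)),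
    written once through 1 / N and once through N. Outside the band both
    vanish. *)
Lemma qw_density_bd s x : (x - al) ^+ 2 != 4 * be ^+ 2 ->
  pi * qw_density r lam x = w1 * bB x / bD2 s x.
Proof.
move=> hne; rewrite /qw_density in_bandE.
have [h|h] := leP ((x - al) ^+ 2) (4 * be ^+ 2); last first.
  by rewrite bd_num_im_out ?(ltW h)// !mulr0 mul0r.
have hlt : (x - al) ^+ 2 < 4 * be ^+ 2 by rewrite lt_neqAle hne.
have B0 := bd_num_im_gt0 hlt; have b0 : be != 0 by rewrite gt_eqF.
have D20 := bd_den2_in s hlt.
have As : bA s x = bA 1 x.
  by rewrite /bd_num_re /bd_root_re (ler0_sqrtr (_ : _ - 4 * _ <= 0)) ?subr_le0// !mulr0.
have [-> ->] := meixner_in h.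
have BE : w2 * Num.sqrt (4 * be ^+ 2 - (x - al) ^+ 2) = 2 * omt r lam * bB x.
  by rewrite /bd_num_im /bd_root_im -be2; field.
rewrite BE; move: D20; rewrite /bd_den2 As.
set A := bA 1 x; set B := bB x; rewrite -/B in B0 *.
have [n nE] : {n | n = A ^+ 2 + B ^+ 2} by exists (A ^+ 2 + B ^+ 2).
have n0 : 0 < n by rewrite nE ltr_wpDl ?sqr_ge0// exprn_gt0.
have n1 : n != 0 by rewrite gt_eqF.
rewrite -nE.
have p0 : pi != 0 :> R by rewrite gt_eqF// pi_gt0.
have o0 : omt r lam != 0 by rewrite gt_eqF.
rewrite (density_cancel _ o0 p0 n1) (mulf_cancel _ _ o0) => D20.
exact: density_algebra.
Qed.

Lemma qw_density_ge0 x : 0 <= qw_density r lam x.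
Proof.
rewrite /qw_density in_bandE; case: ifPn => // h.
have [-> _] := meixner_in h.
have n0 : 0 <= bA 1 x ^+ 2 + bB x ^+ 2 by rewrite addr_ge0 ?sqr_ge0.
apply: divr_ge0; last by apply: addr_ge0; exact: sqr_ge0.
apply: mulr_ge0; first exact: ltW.
apply: divr_ge0; first by apply: mulr_ge0; [exact: ltW|exact: sqrtr_ge0].
apply: mulr_ge0; first by apply: mulr_ge0 => //; exact: pi_ge0.
by apply: mulr_ge0; [exact: ltW|exact: n0].
Qed.

Lemma measurable_qw_density : measurable_fun setT (qw_density r lam).
Proof.
have mA : measurable_fun [set: R] (bA 1).
  apply: continuous_measurable_fun => x.
  apply: cvgB; first by apply: cvgB; [exact: cvg_id|exact: cvg_cst].
  by apply: cvgM; [exact: cvg_cst|exact: continuous_bd_root_re].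
have mB : measurable_fun [set: R] bB.
  apply: continuous_measurable_fun => x.
  by apply: cvgM; [exact: cvg_cst|exact: continuous_bd_root_im].
have ms c : measurable_fun [set: R] (fun x => x - c).
  by apply: measurable_funB.
have mq : measurable_fun [set: R] (fun x => Num.sqrt (4 * be ^+ 2 - (x - al) ^+ 2)).
  apply: continuous_measurable_fun => x.
  apply: continuous_cvg; first exact: sqrt_continuous.
  apply: cvgB; first exact: cvg_cst.
  by apply: cvgM; apply: cvgB; (exact: cvg_id || exact: cvg_cst).
pose n x := bA 1 x ^+ 2 + bB x ^+ 2.
have mn : measurable_fun [set: R] n by apply: measurable_funD; exact: measurable_funX.
pose P x := w2 * Num.sqrt (4 * be ^+ 2 - (x - al) ^+ 2) / (2 * pi * (omt r lam * n x)).
have mP : measurable_fun [set: R] P.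
  apply: measurable_funM; first exact: measurable_funM.
  by apply: measurable_fun_inv; apply: measurable_funM => //; exact: measurable_funM.
pose Q x := omt r lam * bA 1 x / (omt r lam * n x).
have mQ : measurable_fun [set: R] Q.
  apply: measurable_funM; first exact: measurable_funM.
  by apply: measurable_fun_inv; exact: measurable_funM.
pose F x := w1 * P x / ((x - al1 - w1 * Q x) ^+ 2 + (pi * w1 * P x) ^+ 2).
have mF : measurable_fun [set: R] F.
  apply: measurable_funM; first exact: measurable_funM.
  apply: measurable_fun_inv; apply: measurable_funD; apply: measurable_funX.
    by apply: measurable_funB => //; exact: measurable_funM.
  exact: measurable_funM.
have -> : qw_density r lam = F \_ [set` `[Sminus r lam, Splus r lam] ].
  apply/funext => x; rewrite patchE /qw_density mem_setE.
  case: ifPn => // xin; rewrite /F; move: xin; rewrite in_bandE => h.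
  by have [-> ->] := meixner_in h.
apply/(measurable_restrictT _ _).1; first exact: measurable_itv.
exact: measurable_funTS.
Qed.

Lemma continuous_qw_fg s x : x != al1 -> {for x, continuous (qw_fg r lam s)}.
Proof.
move=> xa; apply: cvgB.
  apply: cvgV; first by rewrite subr_eq0.
  by apply: cvgB; [exact: cvg_id|exact: cvg_cst].
apply: cvgM; first exact: cvg_cst.
apply: cvgB; first by apply: cvgB; [exact: cvg_id|exact: cvg_cst].
by apply: cvgM; [exact: cvg_cst|exact: continuous_bd_root_re].
Qed.

Lemma qw_fE x : x <= Sminus r lam -> qw_f r lam x = (qw_fg r lam 1 x)%:E.
Proof.
move=> xS; rewrite /qw_f; case: eqP => [->|_]; last by rewrite f_formulaE.
have Sn : Sminus r lam != al1 by rewrite lt_eqF// Sminus_lt_alt1.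
apply/cvg_lim => //; apply: cvg_EFin; first exact: nearW.
have -> : fine \o (fun y => (f_formula r lam y)%:E) = qw_fg r lam 1.
  by apply/funext => y /=; rewrite f_formulaE.
by apply: cvg_at_left_filter; exact: continuous_qw_fg.
Qed.

Lemma qw_gE x : x != al1 -> qw_g r lam x = (qw_fg r lam (-1) x)%:E.
Proof.
move=> xa; rewrite /qw_g; case: eqP => [xS|_]; last by rewrite g_formulaE.
rewrite -xS; apply/cvg_lim => //; apply: cvg_EFin; first exact: nearW.
have -> : fine \o (fun y => (g_formula r lam y)%:E) = qw_fg r lam (-1).
  by apply/funext => y /=; rewrite g_formulaE.
by apply: cvg_at_right_filter; exact: continuous_qw_fg.
Qed.

(** If the right edge is alt1, the pole of 1 / (x - alt1) makes the endpoint
    value of g infinite, so that it is not a zero. *)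
Lemma qw_g_alt1 : Splus r lam = al1 -> qw_g r lam al1 = +oo%E.
Proof.
move=> Sa; rewrite /qw_g Sa eqxx; apply/cvg_lim => //; apply/cvgeyPge => M.
have cb : (fun y => w1^-1 * bA (-1) y) y @[y --> al1^'+] --> w1^-1 * bA (-1) al1.
  apply: cvg_at_right_filter; apply: cvgM; first exact: cvg_cst.
  apply: cvgB; first by apply: cvgB; [exact: cvg_id|exact: cvg_cst].
  by apply: cvgM; [exact: cvg_cst|exact: continuous_bd_root_re].
set c := w1^-1 * _ in cb.
have dd : 0 < (`|M + c + 1| + 1)^-1 by rewrite invr_gt0 ltr_wpDl.
near=> y; rewrite lee_fin g_formulaE// /qw_fg.
have ya : 0 < y - al1 by rewrite subr_gt0; near: y; exact: nbhs_right_gt.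
have ys : y - al1 < (`|M + c + 1| + 1)^-1.
  by rewrite ltrBlDl; near: y; apply: nbhs_right_lt; rewrite ltrDl.
have yc : `|c - w1^-1 * bA (-1) y| <= 1.
  by near: y; move/cvgrPdist_le : cb; apply.
have : `|M + c + 1| + 1 < (y - al1)^-1.
  by rewrite -[ltLHS]invrK ltf_pV2 ?posrE// invrK ltr_wpDl.
have := ler_norm (M + c + 1); move: yc; rewrite ler_norml => /andP[h1 h2]; lra.
Unshelve. all: by end_near. Qed.

End qw_density_facts.

(** * The spectral distribution of the operator C *)

Section qwC_linear.
Context {R : realType} {H : completeNormedModType R[i]}.
Variables (Bm Bp : {linear H -> H}) (lam : R).

Let shift_linear (B : {linear H -> H}) (s a : R[i]) u v :
  B (a *: u + v) + s *: (a *: u + v) = a *: (B u + s *: u) + (B v + s *: v).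
Proof. by rewrite linearP !scalerDr !scalerA (mulrC s) addrACA. Qed.

Lemma qwC_is_linear : linear (qwC Bm Bp lam).
Proof. by move=> a u v; rewrite /qwC shift_linear shift_linear. Qed.

HB.instance Definition _ := GRing.isLinear.Build R[i] H H *:%R (qwC Bm Bp lam)
  qwC_is_linear.

Definition qwT : {linear H -> H} := qwC Bm Bp lam.

End qwC_linear.

#[local] Arguments om {R} r n : simpl never.

Section qw_measure.
Context {R : realType} (r lam : R).
Hypothesis r0 : 0 < r.
Hypothesis r1 : r < 1.
Hypothesis lam0 : 0 < lam.
Context {H : completeNormedModType R[i]} (dot : {dot H for Num.conj}).
Hypothesis hd : norm_of_dot dot.
Variable Phi : nat -> H.
Hypothesis Phi_cons : complete_orthonormal dot Phi.
Variables Bp Bm : {linear H -> H}.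
Hypothesis BpE : forall n, Bp (Phi n) = (Num.sqrt (om r n.+1))%:C *: Phi n.+1.
Hypothesis BmE : forall n, Bm (Phi n.+1) = (Num.sqrt (om r n.+1))%:C *: Phi n.
Hypothesis Bm0 : Bm (Phi 0%N) = 0.
Variable E : set R -> {linear H -> H}.
Hypothesis hET : is_spectral_measure dot E (qwC Bm Bp lam).

Local Notation normc := Normc.normc.
Local Notation T := (qwT Bm Bp lam).
Local Notation be := (qw_beta r lam).
Local Notation al := (alt r lam).
Local Notation al1 := (alt1 r lam).
Local Notation al2 := (alt2 r lam).
Local Notation w1 := (omt1 r lam).
Local Notation w2 := (omt2 r lam).
Local Notation l := (Num.sqrt lam).
Local Notation b1 := ((l * Num.sqrt (om r 1))%:C).
Local Notation b2 := ((l * Num.sqrt (om r 2))%:C).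

Let be0 : 0 < be. Proof. exact: qw_beta_gt0. Qed.
Let w10 : 0 < w1. Proof. exact: omt1_gt0. Qed.
Let w20 : 0 < w2. Proof. exact: omt2_gt0. Qed.
Let l0 : 0 < l. Proof. exact: sqrt_lam_gt0. Qed.

Let Phi_orth : forall m n, dot (Phi m) (Phi n) = (m == n)%:R := Phi_cons.1.
Let hT : is_spectral_measure dot E T := hET.
Let hE : projection_valued_measure dot E. Proof. by case: hT. Qed.

Let sqC (a : R) : 0 <= a -> (Num.sqrt a)%:C * (Num.sqrt a)%:C = a%:C :> R[i].
Proof. by move=> a0; rewrite -rmorphM/= -expr2 sqr_sqrtr. Qed.

Let bec : be%:C = l%:C * (Num.sqrt (om r 3))%:C :> R[i].
Proof.
rewrite -rmorphM; congr (_%:C); rewrite /qw_beta om3E.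
have -> : r ^+ 2 / 4 = (r / 2) ^+ 2 by field.
by rewrite sqrtr_sqr ger0_norm ?mulrA// divr_ge0// ltW.
Qed.

Lemma T_Phi0 : T (Phi 0%N) = al1%:C *: Phi 0%N + b1 *: Phi 1%N.
Proof.
rewrite /qwT/= /qwC BpE linearD !linearZ/= BmE Bm0; apply: (dot_inj hd) => y.
rewrite scaler0 addr0 !(dotDl, dotZl) /alt1 rmorphD !rmorphM/=.
by rewrite -(sqC (ltW lam0)) -(sqC (ltW (om_gt0 r0 r1 0))); ring.
Qed.

Lemma T_PhiS n : T (Phi n.+1) = (lam + om r n.+2)%:C *: Phi n.+1 +
  (l * Num.sqrt (om r n.+2))%:C *: Phi n.+2 + (l * Num.sqrt (om r n.+1))%:C *: Phi n.
Proof.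
rewrite /qwT/= /qwC BpE linearD !linearZ/= !BmE; apply: (dot_inj hd) => y.
rewrite !(dotDl, dotZl) rmorphD !rmorphM/=.
by rewrite -(sqC (ltW lam0)) -(sqC (ltW (om_gt0 r0 r1 n.+1))); ring.
Qed.

Lemma T_Phi1 : T (Phi 1%N) = al2%:C *: Phi 1%N + b2 *: Phi 2%N + b1 *: Phi 0%N.
Proof. exact: T_PhiS. Qed.

Lemma T_Phi2 : T (Phi 2%N) = al%:C *: Phi 2%N + be%:C *: Phi 3%N + b2 *: Phi 1%N.
Proof. by rewrite bec -rmorphM; exact: T_PhiS. Qed.

Lemma T_Phi3 n : T (Phi n.+3) =
  al%:C *: Phi n.+3 + be%:C *: Phi n.+4 + be%:C *: Phi n.+2.
Proof. by rewrite bec -rmorphM; exact: T_PhiS. Qed.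

Let be0C : be%:C != 0 :> R[i].
Proof. by rewrite eq_complex /= eqxx andbT gt_eqF. Qed.

Let b1C : b1 != 0.
Proof.
rewrite eq_complex /= eqxx andbT gt_eqF// mulr_gt0// sqrtr_gt0; exact: om_gt0.
Qed.

Let b2C : b2 != 0.
Proof.
rewrite eq_complex /= eqxx andbT gt_eqF// mulr_gt0// sqrtr_gt0; exact: om_gt0.
Qed.

Let b1sq : b1 ^+ 2 = w1%:C.
Proof.
rewrite -rmorphXn/= exprMn sqr_sqrtr ?(ltW lam0)// sqr_sqrtr//.
exact: ltW (om_gt0 r0 r1 0).
Qed.

Let b2sq : b2 ^+ 2 = w2%:C.
Proof.
rewrite -rmorphXn/= exprMn sqr_sqrtr ?(ltW lam0)// sqr_sqrtr//.
exact: ltW (om_gt0 r0 r1 1).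
Qed.

Local Notation green_num := (green_num al2 w2 be).
Local Notation green_den := (green_den al1 al2 w1 w2 be).

Lemma jacobi_num_green z ze : jacobi_num al2%:C b2 be%:C z ze = green_num z ze.
Proof.
rewrite /jacobi_num b2sq /green_num; congr (_ - _ * _).
by rewrite [RHS]rmorphM; congr (_ * _); exact/esym/fmorphV.
Qed.

Lemma jacobi_den_green z ze : jacobi_den al1%:C al2%:C b1 b2 be%:C z ze = green_den z ze.
Proof. by rewrite /jacobi_den jacobi_num_green b1sq. Qed.

(** The spectral measure has compact support, so [localization] on the whole
    support bounds T. *)
Lemma T_bounded : exists M, forall v, hnorm (T v) <= M * hnorm v.
Proof.
case: hT => _ [M hM] _; exists (`|M| + 1) => v.
have d0 : 0 < `|M| + 1 by rewrite ltr_wpDl.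
have := @localization _ _ _ hd T E hT [set` `[- M, M]] 0 (`|M| + 1) v
  (measurable_itv _) (hM v) d0.
rewrite scale0r subr0; apply => x /=; rewrite in_itv/= => /andP[h1 h2].
rewrite subr0 ler_norml; have := ler_norm M => ?; apply/andP; split; lra.
Qed.

(** Im N is positive. If D were 0, then (z - al1) N would be the positive
    number w1, so that z - al1 and N would have opposite arguments, whereas
    both have positive imaginary part. *)
Lemma green_den_neq0 x e ze : 0 < e -> complex.Im ze <= 0 -> green_den (x +i* e) ze != 0.
Proof.
move=> e0; case: ze => a b /= b0; apply/eqP => /eqP.
rewrite eq_complex /green_den /green_num /= => /andP[/eqP h1 /eqP h2].
set A := x - al2 - _ in h1 h2; set B := e - 0 - _ in h1 h2.
have B0 : 0 < B.
  rewrite /B subr0 mul0r addr0 subr_gt0; apply: le_lt_trans e0.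
  by rewrite mulr_ge0_le0// divr_ge0// ltW.
have k1 : (x - al1) * A = e * B + w1 by lra.
have k2 : (x - al1) * B = - (e * A) by lra.
have : 0 < (x - al1) * A by rewrite k1 addr_gt0// mulr_gt0.
have : (x - al1) ^+ 2 * B = - e * ((x - al1) * A).
  by rewrite expr2 -mulrA k2; ring.
move=> k3 k4; have : 0 <= (x - al1) ^+ 2 * B by rewrite mulr_ge0 ?sqr_ge0// ltW.
by rewrite k3 mulNr oppr_ge0 leNgt mulr_gt0.
Qed.

Definition qw_mu : {finite_measure set R -> \bar R} := spmeas hd hE (Phi 0%N).
(** The Poisson integral of the spectral distribution, up to the factor
    e / pi. *)
Definition qw_poisson e x : R := fine (\int[qw_mu]_y (cker e x y)%:E).

(** From (T - z) u = Phi 0 and the symmetry of T, the imaginary part of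
    <u, Phi 0> is e |u|^2. *)
Lemma green_identity x e : 0 < e ->
  (\int[qw_mu]_y (cker e x y)%:E)%E = (qw_poisson e x)%:E /\
  exists ze, [/\ joukowski al be (x +i* e) ze, normc ze <= 1, complex.Im ze <= 0
    & e * qw_poisson e x = complex.Im (- (green_num (x +i* e) ze / green_den (x +i* e) ze))].
Proof.
move=> e0; have bne : be != 0 by rewrite gt_eqF.
have [ze hz n1] := joukowski_root_exists al (x +i* e) bne.
have [n1' im0] := joukowski_root_lower be0 e0 hz n1.
have [M hM] := T_bounded.
have Dne : jacobi_den al1%:C al2%:C b1 b2 be%:C (x +i* e) ze != 0.
  by rewrite jacobi_den_green green_den_neq0// ltW.
have [u Tu du] := jacobi_resolvent hd Phi_orth hM T_Phi0 T_Phi1 T_Phi2 T_Phi3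
  be0C hz n1' Dne.
have I := resolvent_integral hd hE hT e0 Tu.
have hI : qw_poisson e x = hnorm u ^+ 2 by rewrite /qw_poisson I.
split; first by rewrite hI.
exists ze; split=> //; first exact: ltW.
rewrite hI -jacobi_num_green -jacobi_den_green -mulNr -du.
have : complex.Im (dot (Phi 0%N) u) = - (e * hnorm u ^+ 2).
  rewrite -{1}Tu dotDl dotNl dotZl (dotvv hd) raddfD/= Im_dot.
  by rewrite (quad_real hT); ring.
by rewrite dotC; case: (dot u (Phi 0%N)) => p q /=; lra.
Qed.

Let qw_poissonE e x : 0 < e -> (\int[qw_mu]_y (cker e x y)%:E)%E = (qw_poisson e x)%:E.
Proof. by move=> /(green_identity x)[]. Qed.

Local Notation bD2 s := (bd_den2 al1 al2 al w1 w2 be s).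

(** An atom at x has mass at most e times the imaginary part of the Green
    function at x + i e, which stays bounded. *)
Lemma qw_mu_atom0 s x : root_side s al be x -> bD2 s x != 0 -> qw_mu [set x] = 0%E.
Proof.
move=> hs hD.
have [C [e0 [e00 he]]] := green_pointwise_bound be0 w20 hs hD.
apply/eqP; rewrite -measure_le0; apply/lee_addgt0Pr => d d0; rewrite add0e.
have C1 : 0 < `|C| + 1 by rewrite ltr_wpDl.
pose e := Num.min (e0 / 2) (d / (`|C| + 1)).
have ep : 0 < e by rewrite lt_min !divr_gt0.
have ee0 : 0 < e < e0.
  rewrite ep /=; apply: (@le_lt_trans _ _ (e0 / 2)); last by lra.
  by rewrite /e ge_min lexx.
have [_ [ze [hz n1 im0 hg]]] := green_identity x ep.
have hC := he e ze ee0 hz n1 im0.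
apply: (le_trans (poisson_atom qw_poissonE x ep)); rewrite lee_fin hg.
have ed : e * (`|C| + 1) <= d by rewrite -ler_pdivlMr// /e ge_min lexx orbT.
apply: le_trans ed; rewrite ler_pM2l//.
apply: (le_trans (ler_norm _)); apply: (le_trans hC).
by have := ler_norm C; lra.
Qed.

Section points.
(* zs contains all the zeros of D outside the band; Z adds the edges which are
   not zeros. *)
Variable zs : seq R.
Hypothesis zs_uniq : uniq zs.
Hypothesis zsf : forall x, x <= Sminus r lam -> qw_den r lam 1 x = 0 -> x \in zs.
Hypothesis zsg : forall x, Splus r lam <= x -> qw_den r lam (-1) x = 0 -> x \in zs.

Let edges := [seq x <- [:: Sminus r lam; Splus r lam] | x \notin zs].
Let Z := edges ++ zs.

Let SmE : Sminus r lam = al - 2 * be. Proof. exact: SminusE. Qed.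
Let SpE : Splus r lam = al + 2 * be. Proof. exact: SplusE. Qed.

Let edgeZ x : x \in [:: Sminus r lam; Splus r lam] -> x \in Z.
Proof.
move=> xe; rewrite mem_cat mem_filter xe andbT.
by case: (x \in zs).
Qed.

Let out_lt x : x < al - 2 * be \/ al + 2 * be < x -> 4 * be ^+ 2 < (x - al) ^+ 2.
Proof.
move=> h; have -> : 4 * be ^+ 2 = (2 * be) ^+ 2 by ring.
have b2 : 0 < 2 * be by rewrite mulr_gt0.
rewrite -(real_normK (num_real (x - al))) ltr_pXn2r ?nnegrE ?normr_ge0 ?(ltW b2)//.
case: h => h; first by rewrite ltr0_norm; lra.
by rewrite gtr0_norm; lra.
Qed.

Let in_lt x : al - 2 * be < x < al + 2 * be -> (x - al) ^+ 2 < 4 * be ^+ 2.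
Proof.
move=> /andP[h1 h2]; have -> : 4 * be ^+ 2 = (2 * be) ^+ 2 by ring.
have b2 : 0 < 2 * be by rewrite mulr_gt0.
rewrite -(real_normK (num_real (x - al))) ltr_pXn2r ?nnegrE ?normr_ge0 ?(ltW b2)//.
by rewrite ltr_norml; apply/andP; split; lra.
Qed.

Let good_interval c d : c < d -> (forall x, c <= x <= d -> x \notin Z) ->
  exists s, forall x, c <= x <= d ->
     [/\ root_side s al be x, (x - al) ^+ 2 != 4 * be ^+ 2 & bD2 s x != 0].
Proof.
move=> cd hZ.
have Sm : Sminus r lam \in Z by apply: edgeZ; rewrite !inE eqxx.
have Sp : Splus r lam \in Z by apply: edgeZ; rewrite !inE eqxx orbT.
have nSm : ~ (c <= Sminus r lam <= d) by move=> /hZ; rewrite Sm.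
have nSp : ~ (c <= Splus r lam <= d) by move=> /hZ; rewrite Sp.
have mem x : c <= x <= d -> x \notin zs.
  by move=> /hZ; rewrite mem_cat negb_or => /andP[].
rewrite SmE in nSm; rewrite SpE in nSp.
have [h1|h1] := ltP d (al - 2 * be).
  exists 1 => x xin; have xlt : x < al - 2 * be.
    by case/andP: xin => _ /le_lt_trans; apply.
  have o := out_lt (or_introl xlt).
  split; [by left; split => //; have := be0; lra|by rewrite gt_eqF|].
  rewrite bd_den2_out ?(ltW o)// sqrf_eq0; apply: contra (mem x xin) => /eqP Dx.
  by apply: zsf => //; rewrite SmE ltW.
have h1' : al - 2 * be < c.
  by rewrite ltNge; apply/negP => h; apply: nSm; rewrite h h1.
have [h2|h2] := ltP (al + 2 * be) c.
  exists (-1) => x xin; have xlt : al + 2 * be < x.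
    by case/andP: xin => /(lt_le_trans h2).
  have o := out_lt (or_intror xlt).
  split; [by right; split => //; have := be0; lra|by rewrite gt_eqF|].
  rewrite bd_den2_out ?(ltW o)// sqrf_eq0; apply: contra (mem x xin) => /eqP Dx.
  by apply: zsg => //; rewrite SpE ltW.
have h2' : d < al + 2 * be.
  by rewrite ltNge; apply/negP => h; apply: nSp; rewrite h h2.
exists 1 => x /andP[cx xd].
have xin : al - 2 * be < x < al + 2 * be.
  by rewrite (lt_le_trans h1' cx) (le_lt_trans xd h2').
have o := in_lt xin.
split; [by left; split => //; have := be0; lra|by rewrite lt_eqF|].
exact: bd_den2_in.
Qed.

Let mp := measurable_qw_density r0 lam0.
Let p0 := qw_density_ge0 r0 r1 lam0.

(** [poisson_density] applies to every interval whose closure avoids Z. *)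
Lemma qw_mu_off_points B : measurable B ->
  qw_mu (B `\` [set` Z]) = dens (qw_density r lam) B.
Proof.
apply: (measure_off_points mp p0) => c d cd hZ.
have [s hs] := good_interval cd hZ.
have atom x : c <= x <= d -> qw_mu [set x] = 0%E.
  by move=> /hs[h1 _ h3]; exact: qw_mu_atom0 h1 h3.
apply: (poisson_density qw_poissonE cd mp p0).
- by apply: atom; rewrite lexx ltW.
- by apply: atom; rewrite lexx andbT ltW.
- move=> eta eta0.
  have [e0 e00 he] := green_uniform_limit be0 w10 w20 (ltW cd) eta0 hs.
  exists e0 => // e x ein xin.
  have ep : 0 < e by case/andP: ein.
  have [_ [ze [hz n1 im0 hg]]] := green_identity x ep.
  have [h1 h2 h3] := hs x xin.
  rewrite hg (qw_density_bd r0 r1 lam0 s h2).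
  exact: he e x ze ein xin hz n1 im0.
Qed.

Lemma qw_mu_decomp B : measurable B ->
  (qw_mu B = dens (qw_density r lam) B + qw_mu (B `&` [set` Z]))%E.
Proof.
move=> mB; rewrite -qw_mu_off_points// -measureU.
- by congr (qw_mu _); rewrite setDE -setIUr setvU setIT.
- exact: measurableD (measurable_seq Z).
- exact: measurableI (measurable_seq Z).
- by rewrite setDE -setIA (setIC (~` _)) -(setIA B) setICr !setI0.
Qed.

Let edge_null x : x \in edges -> qw_mu [set x] = 0%E.
Proof.
rewrite mem_filter !inE => /andP[xz /orP[]/eqP xE].
  have hs : root_side 1 al be x by left; split => //; rewrite xE SmE; have := be0; lra.
  apply: (qw_mu_atom0 hs); rewrite bd_den2_out; last first.
    by rewrite xE SmE (_ : (_ - al) ^+ 2 = 4 * be ^+ 2)//; ring.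
  rewrite sqrf_eq0; apply: contra xz => /eqP Dx; apply: zsf => //.
  by rewrite xE.
have hs : root_side (-1) al be x by right; split => //; rewrite xE SpE; have := be0; lra.
apply: (qw_mu_atom0 hs); rewrite bd_den2_out; last first.
  by rewrite xE SpE (_ : (_ - al) ^+ 2 = 4 * be ^+ 2)//; ring.
rewrite sqrf_eq0; apply: contra xz => /eqP Dx; apply: zsg => //.
by rewrite xE.
Qed.

Let qw_mu_seq (L : seq R) B : uniq L -> measurable B ->
  (qw_mu (B `&` [set` L]) = \sum_(x <- L) qw_mu [set x] * \d_x B)%E.
Proof.
move=> + mB; elim: L => [_|x L IH].
  rewrite big_nil (_ : [set` [::]] = set0) ?setI0 ?measure0//.
  by apply/seteqP; split.
rewrite cons_uniq => /andP[xL uL]; rewrite big_cons -IH//.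
have -> : B `&` [set` x :: L] = (B `&` [set x]) `|` (B `&` [set` L]).
  rewrite -setIUr; congr (_ `&` _); apply/seteqP; split => y /=; rewrite inE.
    by move=> /orP[/eqP|]; [left|right].
  by move=> [->|yL]; rewrite ?eqxx// yL orbT.
rewrite measureU//.
- congr (_ + _)%E; rewrite diracE; case: (boolP (x \in B)) => xB.
    rewrite mule1; congr (qw_mu _); apply/seteqP; split => y /=; first by case.
    by move=> ->; split=> //; exact: set_mem.
  rewrite mule0 (_ : B `&` [set x] = set0) ?measure0//.
  apply/seteqP; split => // y /= [yB yx]; move/negP: xB; apply.
  by rewrite -yx; exact: mem_set.
- exact: measurableI.
- exact: measurableI (measurable_seq L).
- apply/seteqP; split => // y /= [[_ yx] [_ yL]].
  by rewrite yx (negbTE xL) in yL.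
Qed.

Let Z_uniq : uniq Z.
Proof.
rewrite cat_uniq zs_uniq filter_uniq ?andbT/=; last first.
  rewrite inE andbT SmE SpE; apply/eqP; have := be0; lra.
by apply/hasPn => x xz; rewrite mem_filter xz.
Qed.

Lemma qw_mu_formula B : measurable B ->
  (qw_mu B = \sum_(x <- zs) qw_mu [set x] * \d_x B + dens (qw_density r lam) B)%E.
Proof.
move=> mB; rewrite qw_mu_decomp// addeC qw_mu_seq// big_cat/= big1_seq ?add0e//.
by move=> x /andP[_ /edge_null ->]; rewrite mul0e.
Qed.

Lemma qw_mu_ac_density : is_ac_density qw_mu (qw_density r lam).
Proof.
exists (dens_measure mp p0), (mrestr qw_mu (measurable_seq Z)); split.
- exact: dens_dominated.
- exists (~` [set` Z]); split.
  + exact: measurableC (measurable_seq Z).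
  + rewrite /mutually_singular/= /mrestr setICl; exact: (measure0 qw_mu).
  + rewrite setCK; apply/countable_lebesgue_measure0/finite_set_countable.
    exact: finite_seq.
- by move=> B mB; rewrite qw_mu_decomp.
- by split.
- by [].
Qed.

End points.

Lemma qw_spectrum s x : root_side s al be x -> 4 * be ^+ 2 <= (x - al) ^+ 2 ->
  qw_den r lam s x = 0 -> spectrum (qwC Bm Bp lam) x%:C.
Proof.
move=> hs ho Dx.
have zi0 : bd_root_im al be x = 0 by exact: bd_root_im_out.
have zE : bd_root s al be x = (bd_root_re s al be x)%:C by rewrite /bd_root zi0.
have hz := bd_root_joukowski be0 hs; rewrite zE in hz.
apply: (jacobi_spectrum hd Phi_orth T_Phi0 T_Phi1 T_Phi2 T_Phi3 be0C hz _ b1C b2C).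
  by rewrite -(normc_bd_root_out s ho) normc_bd_root_le1.
rewrite jacobi_den_green -zE green_den_bd /bd_num_im zi0 mulr0 mulr0.
by move: Dx; rewrite /qw_den => ->.
Qed.

End qw_measure.

Theorem theorem3p5 (R : realType) (r lam : R)
    (r_gt0 : 0 < r) (r_lt1 : r < 1) (lam_gt0 : 0 < lam)
    (H : completeNormedModType R[i]) (dot : {dot H for Num.conj})
    (H_hilbert : norm_of_dot dot)
    (Phi : nat -> H) (Phi_cons : complete_orthonormal dot Phi)
    (Bp Bm : {linear H -> H})
    (Bp_bounded : bounded_op Bp) (Bm_bounded : bounded_op Bm)
    (BpE : forall n, Bp (Phi n) = (Num.sqrt (om r n.+1))%:C *: Phi n.+1)
    (BmE : forall n, Bm (Phi n.+1) = (Num.sqrt (om r n.+1))%:C *: Phi n)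
    (Bm0 : Bm (Phi 0%N) = 0)
    (E : set R -> {linear H -> H})
    (E_spectral : is_spectral_measure dot E (qwC Bm Bp lam)) :
  let sigma := spectrum (qwC Bm Bp lam) in
  let mu := spectral_distribution dot E (Phi 0%N) in
  let p := qw_density r lam in
  let I0 := `]0, Sminus r lam] in
  let U := (Num.sqrt (om r 1) + Num.sqrt lam) ^+ 2 in
  let I1 := (`]alt1 r lam, U[) in
  let I2 := (`[Splus r lam, U[) in
  is_ac_density mu p /\
  (lam <= LambdaM r ->
     exists x0 x1 : R,
       [/\ is_unique_zero_in (qw_f r lam) I0 x0,
           is_unique_zero_in (qw_g r lam) I1 x1,
           sigma x0%:C /\ x0 \in I0,
           sigma x1%:C /\ x1 \in I1
         & forall B : set R, measurable B ->
             (mu B = mu [set x0] * \d_x0 B + mu [set x1] * \d_x1 B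
                  + \int[@lebesgue_measure R]_(x in B) (p x)%:E)%E]) /\
  (LambdaM r < lam < LambdaP r ->
     exists x1 : R,
       [/\ is_unique_zero_in (qw_g r lam) I1 x1,
           sigma x1%:C /\ x1 \in I1
         & forall B : set R, measurable B ->
             (mu B = mu [set x1] * \d_x1 B
                  + \int[@lebesgue_measure R]_(x in B) (p x)%:E)%E]) /\
  (LambdaP r <= lam ->
     exists x2 : R,
       [/\ is_unique_zero_in (qw_g r lam) I2 x2,
           sigma x2%:C /\ x2 \in I2
         & forall B : set R, measurable B ->
             (mu B = mu [set x2] * \d_x2 B
                  + \int[@lebesgue_measure R]_(x in B) (p x)%:E)%E]).
Proof.
move=> sigma mu p I0 U I1 I2.
have hE := E_spectral.
have [hP _ _] := E_spectral.
have muE B : measurable B -> mu B = qw_mu H_hilbert Phi E_spectral B.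
  by move=> mB; rewrite /mu (spectral_distributionE H_hilbert hP).
have be0 := qw_beta_gt0 r_gt0 lam_gt0.
have SmE := SminusE r_gt0 lam_gt0.
have SpE := SplusE r_gt0 lam_gt0.
have Ma := Sminus_lt_alt1 r_gt0 r_lt1 lam_gt0.
have UE : U = qw_top r lam by [].
have [x1 [Sx1 /andP[ax1 x1U] Dx1 ux1]] := qw_den_g_zero r_gt0 r_lt1 lam_gt0.
have x1ne : x1 != alt1 r lam by rewrite gt_eqF.
have g0 y : y != alt1 r lam -> (qw_g r lam y = 0%E) <-> (qw_den r lam (-1) y = 0).
  move=> ya; rewrite qw_gE//; have e := qw_fg_eq0 r_gt0 r_lt1 lam_gt0 (-1) ya.
  split => [[] /eqP|/eqP]; first by rewrite e => /eqP.
  by rewrite -e => /eqP ->.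
(* x1 lies to the right of the band, where the branch is s = -1 *)
have sp1 : sigma x1%:C.
  rewrite /sigma; apply: (qw_spectrum r_gt0 r_lt1 lam_gt0 H_hilbert Phi_cons BpE BmE Bm0 _ _ Dx1).
    by right; split => //; lra.
  have -> : 4 * qw_beta r lam ^+ 2 = (2 * qw_beta r lam) ^+ 2 by ring.
  by rewrite ler_pXn2r// ?nnegrE; lra.
(* all the cases follow from this, applied to the list of zeros at hand *)
have form zs : uniq zs ->
    (forall x, x <= Sminus r lam -> qw_den r lam 1 x = 0 -> x \in zs) ->
    (forall x, Splus r lam <= x -> qw_den r lam (-1) x = 0 -> x \in zs) ->
    is_ac_density mu p /\ forall B, measurable B ->
     (mu B = \sum_(x <- zs) mu [set x] * \d_x B +
       \int[@lebesgue_measure R]_(x in B) (p x)%:E)%E.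
  move=> uz zf zg; split.
    have [mac [msg [h1 h2 h3 h4 h5]]] := qw_mu_ac_density r_gt0 r_lt1 lam_gt0
      H_hilbert Phi_cons BpE BmE Bm0 E_spectral zf zg.
    exists mac, msg; split=> // B mB; rewrite muE//; exact: h3.
  move=> B mB; rewrite muE// (qw_mu_formula r_gt0 r_lt1 lam_gt0
      H_hilbert Phi_cons BpE BmE Bm0 E_spectral uz zf zg mB).
  by congr (_ + _)%E; apply: eq_bigr => x _; rewrite muE.
have only1 : LambdaM r < lam ->
   is_ac_density mu p /\ forall B, measurable B ->
     (mu B = mu [set x1] * \d_x1 B + \int[@lebesgue_measure R]_(x in B) (p x)%:E)%E.
  move=> hl; have [] := form [:: x1] isT.
  - move=> x xS Dx; have := qw_den_f_neq0 r_gt0 r_lt1 lam_gt0 hl xS.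
    by rewrite Dx eqxx.
  - by move=> x xS Dx; rewrite inE (ux1 _ xS Dx).
  - by move=> h1 h2; split => // B mB; rewrite h2// big_seq1.
have gu1 : Splus r lam < alt1 r lam -> is_unique_zero_in (qw_g r lam) I1 x1.
  move=> Sa; split.
    by rewrite in_itv/= ax1 x1U; split => //; apply/g0.
  move=> y [/=]; rewrite in_itv/= => /andP[ay _] gy.
  apply/esym/ux1; first exact: ltW (lt_trans Sa ay).
  by apply/g0 => //; rewrite gt_eqF.
have [hM|hM] := leP lam (LambdaM r); last first.
  have [hac hmu] := only1 hM; split=> //; split=> //; split.
    move=> /= hP'; exists x1; split=> //; last by rewrite in_itv/= ax1.
    by apply: gu1; rewrite Splus_alt1.
  move=> hP'; have aS : alt1 r lam <= Splus r lam.
    by rewrite leNgt Splus_alt1// -leNgt.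
  exists x1; split=> //; last by rewrite in_itv/= (ltW Sx1) x1U.
  split.
    by rewrite in_itv/= (ltW Sx1) x1U; split => //; apply/g0.
  move=> y [/=]; rewrite in_itv/= => /andP[Sy _] gy.
  (* I2 is closed at S+, so y = alt1 can only occur for S+ = alt1 *)
  have [ya|ya] := eqVneq y (alt1 r lam).
    have Sa : Splus r lam = alt1 r lam by apply/eqP; rewrite eq_le aS -{1}ya Sy.
    by move: gy; rewrite ya qw_g_alt1.
  by apply/esym/ux1 => //; apply/g0.
have hP' : lam < LambdaP r by apply: (le_lt_trans hM); exact: LambdaM_ltP.
have Sa : Splus r lam < alt1 r lam by rewrite Splus_alt1.
have [x0 [/andP[x00 x0S] Dx0 ux0]] := qw_den_f_zero r_gt0 r_lt1 lam_gt0 hM.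
have x01 : x0 < x1 by apply: (le_lt_trans x0S); lra.
have [||//|hac hmu] := form [:: x0; x1].
- by rewrite /= inE lt_eqF.
- by move=> x xS Dx; rewrite inE (ux0 _ xS Dx) eqxx.
- by move=> x xS Dx; rewrite !inE (ux1 _ xS Dx) eqxx orbT.
split=> //; split; last first.
  by split => //; rewrite leNgt hP'.
move=> _; exists x0, x1; split.
- have f0 y : y <= Sminus r lam -> (qw_f r lam y = 0%E) <-> (qw_den r lam 1 y = 0).
    move=> yS; have ya : y != alt1 r lam by rewrite lt_eqF// (le_lt_trans yS).
    rewrite qw_fE//; have e := qw_fg_eq0 r_gt0 r_lt1 lam_gt0 1 ya.
    split => [[] /eqP|/eqP]; first by rewrite e => /eqP.
    by rewrite -e => /eqP ->.
  split; first by rewrite in_itv/= x00 x0S; split => //; apply/f0.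
  move=> y [/=]; rewrite in_itv/= => /andP[_ yS] fy.
  by apply/esym/ux0 => //; apply/f0.
- exact: gu1.
- split; last by rewrite in_itv/= x00.
  rewrite /sigma; apply: (qw_spectrum r_gt0 r_lt1 lam_gt0 H_hilbert Phi_cons BpE BmE Bm0 _ _ Dx0).
    by left; split => //; lra.
  have -> : 4 * qw_beta r lam ^+ 2 = (2 * qw_beta r lam) ^+ 2 by ring.
  by rewrite -(sqrrN (x0 - _)) ler_pXn2r// ?nnegrE; lra.
- by split => //; rewrite in_itv/= ax1.
- by move=> B mB; rewrite hmu// big_cons big_seq1.
Qed.
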